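(* Let $q>0$. Suppose that $c_0\in(0,1)$ and $c_i>0$ for $i=1,2,3$. Consider, for $0<x<1$, $t>0$, the coupled system $$\widetilde z_{tt}(x,t)=\widetilde z_{xx}(x,t),\quad \widetilde z_x(0,t)=\tfrac{c_1}{1-c_0}\widetilde z(0,t)+\tfrac{c_0}{1-c_0}\widetilde z_t(0,t),\quad \widetilde z(1,t)=0,$$ $$\varepsilon_{tt}(x,t)=\varepsilon_{xx}(x,t),\quad \varepsilon_x(0,t)=c_1\varepsilon(0,t),\quad \varepsilon_x(1,t)=-\widetilde z_x(1,t)-Y_x(1,t),$$ $$Y_t(x,t)=-Y_x(x,t),\quad Y(0,t)=-c_0\varepsilon(0,t),$$ $$\widetilde w_{tt}(x,t)=\widetilde w_{xx}(x,t)-(c_1+q)(c_2+q)e^{qx}\varepsilon(0,t),$$ $$\widetilde w_x(0,t)=c_2\widetilde w(0,t)+(c_1+q)\varepsilon(0,t),\quad \widetilde w_x(1,t)=-c_3\widetilde w_t(1,t).$$ For any initial value $(\varepsilon_0,\varepsilon_1,Y_0,\widetilde z_0,\widetilde z_1,\widetilde w_0,\widetilde w_1)\in\mathcal{X}$ of $(\varepsilon,\varepsilon_t,Y,\widetilde z,\widetilde z_t,\widetilde w,\widetilde w_t)$ at $t=0$ with the compatibility condition $Y_0(0)=-c_0\varepsilon_0(0)$, there exists a unique solution $(\varepsilon,\varepsilon_t,Y,\widetilde z,\widetilde z_t,\widetilde w,\widetilde w_t)\in C(0,\infty;\mathcal{X})$ to this system, and $$\|(\varepsilon,\varepsilon_t,Y,\widetilde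 z,\widetilde z_t,\widetilde w,\widetilde w_t)(\cdot,t)\|_{\mathcal{X}}\le Me^{-\mu t},\quad t\ge0,$$ with some $M,\mu>0$.
   Context: $\mathbb{H}=H^1(0,1)\times L^2(0,1)$ with the usual inner product, $H^1_R(0,1)=\{\phi\in H^1(0,1):\phi(1)=0\}$, and $\mathcal{X}=\mathbb{H}\times H^1(0,1)\times H^1_R(0,1)\times L^2(0,1)\times\mathbb{H}$. $C(0,\infty;X)$ denotes the continuous functions $[0,\infty)\to X$; solutions with this regularity are understood in the usual generalized (mild/weak) sense. *)

(* Defs.v *)
From HB Require Import structures.
From mathcomp Require Import all_boot all_order all_algebra.
From mathcomp Require Import all_classical all_reals all_analysis.

Set Implicit Arguments.
Unset Strict Implicit.
Unset Printing Implicit Defensive.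
Import Order.TTheory GRing.Theory Num.Theory.
Import numFieldNormedType.Exports.
Local Open Scope classical_set_scope.
Local Open Scope ring_scope.

(* Elements of L^2(0,1) and H^1(0,1) are represented by total functions
   R -> R of which only the values on (0,1), resp. [0,1], matter; the library
   has no normed quotient space L^p. *)
Section Sobolev.
Variable R : realType.
Local Notation mu := (@lebesgue_measure R).
Implicit Types u v : R -> R.

Definition zext u : R -> R := u \* \1_`]0, 1[%classic.

Definition L2 u : Prop := zext u \in Lfun mu 2%:E.

Definition L2norm u : R := fine ('N[mu]_2%:E [EFin \o zext u])%E.

(* u is absolutely continuous on [0,1] with derivative v in L^2(0,1).  The
   equation is required at every point of [0,1], so u is the continuous
   representative of its class and u 0, u 1 are its traces. *)
Definition H1deriv u v : Prop :=
  L2 v /\ forall x, 0 <= x <= 1 -> u x = u 0 + \int[mu]_(y in `]0, x[) v y.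

Definition H1 u : Prop := exists v, H1deriv u v.

Definition H1R u : Prop := H1 u /\ u 1 = 0.

(* The derivative is determined a.e., so the norm does not depend on the
   choice made by xget. *)
Definition H1norm u : R :=
  Num.sqrt (L2norm u ^+ 2 + L2norm (xget (cst 0) [set v | H1deriv u v]) ^+ 2).

Definition eq_ae01 u v : Prop := u = v %[ae mu in `]0, 1[%classic].

End Sobolev.

(* (eps, eps_t, Y, z~, z~_t, w~, w~_t) at a fixed time. *)
Record state (R : realType) := State {
  s_eps : R -> R; s_epst : R -> R; s_Y : R -> R; s_z : R -> R;
  s_zt : R -> R; s_w : R -> R; s_wt : R -> R }.

Section StateSpace.
Variable R : realType.
Implicit Types U V : state R.

Definition sub_state U V : state R :=
  State (s_eps U \- s_eps V) (s_epst U \- s_epst V) (s_Y U \- s_Y V)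
    (s_z U \- s_z V) (s_zt U \- s_zt V) (s_w U \- s_w V) (s_wt U \- s_wt V).

Definition scale_state (a : R) U : state R :=
  State (a \*o s_eps U) (a \*o s_epst U) (a \*o s_Y U)
    (a \*o s_z U) (a \*o s_zt U) (a \*o s_w U) (a \*o s_wt U).

Definition inX U : Prop :=
  [/\ H1 (s_eps U) /\ L2 (s_epst U), H1 (s_Y U),
      H1R (s_z U) /\ L2 (s_zt U) & H1 (s_w U) /\ L2 (s_wt U)].

Definition Xnorm U : R :=
  Num.sqrt (H1norm (s_eps U) ^+ 2 + L2norm (s_epst U) ^+ 2
    + H1norm (s_Y U) ^+ 2
    + H1norm (s_z U) ^+ 2 + L2norm (s_zt U) ^+ 2
    + H1norm (s_w U) ^+ 2 + L2norm (s_wt U) ^+ 2).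

(* Two states of X are the same element of X iff their distance is 0. *)
Definition Xdist U V : R := Xnorm (sub_state U V).

(* U belongs to C(0,oo; X): only times t >= 0 matter. *)
Definition Xcontinuous (U : R -> state R) : Prop :=
  forall t, 0 <= t ->
    inX (U t) /\
    Xdist (U s) (U t) @[s --> within [set s | 0 <= s] (nbhs t)] --> (0 : R).

(* V t = \int_0^t U s ds as an X-valued integral, expressed by V 0 = 0 and
   V' = U, with the derivative taken in the norm of X. *)
Definition Xprimitive (U V : R -> state R) : Prop :=
  [/\ forall t, 0 <= t -> inX (V t),
      Xnorm (V 0) = 0 &
      forall t, 0 <= t ->
        Xdist (scale_state (s - t)^-1 (sub_state (V s) (V t))) (U t)
          @[s --> within [set s | 0 <= s] (dnbhs t)] --> (0 : R)].

End StateSpace.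

Section System.
Variable R : realType.
Variables q c0 c1 c2 c3 : R.
Implicit Types U V W : state R.

(* V lies in the domain of the operator A of the system and A V = W.
   Equivalently, V and W satisfy the equations and boundary conditions of the
   system when V is read as the state and W as its time derivative; thus the
   boundary values z~_t(0) and w~_t(1) are those of s_z W and s_w W.
   Functions with a subscript x are x-derivatives of the components of V;
   those evaluated at 0 or 1 are in H^1. *)
Definition system_op V W : Prop :=
  exists z_x z_xx eps_x eps_xx Y_x w_x w_xx : R -> R,
  [/\ [/\ H1deriv (s_z V) z_x /\ H1deriv z_x z_xx,
          eq_ae01 (s_z W) (s_zt V) /\ eq_ae01 (s_zt W) z_xx,
          z_x 0 = c1 / (1 - c0) * s_z V 0 + c0 / (1 - c0) * s_z W 0 &
          s_z V 1 = 0],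
      [/\ H1deriv (s_eps V) eps_x /\ H1deriv eps_x eps_xx,
          eq_ae01 (s_eps W) (s_epst V) /\ eq_ae01 (s_epst W) eps_xx,
          eps_x 0 = c1 * s_eps V 0 &
          eps_x 1 = - z_x 1 - Y_x 1],
      [/\ H1deriv (s_Y V) Y_x /\ H1 Y_x,
          eq_ae01 (s_Y W) (\- Y_x) &
          s_Y V 0 = - c0 * s_eps V 0] &
      [/\ H1deriv (s_w V) w_x /\ H1deriv w_x w_xx,
          eq_ae01 (s_w W) (s_wt V) /\
          eq_ae01 (s_wt W) (fun x =>
            w_xx x - (c1 + q) * (c2 + q) * expR (q * x) * s_eps V 0),
          w_x 0 = c2 * s_w V 0 + (c1 + q) * s_eps V 0 &
          w_x 1 = - c3 * s_w W 1]].

(* Mild solution of U' = A U, U(0) = U0: U is in C(0,oo; X), and for t >= 0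
   \int_0^t U ds is in the domain of A with
   U(t) = U(0) + A (\int_0^t U ds). *)
Definition mild_solution U0 (U : R -> state R) : Prop :=
  [/\ Xcontinuous U, Xdist (U 0) U0 = 0 &
      exists V : R -> state R, Xprimitive U V /\
        forall t, 0 <= t -> system_op (V t) (sub_state (U t) (U 0))].

End System.

(* Main.v *)
Require Import Defs.
From HB Require Import structures.
From mathcomp Require Import all_boot all_order all_algebra.
From mathcomp Require Import all_classical all_reals all_analysis.
From mathcomp Require Import measurable_realfun.
From mathcomp Require Import ring lra.
Set Implicit Arguments.
Unset Strict Implicit.
Unset Printing Implicit Defensive.
Import Order.TTheory GRing.Theory Num.Theory.
Import numFieldNormedType.Exports.
Local Open Scope classical_set_scope.
Local Open Scope ring_scope.

(* Uniqueness and decay: the Riemann invariants with affine weights, trace terms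
   and a cross term that controls the boundary value at x = 0 give a bounded
   coercive bilinear form B on X with B(V,W) + B(W,V) <= - m B(V,V) whenever
   A V = W and W satisfies the compatibility condition.  The system is a cascade
   z -> (eps, Y) -> w, so the forms of the three parts are added with suitable
   constants.  A mild solution U is not in the domain of A, but the difference
   quotients of its primitive are, and B decays along them.  The difference of
   two solutions decays from 0, hence vanishes.

   Existence: each wave is f(t+x) + g(t-x) (plus b(t) e^{qx} for w, where
   b'' = q^2 b - (c1+q)(c2+q) eps(0,t)).  The condition at x = 0 determines g from
   f through a linear ODE, the one at x = 1 determines f at time t+1 from earlier
   values, so f and g are obtained step by step.  Since Y(x,t) = Y(0,t-x), the
   datum Y_0 fixes eps(0,.) on (-1,0).  The trajectory is continuous in X by
   continuity of translations in L^2. *)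

(** The boundary condition of eps at x = 1 contains the trace of Y_x, which the norm of X does not
    control. It is handled at the level of Y_x, a transported quantity with inflow Y_x(0) = - Y_t(0)
    = c0 eps_t(0); that identity is the compatibility condition for the time derivative. Since [inX]
    does not contain this condition, the dissipation estimate assumes it for [W], and mild solutions
    recover it from the domain of the operator. Each wave is damped at one end only: z and eps at x
    = 0, w at x = 1. The weights make the undamped end slightly lossy, and their slope [d] is so
    small that the damping pays for them at the other end. For data in X the profiles f and g are
    merely H^1, so conditions on x-derivatives have no pointwise meaning in time. They are imposed
    after one integration in time, as relations between increments of f and g and the integral of f
    + g. The mild formulation asks exactly for this: the primitive of a trajectory is the same
    d'Alembert expression with f and g replaced by antiderivatives. *)

Section realintegrable.
Context {R : realType}.
Local Notation mu := (@lebesgue_measure R).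
Implicit Types (E : set R) (f g : R -> R).

Lemma le_integrable_EFin E f g : measurable E -> measurable_fun E f ->
  (forall x, E x -> `|f x| <= g x) -> mu.-integrable E (EFin \o g) ->
  mu.-integrable E (EFin \o f).
Proof.
move=> mE mf fg; apply: le_integrable => //; first exact/measurable_EFinP.
by move=> x Ex /=; rewrite lee_fin (le_trans (fg _ Ex))// ler_norm.
Qed.

Lemma integrable_addR E f g : measurable E ->
  mu.-integrable E (EFin \o f) -> mu.-integrable E (EFin \o g) ->
  mu.-integrable E (EFin \o (fun x => f x + g x)).
Proof.
move=> mE fi gi; rewrite (_ : _ \o _ = ((EFin \o f) \+ (EFin \o g))%E)//.
exact: integrableD.
Qed.

Lemma integrable_subR E f g : measurable E ->
  mu.-integrable E (EFin \o f) -> mu.-integrable E (EFin \o g) ->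
  mu.-integrable E (EFin \o (fun x => f x - g x)).
Proof.
move=> mE fi gi; rewrite (_ : _ \o _ = ((EFin \o f) \- (EFin \o g))%E)//.
exact: integrableB.
Qed.

Lemma integrable_scaleR E f (k : R) : measurable E ->
  mu.-integrable E (EFin \o f) ->
  mu.-integrable E (EFin \o (fun x => k * f x)).
Proof.
move=> mE fi; rewrite (_ : _ \o _ = (fun x => k%:E * (EFin \o f) x)%E)//.
exact: integrableZl.
Qed.

Lemma integrable_cstR E (k : R) : measurable E -> (mu E < +oo)%E ->
  mu.-integrable E (EFin \o (fun=> k)).
Proof.
move=> mE Eoo; apply/integrableP; split; first exact: measurable_cst.
rewrite (_ : integral _ _ _ = (`|k|%:E * mu E)%E).
  by rewrite lte_mul_pinfty// lee_fin.
by rewrite -integral_cst.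
Qed.

Lemma measurable_affine (a b : R) (E : set R) : measurable_fun E (fun x => a + b * x).
Proof. by apply: measurable_funD => //; exact: measurable_funM. Qed.
End realintegrable.

(** * The inner product of L^2(0,1) *)

Section L2.
Variable R : realType.
Local Notation mu := (@lebesgue_measure R).
Local Notation D := (`]0, 1[%classic : set R).
Implicit Types u v w : R -> R.

Definition ip u v : R := \int[mu]_(x in D) (u x * v x).

Lemma measD : measurable D. Proof. exact: measurable_itv. Qed.
Hint Resolve measD : core.

Lemma muD : mu D = 1%E.
Proof. by rewrite lebesgue_measure_itv/= lte_fin ltr01 oppr0 adde0. Qed.

Lemma zext_restrict u : zext u = u \_ D.
Proof.
apply/funext => x; rewrite /zext/= indicE patchE.
by case: ifP => _; rewrite ?mulr1 ?mulr0.
Qed.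

Lemma restrict_sqr u :
  (EFin \o (fun x => zext u x ^+ 2)) = (EFin \o (fun x => u x ^+ 2)) \_ D.
Proof.
apply/funext => x; rewrite /= zext_restrict !patchE; case: ifP => //= _.
by rewrite expr0n.
Qed.

Lemma Lnorm_zext u : 'N[mu]_2%:E [EFin \o zext u]%E =
  ((\int[mu]_(x in D) ((u x ^+ 2)%:E)) `^ 2^-1)%E.
Proof.
rewrite unlock/=; congr (_ `^ _)%E.
rewrite [RHS]integral_mkcond; apply: eq_integral => x _/=.
rewrite -[in RHS](restrict_sqr u)/=.
by rewrite powR_mulrn// real_normK// num_real.
Qed.

Lemma L2E u : L2 u <->
  measurable_fun D u /\ mu.-integrable D (EFin \o (fun x => u x ^+ 2)).
Proof.
split.
- move=> uL; have := Lfun2_integrable_sqr uL; rewrite restrict_sqr => iu.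
  move: uL; rewrite /L2 inE => /andP[]; rewrite inE/= zext_restrict => mu_ _.
  split; first exact/measurable_restrictT.
  by have := (integrable_restrict mu measD measurableT _).2 iu; rewrite setTI.
- move=> [mu_ iu]; rewrite /L2 inE; apply/andP; split; rewrite inE/=.
    by rewrite zext_restrict; exact/(measurable_restrictT _ _).1.
  rewrite /finite_norm Lnorm_zext poweR_lty//.
  move/integrableP : iu => [_]; apply: le_lt_trans.
  rewrite le_eqVlt; apply/orP; left; apply/eqP/eq_integral => x _ /=.
  by rewrite ger0_norm ?sqr_ge0.
Qed.

Lemma L2_mul_integrable u v : L2 u -> L2 v ->
  mu.-integrable D (EFin \o (fun x => u x * v x)).
Proof.
move=> /L2E[mu_ iu] /L2E[mv iv].
apply: (le_integrable_EFin measD _ _ (integrable_addR measD iu iv)).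
  exact: measurable_funM.
move=> x _ /=; rewrite ler_norml; apply/andP; split; nra.
Qed.

(** Valid for every [u]: if the integral is infinite, so is its power, and [fine] sends both to
    0. *)
Lemma L2norm_ip u : L2norm u = Num.sqrt (ip u u).
Proof.
rewrite /L2norm Lnorm_zext /ip /Rintegral.
under [in RHS]eq_integral do rewrite -expr2.
have : (0 <= \int[mu]_(x in D) ((u x ^+ 2)%:E))%E.
  by apply: integral_ge0 => x _; rewrite lee_fin sqr_ge0.
case: (integral _ _ _) => [r|_|//]/=.
  by rewrite lee_fin => r0; rewrite powR12_sqrt.
by rewrite invr_eq0 pnatr_eq0 sqrtr0.
Qed.

Lemma L2_cst (k : R) : L2 (cst k).
Proof.
apply/L2E; split; first exact: measurable_cst.
by apply: (@integrable_cstR _ _ (k ^+ 2)); rewrite ?muD ?ltry.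
Qed.

Lemma L2_ext u v : {in D, u =1 v} -> L2 u -> L2 v.
Proof.
move=> uv; rewrite /L2 (_ : zext v = zext u)//.
by rewrite !zext_restrict; apply/esym/eq_restrictP.
Qed.

Lemma L2D u v : L2 u -> L2 v -> L2 (u \+ v).
Proof.
move=> uL vL; have iuv := L2_mul_integrable uL vL.
move: uL vL => /L2E[mu_ iu] /L2E[mv iv]; apply/L2E; split.
  exact: measurable_funD.
rewrite (_ : (fun x => _) =
    fun x => u x ^+ 2 + (2 * (u x * v x) + v x ^+ 2)); last first.
  by apply/funext => x /=; ring.
do 2 apply: integrable_addR => //; exact: integrable_scaleR.
Qed.

Lemma L2_bM (a : R -> R) (M : R) u : measurable_fun D a ->
  (forall x, 0 < x < 1 -> `|a x| <= M) -> L2 u -> L2 (a \* u).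
Proof.
move=> ma aM /L2E[mu_ iu]; apply/L2E; split; first exact: measurable_funM.
apply: (le_integrable_EFin measD _ _ (integrable_scaleR (M ^+ 2) measD iu)).
  by apply/measurable_funX; exact: measurable_funM.
move=> x /=; rewrite in_itv/= => /aM xM; rewrite exprMn.
rewrite normrM ler_pM// !ger0_norm ?sqr_ge0//.
by rewrite -[leLHS]real_normK ?num_real// ler_pXn2r ?nnegrE//
  (le_trans _ xM).
Qed.

Lemma L2Z (k : R) u : L2 u -> L2 (k \*o u).
Proof. by apply: (@L2_bM (cst k) `|k|) => //; exact: measurable_cst. Qed.

Lemma L2N u : L2 u -> L2 (\- u).
Proof.
by move=> /(L2Z (-1)); apply: L2_ext => x _ /=; rewrite mulN1r.
Qed.

Lemma L2B u v : L2 u -> L2 v -> L2 (u \- v).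
Proof. by move=> uL /L2N vL; exact: L2D. Qed.

Lemma L2_integrable u : L2 u -> mu.-integrable D (EFin \o u).
Proof.
move=> uL; have := L2_mul_integrable uL (L2_cst 1).
rewrite (_ : (fun x => _) = u)//.
by apply/funext => x; rewrite /= mulr1.
Qed.

Lemma ipC u v : ip u v = ip v u.
Proof. by apply: eq_Rintegral => x _; rewrite mulrC. Qed.

Lemma ipDl u v w : L2 u -> L2 v -> L2 w -> ip (u \+ v) w = ip u w + ip v w.
Proof.
move=> uL vL wL; rewrite -RintegralD//; try exact: L2_mul_integrable.
by apply: eq_Rintegral => x _ /=; rewrite mulrDl.
Qed.

Lemma ipBl u v w : L2 u -> L2 v -> L2 w -> ip (u \- v) w = ip u w - ip v w.
Proof.
move=> uL vL wL; rewrite -RintegralB//; try exact: L2_mul_integrable.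
by apply: eq_Rintegral => x _ /=; rewrite mulrBl.
Qed.

Lemma ipZl k u w : L2 u -> L2 w -> ip (k \*o u) w = k * ip u w.
Proof.
move=> uL wL; rewrite -RintegralZl//; last exact: L2_mul_integrable.
by apply: eq_Rintegral => x _ /=; rewrite mulrA.
Qed.

Lemma ipDr u v w : L2 u -> L2 v -> L2 w -> ip w (u \+ v) = ip w u + ip w v.
Proof. by move=> *; rewrite ipC ipDl// !(ipC w). Qed.

Lemma ipBr u v w : L2 u -> L2 v -> L2 w -> ip w (u \- v) = ip w u - ip w v.
Proof. by move=> *; rewrite ipC ipBl// !(ipC w). Qed.

Lemma ipZr k u w : L2 u -> L2 w -> ip w (k \*o u) = k * ip w u.
Proof. by move=> *; rewrite ipC ipZl// (ipC w). Qed.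

Lemma ip_ge0 u : 0 <= ip u u.
Proof. by apply: Rintegral_ge0 => x _; rewrite -expr2 sqr_ge0. Qed.

Lemma sqr_L2norm u : L2norm u ^+ 2 = ip u u.
Proof. by rewrite L2norm_ip sqr_sqrtr// ip_ge0. Qed.

(** The squared norm of [u - k v] is nonnegative for every [k]; the optimal [k] gives the
    inequality. If [ip v v] is 0 the expression is affine in [k], which forces [ip u v] to
    vanish. *)
Lemma ip_CS u v : L2 u -> L2 v -> ip u v ^+ 2 <= ip u u * ip v v.
Proof.
move=> uL vL; have key k : 0 <= ip u u - 2 * k * ip u v + k ^+ 2 * ip v v.
  have := ip_ge0 (u \- (k \*o v)); have kv := L2Z k vL.
  rewrite !(ipBl, ipBr)//; try exact: L2B.
  by rewrite !(ipZl, ipZr)// (ipC v u) => /le_trans; apply; nra.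
have [v0|v0] := eqVneq (ip v v) 0; last first.
  have {}v0 : 0 < ip v v by rewrite lt0r v0 ip_ge0.
  have := key (ip u v / ip v v).
  rewrite -(ler_pM2r v0) mul0r.
  rewrite (_ : (_ - _ + _) * _ = ip u u * ip v v - ip u v ^+ 2) ?subr_ge0//.
  by field; rewrite gt_eqF.
rewrite v0 mulr0; have [->|uv0] := eqVneq (ip u v) 0; first by rewrite expr0n.
(* With this [k] the nonnegative quantity would equal -1. *)
have := key ((ip u u + 1) / (2 * ip u v)).
rewrite v0 mulr0 addr0 (_ : 2 * _ * _ = ip u u + 1); last by field.
by rewrite opprD addNKr oppr_ge0 ler10.
Qed.

Lemma ip_ae u u' v : L2 u -> L2 u' -> L2 v -> eq_ae01 u u' ->
  ip u v = ip u' v.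
Proof.
move=> uL uL' vL uu'; congr fine; apply: ae_eq_integral => //.
- by have := L2_mul_integrable uL vL => /measurable_int.
- by have := L2_mul_integrable uL' vL => /measurable_int.
- move: uu'; apply: filterS; first exact: (ae_filter_ringOfSetsType mu).
  by move=> x /= + xD => ->.
Qed.

Lemma L2_affM (a b : R) u : L2 u -> L2 (fun x => (a + b * x) * u x).
Proof.
apply: (@L2_bM _ (`|a| + `|b|)); first exact: measurable_affine.
move=> x /andP[x0 x1]; rewrite (le_trans (ler_normD _ _))// lerD2l normrM.
by rewrite ler_piMr// ger0_norm ltW.
Qed.

End L2.

(** * Fubini on a triangle *)

Section fubini.
Variable R : realType.
Local Notation mu := (@lebesgue_measure R).
Implicit Types f g : R -> R.

Lemma measurable_lt_pair : measurable [set p : R * R | p.2 < p.1].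
Proof.
have := @measurable_fun_ltr _ _ R setT (@snd R R) (@fst R R) _ _.
move=> /(_ measurable_snd measurable_fst measurableT [set true] _)/=.
rewrite setTI (_ : _ @^-1` _ = [set p : R * R | p.2 < p.1]).
  by apply.
by apply/seteqP; split => -[x y].
Qed.

Lemma integral_indic_EFin f (E : set R) : measurable E ->
  mu.-integrable setT (EFin \o f) ->
  (\int[mu]_y (f y * \1_E y)%:E = (\int[mu]_(y in E) f y)%:E)%E.
Proof.
move=> mE fi; rewrite /Rintegral fineK; last first.
  by apply: integrable_fin_num => //; exact: integrableS fi.
rewrite [RHS]integral_mkcond; apply: eq_integral => y _.
by rewrite patchE indicE/=; case: ifP => _; rewrite ?mulr1 ?mulr0.
Qed.

(** Both sides integrate [f y * g s] over the half-plane [y < s]. This is the source of integration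
    by parts for absolutely continuous functions. *)
Lemma Fubini_triangle f g : mu.-integrable setT (EFin \o f) ->
  mu.-integrable setT (EFin \o g) ->
  \int[mu]_s (g s * \int[mu]_(y in `]-oo, s[) f y) =
  \int[mu]_y (f y * \int[mu]_(s in `]y, +oo[) g s).
Proof.
move=> fi gi.
have mf : measurable_fun setT f by move/measurable_int: fi => /measurable_EFinP.
have mg : measurable_fun setT g by move/measurable_int: gi => /measurable_EFinP.
pose h (p : R * R) := (g p.1 * f p.2 * \1_[set p : R * R | p.2 < p.1] p)%:E.
have mh : measurable_fun setT h.
  apply/measurable_EFinP; apply: measurable_funM; last exact: measurable_indic measurable_lt_pair.
  by apply: measurable_funM; apply: measurableT_comp.
have Ilt s y : \1_[set p : R * R | p.2 < p.1] (s, y) = \1_(`]-oo, s[%classic : set R) y :> R.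
  by rewrite !indicE; congr (_%:R); apply/idP/idP; rewrite !inE/= in_itv.
have Igt s y : \1_[set p : R * R | p.2 < p.1] (s, y) = \1_(`]y, +oo[%classic : set R) s :> R.
  rewrite !indicE; suff -> : ((s, y) \in [set p : R * R | p.2 < p.1]) =
      (s \in (`]y, +oo[%classic : set R)) by [].
  by apply/idP/idP; rewrite !inE/= in_itv/= andbT.
(* Integrability on the product comes from Tonelli, after bounding the indicator by 1. *)
have hi : (mu \x mu)%E.-integrable setT h.
  apply/integrable12ltyP => //.
  apply: (@le_lt_trans _ _ (\int[mu]_s (`|g s| * \int[mu]_y `|f y|)%:E)%E).
    have nfi : mu.-integrable setT (EFin \o (fun y => `|f y|)).
      exact: integrable_norm.
    apply: ge0_le_integral => //.
    - by move=> s _; apply: integral_ge0.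
    - have mah : measurable_fun setT (abse \o h) by exact: measurableT_comp.
      by apply: (@measurable_fun_fubini_tonelli_F _ _ _ _ R mu (abse \o h) mah) => p; exact: abse_ge0.
    - apply/measurable_EFinP; apply: measurable_funM => //.
      exact: measurableT_comp.
    - move=> s _; rewrite EFinM /Rintegral fineK; last exact: integrable_fin_num.
      rewrite -ge0_integralZl//; last by apply/measurable_EFinP; exact: measurableT_comp.
      apply: ge0_le_integral => //.
      + apply: measurableT_comp => //; exact: measurableT_comp.
      + apply/measurable_EFinP; apply: measurable_funM => //; exact: measurableT_comp.
      + move=> y _; rewrite /h/= -EFinM lee_fin !normrM ler_piMr ?mulr_ge0//.
        by rewrite indicE; case: (_ \in _); rewrite ?normr1 ?normr0.
  rewrite -ge0_fin_numE; last first.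
    by apply: integral_ge0 => s _; rewrite lee_fin mulr_ge0// Rintegral_ge0.
  apply: integrable_fin_num => //.
  rewrite (_ : (fun s => _) = EFin \o (fun s => (\int[mu]_y `|f y|) * `|g s|)); last first.
    by apply/funext => s /=; rewrite mulrC.
  apply: integrable_scaleR => //; exact: integrable_norm.
have := Fubini hi.
have -> : (\int[mu]_s \int[mu]_y h (s, y) =
   \int[mu]_s (g s * \int[mu]_(y in `]-oo, s[) f y)%:E)%E.
  apply: eq_integral => s _; rewrite EFinM -integral_indic_EFin//.
  rewrite -integralZl//; last first.
    apply: (le_integrable_EFin _ _ _ (integrable_norm fi)) => //.
      by apply: measurable_funM => //; exact: measurable_indic.
    move=> y _; rewrite normrM ler_piMr// indicE.
    by case: (_ \in _); rewrite ?normr1 ?normr0.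
  by apply: eq_integral => y _; rewrite /h/= Ilt -EFinM mulrA.
have -> : (\int[mu]_y \int[mu]_s h (s, y) =
   \int[mu]_y (f y * \int[mu]_(s in `]y, +oo[) g s)%:E)%E.
  apply: eq_integral => y _; rewrite EFinM -integral_indic_EFin//.
  rewrite -integralZl//; last first.
    apply: (le_integrable_EFin _ _ _ (integrable_norm gi)) => //.
      by apply: measurable_funM => //; exact: measurable_indic.
    move=> s _; rewrite normrM ler_piMr// indicE.
    by case: (_ \in _); rewrite ?normr1 ?normr0.
  by apply: eq_integral => s _; rewrite /h/= Igt -EFinM mulrA (mulrC (g s)).
by move=> fub; rewrite /Rintegral fub.
Qed.
End fubini.

(** * Absolutely continuous functions on [0,1] *)

Section H1.
Variable R : realType.
Local Notation mu := (@lebesgue_measure R).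
Local Notation D := (`]0, 1[%classic : set R).
Local Notation I := (`[0, 1]%classic : set R).
Implicit Types u v w : R -> R.

Lemma Rintegral_itvoo_split (f : R -> R) (a c b : R) : a <= c <= b ->
  mu.-integrable `]a, b[ (EFin \o f) ->
  \int[mu]_(y in `]a, b[) f y =
  \int[mu]_(y in `]a, c[) f y + \int[mu]_(y in `]c, b[) f y.
Proof.
move=> /andP[ac]; rewrite le_eqVlt => /predU1P[-> _|cb fi].
  by rewrite set_itvoo0 Rintegral_set0 addr0.
rewrite -(@Rintegral_itvB _ f (BRight a) (BLeft b) c)// ?bnd_simp//.
rewrite (@Rintegral_itv_bndo_bndc _ (BRight a) c f); first by rewrite addrC subrK.
by apply: integrableS fi => //; apply: subset_itvl; rewrite bnd_simp ltW.
Qed.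

Definition prim v x : R := \int[mu]_(y in `]0, x[) v y.

Lemma itv01S x : x <= 1 -> `]0, x[%classic `<=` D.
Proof.
by move=> x1 y /=; rewrite !in_itv/= => /andP[-> /lt_le_trans->].
Qed.

Lemma L2_integrableS v x : L2 v -> x <= 1 ->
  mu.-integrable `]0, x[ (EFin \o v).
Proof.
by move=> vL x1; apply: integrableS (L2_integrable vL) => //; exact: itv01S.
Qed.

Lemma indic_bounded (E : set R) x : `|\1_E x| <= 1 :> R.
Proof. by rewrite indicE; case: (_ \in _); rewrite ?normr1 ?normr0. Qed.

(** Turns bounds on a primitive into instances of Cauchy-Schwarz. *)
Lemma prim_ip v x : x <= 1 -> prim v x = ip \1_(`]0, x[%classic) v.
Proof.
move=> x1; rewrite /prim Rintegral_mkcond /ip [RHS]Rintegral_mkcond.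
apply: eq_Rintegral => y _; rewrite !patchE indicE.
have [yx|yx] := boolP (y \in `]0, x[%classic).
  by rewrite mul1r mem_set//; apply: itv01S x1 _ _; rewrite inE in yx.
by rewrite mul0r if_same.
Qed.

Lemma L2_indic (E : set R) : measurable E -> L2 \1_E.
Proof.
move=> mE; have := @L2_bM R \1_E 1 (cst 1) _ (fun x _ => indic_bounded E x) (L2_cst 1).
rewrite (_ : _ \* _ = \1_E); last by apply/funext => x; rewrite /= mulr1.
by apply; exact: measurable_indic.
Qed.

Lemma ip11 : ip (cst 1) (cst 1) = 1 :> R.
Proof.
rewrite /ip (_ : (fun x => _) = cst 1); last by apply/funext => x /=; rewrite mulr1.
rewrite Rintegral_cst// mul1r -[RHS]/(fine 1%E); congr fine; exact: muD.
Qed.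

Lemma ip_le u v : L2 u -> L2 v -> (forall x, 0 < x < 1 -> `|u x| <= `|v x|) ->
  ip u u <= ip v v.
Proof.
move=> uL vL uv; apply: le_Rintegral => //; try exact: L2_mul_integrable.
move=> x /=; rewrite in_itv/= => /uv uvx.
by rewrite -!expr2 -real_normK ?num_real// -[leRHS]real_normK ?num_real// ler_pXn2r ?nnegrE.
Qed.

Lemma sqr_prim_le v x : L2 v -> x <= 1 -> prim v x ^+ 2 <= ip v v.
Proof.
move=> vL x1; rewrite prim_ip//.
have iL : L2 (\1_(`]0, x[%classic) : R -> R) by apply: L2_indic.
apply: le_trans (ip_CS iL vL) _.
rewrite ler_piMl ?ip_ge0// -ip11; apply: ip_le => //; first exact: L2_cst.
by move=> y _; rewrite normr1 indic_bounded.
Qed.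

Lemma zext_integrable v : L2 v -> mu.-integrable setT (EFin \o zext v).
Proof.
move=> vL; rewrite zext_restrict -restrict_EFin.
by apply/(integrable_restrict mu _ _ _).1 => //; rewrite setTI; exact: L2_integrable.
Qed.

Lemma prim_zext v x : x <= 1 -> prim (zext v) x = prim v x.
Proof.
move=> x1; apply: eq_Rintegral => y; rewrite inE => /(itv01S x1) yD.
by rewrite zext_restrict patchE mem_set.
Qed.

Lemma prim_parameterized (f : R -> R) (x : R) : measurable_fun `]0, x[ f ->
  prim f x = parameterized_integral mu 0 x f.
Proof.
move=> mf; rewrite /prim /parameterized_integral /Rintegral; congr fine.
by rewrite -(integral_itv_bndoo true false)//; exact/measurable_EFinP.
Qed.

Lemma prim_continuous v : L2 v -> {within `[0, 1], continuous (prim v)}.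
Proof.
move=> vL; have vi := zext_integrable vL.
have mz : measurable_fun setT (zext v).
  by move/measurable_int : vi => /measurable_EFinP.
have vi01 : mu.-integrable `[0, 1] (EFin \o zext v) by exact: integrableS vi.
have := parameterized_integral_continuous ler01 vi01.
apply: subspace_eq_continuous => x; rewrite inE/= in_itv/= => /andP[x0 x1].
rewrite /from_subspace/= -prim_zext// prim_parameterized//.
exact: measurable_funS mz.
Qed.

Lemma H1deriv_continuous u v : H1deriv u v -> {within `[0, 1], continuous u}.
Proof.
move=> [vL uE].
apply: (@subspace_eq_continuous _ _ _ (fun x => u 0 + prim v x)).
  by move=> x; rewrite inE/= in_itv/= => /uE.
by move=> x; apply: cvgD; [exact: cvg_cst|exact: prim_continuous].
Qed.

Lemma H1deriv_measurable u v : H1deriv u v -> measurable_fun D u.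
Proof.
move=> /H1deriv_continuous uc.
have : measurable_fun I u by exact: subspace_continuous_measurable_fun.
by apply: measurable_funS => //; exact: subset_itv_oo_cc.
Qed.

Lemma H1deriv_trace u v x : H1deriv u v -> 0 <= x <= 1 ->
  (u x - u 0) ^+ 2 <= ip v v.
Proof.
move=> [vL uE] /[dup] x01 /andP[_ x1]; rewrite (uE _ x01) addrAC subrr add0r.
exact: sqr_prim_le.
Qed.

Lemma H1deriv_bounded u v : H1deriv u v ->
  exists M, forall x, 0 <= x <= 1 -> `|u x| <= M.
Proof.
move=> uv; exists (`|u 0| + (1 + ip v v)) => x x01.
have := H1deriv_trace uv x01; set p := ip v v => h.
rewrite -[u x](subrK (u 0)) (le_trans (ler_normD _ _))// addrC lerD2l.
move: h; set y := u x - u 0 => h.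
have := sqr_ge0 (y - 1); have := sqr_ge0 (y + 1); have := sqr_ge0 y => *.
by rewrite ler_norml; apply/andP; split; nra.
Qed.

Lemma H1deriv_L2 u v : H1deriv u v -> L2 u.
Proof.
move=> uv; have [M uM] := H1deriv_bounded uv.
have := L2_bM (H1deriv_measurable uv) _ (L2_cst 1) => /(_ M).
rewrite (_ : _ \* _ = u); last by apply/funext => x; rewrite /= mulr1.
by apply => x /andP[x0 x1]; rewrite uM// !ltW.
Qed.

Lemma H1deriv_bM u u' v : H1deriv u u' -> L2 v -> L2 (u \* v).
Proof.
move=> uv vL; have [M uM] := H1deriv_bounded uv.
apply: (L2_bM (H1deriv_measurable uv) _ vL) => x /andP[x0 x1].
by apply: uM; rewrite !ltW.
Qed.

(** [Fubini_triangle] is applied to [u'] and [v'] cut off outside []0, x[]: its two sides become the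
    integrals of [(u - u 0) * v'] and of [(v x - v) * u'], and their equality is the integrated
    product rule. *)
Lemma H1derivM u u' v v' : H1deriv u u' -> H1deriv v v' ->
  H1deriv (u \* v) (fun x => u x * v' x + v x * u' x).
Proof.
move=> uu' vv'; have [u'L uE] := uu'; have [v'L vE] := vv'.
have uv'L := H1deriv_bM uu' v'L; have vu'L := H1deriv_bM vv' u'L.
split=> [|x x01]; first exact: L2D.
have /andP[x0 x1] := x01.
pose E : set R := `]0, x[%classic.
have mE : measurable E by exact: measurable_itv.
have ires w : L2 w -> mu.-integrable setT (EFin \o (w \_ E)).
  move=> wL; rewrite -restrict_EFin.
  by apply/(integrable_restrict mu _ _ _).1 => //; rewrite setTI; exact: L2_integrableS.
have := Fubini_triangle (ires _ u'L) (ires _ v'L).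
have -> : \int[mu]_s ((v' \_ E) s * \int[mu]_(y in `]-oo, s[) (u' \_ E) y) =
    \int[mu]_(s in E) (u s * v' s - u 0 * v' s).
  rewrite [RHS]Rintegral_mkcond; apply: eq_Rintegral => s _; rewrite !patchE.
  case: ifPn => [|_]; last by rewrite mul0r.
  move=> /set_mem; rewrite /E/= in_itv/= => /andP[s0 sx].
  rewrite (_ : \int[mu]_(y in _) _ = prim u' s).
    have -> : u s = u 0 + prim u' s by apply: uE; rewrite !ltW// (lt_le_trans sx).
    by ring.
  rewrite /prim Rintegral_mkcond [RHS]Rintegral_mkcond.
  apply: eq_Rintegral => y _; rewrite !patchE !mem_setE !in_itv/=.
  have [ys|_] := ltP y s; last by rewrite andbF.
  by rewrite andbT (lt_trans ys sx) andbT.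
have -> : \int[mu]_s ((u' \_ E) s * \int[mu]_(y in `]s, +oo[) (v' \_ E) y) =
    \int[mu]_(s in E) (v x * u' s - v s * u' s).
  rewrite [RHS]Rintegral_mkcond; apply: eq_Rintegral => s _; rewrite !patchE.
  case: ifPn => [|_]; last by rewrite mul0r.
  move=> /set_mem; rewrite /E/= in_itv/= => /andP[s0 sx].
  have s01 : 0 <= s <= 1 by rewrite !ltW// (lt_le_trans sx).
  rewrite (_ : \int[mu]_(y in _) _ = v x - v s); first by ring.
  rewrite (vE x)// (vE s)// opprD addrACA subrr add0r.
  have sx' : 0 <= s <= x by rewrite !ltW.
  rewrite (Rintegral_itvoo_split sx') 1?addrAC ?subrr ?add0r; last exact: L2_integrableS.
  rewrite Rintegral_mkcond [RHS]Rintegral_mkcond.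
  apply: eq_Rintegral => y _; rewrite !patchE !mem_setE !in_itv/= andbT.
  by have [ys|_] := ltP s y => //; rewrite (lt_trans s0 ys).
have iE w : L2 w -> mu.-integrable E (EFin \o w) by move=> wL; exact: L2_integrableS.
have iEZ k w : L2 w -> mu.-integrable E (EFin \o (fun y => k * w y)).
  by move=> wL; apply: integrable_scaleR => //; exact: iE.
rewrite !RintegralB//; do ?[exact: iE|exact: iEZ].
rewrite !RintegralZl//; do ?exact: iE.
rewrite -/(prim u' x) -/(prim v' x) => h.
rewrite RintegralD//; do ?exact: iE.
have uxE : u x = u 0 + prim u' x by exact: uE.
have vxE : v x = v 0 + prim v' x by exact: vE.
move: h; rewrite /E [(u \* v) x]/= [(u \* v) 0]/=.
by rewrite [in v x * prim _ _]vxE uxE vxE; set A := Rintegral _ _ _; set B := Rintegral _ _ _; lra.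
Qed.

Lemma H1derivD u u' v v' : H1deriv u u' -> H1deriv v v' ->
  H1deriv (u \+ v) (u' \+ v').
Proof.
move=> [u'L uE] [v'L vE]; split=> [|x x01]; first exact: L2D.
have /andP[_ x1] := x01; rewrite RintegralD//; do ?exact: L2_integrableS.
by rewrite /= (uE x)// (vE x)// addrACA.
Qed.

Lemma H1derivZ k u u' : H1deriv u u' -> H1deriv (k \*o u) (k \*o u').
Proof.
move=> [u'L uE]; split=> [|x x01]; first exact: L2Z.
have /andP[_ x1] := x01; rewrite RintegralZl//; do ?exact: L2_integrableS.
by rewrite /= (uE x)// mulrDr.
Qed.

Lemma H1derivB u u' v v' : H1deriv u u' -> H1deriv v v' ->
  H1deriv (u \- v) (u' \- v').
Proof.
move=> [u'L uE] [v'L vE]; split=> [|x x01]; first exact: L2B.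
have /andP[_ x1] := x01; rewrite RintegralB//; do ?exact: L2_integrableS.
by rewrite /= (uE x)// (vE x)// addrACA -opprD.
Qed.

Lemma fine_mu_itvoo x : 0 <= x -> fine (mu (`]0, x[%classic : set R)) = x.
Proof.
by rewrite lebesgue_measure_itv/= lte_fin; case: ltgtP => //= _ _; rewrite subr0.
Qed.

Lemma H1deriv_affine (a b : R) : H1deriv (fun x => a + b * x) (cst b).
Proof.
split=> [|x /andP[x0 x1]]; first exact: L2_cst.
rewrite Rintegral_cst// mulr0 addr0; congr (_ + b * _).
exact/esym/fine_mu_itvoo.
Qed.

Lemma H1deriv_int u v : H1deriv u v -> ip (cst 1) v = u 1 - u 0.
Proof.
move=> [vL /(_ 1)]; rewrite ler01 lexx => /(_ isT) ->.
rewrite addrAC subrr add0r /ip; apply: eq_Rintegral => x _; exact: mul1r.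
Qed.

(* Integrating (A u^2)' over (0,1), for an affine weight A. *)
Lemma weighted_ibp (a b : R) u v : H1deriv u v ->
  2 * ip (fun x => (a + b * x) * u x) v =
  (a + b) * u 1 ^+ 2 - a * u 0 ^+ 2 - b * ip u u.
Proof.
move=> uv; have uL := H1deriv_L2 uv; have vL := uv.1.
have := H1deriv_int (H1derivM (H1derivM (H1deriv_affine a b) uv) uv).
set w := (X in ip _ X) => h.
have AuL : L2 (fun x => (a + b * x) * u x) by exact: L2_affM.
have -> : 2 * ip (fun x => (a + b * x) * u x) v = ip (cst 1) w - b * ip u u.
  rewrite /ip -!RintegralZl//; do ?exact: L2_mul_integrable.
  rewrite -RintegralB//.
  - by apply: eq_Rintegral => x _; rewrite /w/=; ring.
  - by apply: L2_mul_integrable; [exact: L2_cst|exact: (H1derivM (H1derivM (H1deriv_affine a b) uv) uv).1].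
  - by apply: integrable_scaleR => //; exact: L2_mul_integrable.
by rewrite h/=; ring.
Qed.

Lemma L2_ae0 u : L2 u -> eq_ae01 u (cst 0) -> ip u u = 0.
Proof.
move=> uL u0; rewrite (ip_ae uL (L2_cst 0) uL u0) /ip.
by under eq_Rintegral do rewrite /= mul0r; rewrite Rintegral_cst// mul0r.
Qed.

Lemma eq_ae01_sym u v : eq_ae01 u v -> eq_ae01 v u.
Proof.
apply: filterS; first exact: (ae_filter_ringOfSetsType mu).
by move=> x /= + xD => ->.
Qed.

Lemma eq_ae01_trans u v w : eq_ae01 u v -> eq_ae01 v w -> eq_ae01 u w.
Proof.
apply: filterS2; first exact: (ae_filter_ringOfSetsType mu).
by move=> x /= h h' xD; rewrite h// h'.
Qed.

Lemma eq_ae01_comp2 (h : R -> R -> R -> R) u u' v v' :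
  eq_ae01 u u' -> eq_ae01 v v' ->
  eq_ae01 (fun x => h x (u x) (v x)) (fun x => h x (u' x) (v' x)).
Proof.
apply: filterS2; first exact: (ae_filter_ringOfSetsType mu).
by move=> x /= e e' xD; rewrite e// e'.
Qed.

Lemma H1deriv_ae0 u v x : H1deriv u v -> eq_ae01 u (cst 0) -> 0 <= x <= 1 ->
  u x = 0.
Proof.
(* u^2 is in H^1 with derivative 2 u v = 0 a.e., hence constant; its integral vanishes *)
move=> uv u0; have uL := H1deriv_L2 uv; have uu := H1derivM uv uv.
have sq0 y : 0 <= y <= 1 -> u y ^+ 2 = u 0 ^+ 2.
  move=> y01; have /= := uu.2 y y01; rewrite 2!expr2 -/(prim _ y) => ->.
  have /andP[_ y1] := y01.
  suff -> : prim (fun x0 => u x0 * v x0 + u x0 * v x0) y = 0 by rewrite addr0.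
  apply/eqP; rewrite -sqrf_eq0 eq_le sqr_ge0 andbT.
  apply: le_trans (sqr_prim_le uu.1 y1) _.
  rewrite L2_ae0//; first exact: uu.1.
  apply: eq_ae01_trans (eq_ae01_comp2 (fun _ a b => a * b + a * b) u0 _) _.
    exact: (@ae_eq_refl _ _ _ mu D _ v).
  by apply/aeW => y' _ /=; rewrite mul0r addr0.
move=> /sq0 ux; apply/eqP; rewrite -sqrf_eq0 ux.
have <- : ip u u = u 0 ^+ 2.
  rewrite /ip (@eq_Rintegral _ _ _ _ _ (fun=> u 0 ^+ 2)).
    by rewrite Rintegral_cst// -[RHS]mulr1; congr (_ * _); rewrite fine_mu_itvoo.
  by move=> y; rewrite inE/= in_itv/= => /andP[y0 y1]; rewrite -expr2 sq0// !ltW.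
by rewrite L2_ae0.
Qed.

Lemma H1deriv_ae_eq u u' v v' x : H1deriv u u' -> H1deriv v v' ->
  eq_ae01 u v -> 0 <= x <= 1 -> u x = v x.
Proof.
move=> uu' vv' uv x01; apply/eqP; rewrite -subr_eq0; apply/eqP.
apply: (H1deriv_ae0 (H1derivB uu' vv') _ x01).
apply: eq_ae01_trans (eq_ae01_comp2 (fun _ a b => a - b) uv _) _.
  exact: (@ae_eq_refl _ _ _ mu D _ v).
by apply/aeW => y' _ /=; rewrite subrr.
Qed.

(** By Lebesgue differentiation [v] is a.e. the derivative of its primitive. The theorem needs a
    function on the whole line, hence the zero extension, whose primitive vanishes everywhere. *)
Lemma prim_eq0_ae v : L2 v -> (forall x, 0 <= x <= 1 -> prim v x = 0) ->
  eq_ae01 v (cst 0).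
Proof.
move=> vL v0; have zi := zext_integrable vL.
have mz : measurable_fun setT (zext v).
  by move/measurable_int : zi => /measurable_EFinP.
have zi' y : mu.-integrable [set` Interval (BRight (0 : R)) (BRight y)] (EFin \o zext v).
  by apply: integrableS zi.
have left_z : locally_integrable setT (zext v) by apply: open_integrable_locally => //; exact: openT.
have := FTC1 zi' left_z; apply: filterS; first exact: (ae_filter_ringOfSetsType mu).
move=> x /= + xD; have /andP[x0 x1] : 0 < x < 1 by rewrite in_itv in xD.
rewrite lte_fin => /(_ x0)[_].
set F := (F in derive1 F x) => Fx.
have zvx : zext v x = v x by rewrite zext_restrict patchE mem_set.
have F1 y : y <= 1 -> F y = 0.
  move=> y1; rewrite /F -Rintegral_itv_bndo_bndc; last first.
    by apply: integrableS zi.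
  rewrite -/(prim (zext v) y) prim_zext//.
  have [y0|y0] := leP 0 y; first by rewrite v0// y0.
  by rewrite /prim set_itv_ge ?Rintegral_set0// bnd_simp -leNgt ltW.
suff F0 : F = cst 0 by rewrite -zvx -Fx F0; exact: derive1_cst.
(* Beyond 1 the primitive of the zero extension keeps its value at 1, which is 0. *)
apply/funext => y; have [/F1//|y1] := leP y 1.
rewrite -(F1 1)// /F Rintegral_mkcond [RHS]Rintegral_mkcond.
apply: eq_Rintegral => s _; rewrite !patchE !mem_setE !in_itv/=.
case: (ltP 0 s) => //= s0; case: (leP s 1) => s1.
  by rewrite (le_trans s1)// ltW.
by case: ifP => // _; rewrite zext_restrict patchE mem_setE in_itv/= (ltNge s) (ltW s1) andbF.
Qed.

Lemma H1deriv_unique u v v' : H1deriv u v -> H1deriv u v' -> eq_ae01 v v'.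
Proof.
move=> [vL uv] [v'L uv'].
have : eq_ae01 (v \- v') (cst 0).
  apply: prim_eq0_ae => [|x x01]; first exact: L2B.
  have /andP[_ x1] := x01.
  rewrite /prim RintegralB//; do ?exact: L2_integrableS.
  by have := uv x x01; rewrite (uv' x x01) => /addrI->; rewrite subrr.
apply: filterS; first exact: (ae_filter_ringOfSetsType mu).
by move=> x /= h xD; apply/eqP; rewrite -subr_eq0 h.
Qed.

(** Names the choice made inside [H1norm]. It is determined only up to a.e. equality, so every
    identity about it below is an [eq_ae01]. *)
Definition deriv01 u : R -> R := xget (cst 0) [set v | H1deriv u v].

Lemma H1_deriv01 u : H1 u -> H1deriv u (deriv01 u).
Proof. by move=> /cid[v uv]; exact: (@xgetI _ (cst 0) [set v | H1deriv u v] v). Qed.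

Lemma deriv01_ae u v : H1deriv u v -> eq_ae01 (deriv01 u) v.
Proof.
by move=> uv; apply: H1deriv_unique (uv); apply: H1_deriv01; exists v.
Qed.

Lemma H1norm_sqr u v : H1deriv u v -> H1norm u ^+ 2 = ip u u + ip v v.
Proof.
move=> uv; rewrite /H1norm sqr_sqrtr ?addr_ge0 ?sqr_ge0// !sqr_L2norm.
rewrite -/(deriv01 u); congr (_ + _).
have dL := (H1_deriv01 (ex_intro _ v uv)).1; have du := deriv01_ae uv.
by rewrite (ip_ae dL uv.1 dL du) ipC (ip_ae dL uv.1 uv.1 du).
Qed.

End H1.

(** * Bounded linear and bilinear maps on the state space *)

Section Xcalc.
Variable R : realType.
Local Notation mu := (@lebesgue_measure R).
Local Notation D := (`]0, 1[%classic : set R).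
Implicit Types (U V W : state R) (P Q : state R -> (R -> R)) (p : state R -> R)
  (B : state R -> state R -> R).

Lemma inX_sub U V : inX U -> inX V -> inX (sub_state U V).
Proof.
case=> [[[u1 h1] l1] [u2 h2] [[[u3 h3] b3] l3] [[u4 h4] l4]].
case=> [[[v1 k1] m1] [v2 k2] [[[v3 k3] c3] m3] [[v4 k4] m4]].
split=> /=.
- by split; [exists (u1 \- v1); exact: H1derivB|exact: L2B].
- by exists (u2 \- v2); exact: H1derivB.
- split; last exact: L2B.
  by split=> /=; [exists (u3 \- v3); exact: H1derivB|rewrite b3 c3 subrr].
- by split; [exists (u4 \- v4); exact: H1derivB|exact: L2B].
Qed.

Lemma inX_scale a U : inX U -> inX (scale_state a U).
Proof.
case=> [[[u1 h1] l1] [u2 h2] [[[u3 h3] b3] l3] [[u4 h4] l4]].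
split=> /=.
- by split; [exists (a \*o u1); exact: H1derivZ|exact: L2Z].
- by exists (a \*o u2); exact: H1derivZ.
- split; last exact: L2Z.
  by split=> /=; [exists (a \*o u3); exact: H1derivZ|rewrite b3 mulr0].
- by split; [exists (a \*o u4); exact: H1derivZ|exact: L2Z].
Qed.

(** Linearity is asked for only a.e., because [deriv01] picks a representative for each function
    separately. *)
Definition linear_L2 P : Prop :=
  [/\ forall U, inX U -> L2 (P U),
      forall U V, inX U -> inX V -> eq_ae01 (P (sub_state U V)) (P U \- P V) &
      forall a U, inX U -> eq_ae01 (P (scale_state a U)) (a \*o P U)].

Lemma eq_ae01_refl (u : R -> R) : eq_ae01 u u. Proof. exact/aeW. Qed.
Hint Resolve eq_ae01_refl : core.

Lemma linear_L2_deriv (f : state R -> (R -> R)) : (forall U, inX U -> H1 (f U)) ->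
  (forall U V, f (sub_state U V) = f U \- f V) ->
  (forall a U, f (scale_state a U) = a \*o f U) -> linear_L2 (fun U => deriv01 (f U)).
Proof.
move=> fH fB fZ; split=> [U UX|U V UX VX|a U UX].
- exact: (H1_deriv01 (fH U UX)).1.
- by rewrite fB; apply: deriv01_ae; apply: H1derivB; apply: H1_deriv01; exact: fH.
- by rewrite fZ; apply: deriv01_ae; apply: H1derivZ; apply: H1_deriv01; exact: fH.
Qed.

Lemma linear_L2_fun (f : state R -> (R -> R)) : (forall U, inX U -> L2 (f U)) ->
  (forall U V, f (sub_state U V) = f U \- f V) ->
  (forall a U, f (scale_state a U) = a \*o f U) -> linear_L2 f.
Proof. by move=> fH fB fZ; split=> // *; rewrite ?fB ?fZ. Qed.

Lemma inX_H1 U : inX U ->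
  [/\ H1 (s_eps U), H1 (s_Y U), H1 (s_z U) & H1 (s_w U)].
Proof. by case=> -[? _] ? [[? _] _] [? _]. Qed.

Lemma H1_L2 (u : R -> R) : H1 u -> L2 u.
Proof. by move=> [v]; exact: H1deriv_L2. Qed.

Lemma inX_L2 U : inX U -> [/\ L2 (s_epst U), L2 (s_zt U) & L2 (s_wt U)].
Proof. by case=> -[_ ?] _ [_ ?] [_ ?]. Qed.

(** The squared norm of X is the sum of the squared L^2 norms of these eleven components, so
    estimates on [Xnorm] reduce to one argument per component. *)
Definition Xcomp : seq (state R -> (R -> R)) :=
  [:: @s_eps R; fun U => deriv01 (s_eps U); @s_epst R;
      @s_Y R; fun U => deriv01 (s_Y U);
      @s_z R; fun U => deriv01 (s_z U); @s_zt R;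
      @s_w R; fun U => deriv01 (s_w U); @s_wt R].

(** Holds for all [n] since an index out of range falls back on the default [s_eps]. *)
Lemma Xcomp_linear_L2 n : linear_L2 (nth (@s_eps R) Xcomp n).
Proof.
do 11?[case: n => [|n]].
all: try by apply: linear_L2_fun => // U; case/inX_L2.
all: try by apply: linear_L2_fun => // U; case/inX_H1 => *; apply: H1_L2.
all: try by apply: linear_L2_deriv => // U; case/inX_H1.
by rewrite nth_default//; apply: linear_L2_fun => // U; case/inX_H1 => *; apply: H1_L2.
Qed.

Lemma Xnorm_sqr U : inX U ->
  Xnorm U ^+ 2 = \sum_(i < 11) ip (nth (@s_eps R) Xcomp i U) (nth (@s_eps R) Xcomp i U).
Proof.
move=> /inX_H1[/H1_deriv01 h1 /H1_deriv01 h2 /H1_deriv01 h3 /H1_deriv01 h4].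
rewrite sqr_sqrtr ?addr_ge0 ?sqr_ge0//.
transitivity (\sum_(P <- Xcomp) ip (P U) (P U)); last first.
  by rewrite (big_nth (@s_eps R)) big_mkord.
rewrite (H1norm_sqr h1) (H1norm_sqr h2) (H1norm_sqr h3) (H1norm_sqr h4).
by rewrite !sqr_L2norm /Xcomp !big_cons big_nil addr0 !addrA.
Qed.

Lemma Xnorm_ge0 U : 0 <= Xnorm U. Proof. exact: sqrtr_ge0. Qed.

Lemma ip_sub_le (u v : R -> R) : L2 u -> L2 v ->
  ip (u \- v) (u \- v) <= 2 * ip u u + 2 * ip v v.
Proof.
move=> uL vL; have := ip_ge0 (u \+ v).
have := L2D uL vL; have := L2B uL vL => ? ?.
by rewrite !(ipDl, ipDr, ipBl, ipBr)//; lra.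
Qed.

Lemma linear_L2_sub_ip P U V : linear_L2 P -> inX U -> inX V ->
  ip (P (sub_state U V)) (P (sub_state U V)) = ip (P U \- P V) (P U \- P V).
Proof.
move=> [PL PB _] UX VX; have SX := inX_sub UX VX.
have L1 := PL _ SX; have L2' := L2B (PL _ UX) (PL _ VX).
by rewrite (ip_ae L1 L2' L1 (PB _ _ UX VX)) ipC (ip_ae L1 L2' L2' (PB _ _ UX VX)).
Qed.

Lemma linear_L2_scale_ip P a U : linear_L2 P -> inX U ->
  ip (P (scale_state a U)) (P (scale_state a U)) = a ^+ 2 * ip (P U) (P U).
Proof.
move=> [PL _ PZ] UX; have SX := inX_scale a UX.
have L1 := PL _ SX; have L2' := L2Z a (PL _ UX).
rewrite (ip_ae L1 L2' L1 (PZ _ _ UX)) ipC (ip_ae L1 L2' L2' (PZ _ _ UX)).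
by rewrite ipZl ?ipZr//; [ring|exact: PL..].
Qed.

(** Summing [ip_sub_le] over the components gives a triangle inequality up to a factor, which is
    enough for all limit arguments below. *)
Lemma Xnorm_sub_le U V : inX U -> inX V ->
  Xnorm (sub_state U V) ^+ 2 <= 2 * Xnorm U ^+ 2 + 2 * Xnorm V ^+ 2.
Proof.
move=> UX VX; have SX := inX_sub UX VX.
rewrite !Xnorm_sqr// !mulr_sumr -big_split/=; apply: ler_sum => i _.
have lP := Xcomp_linear_L2 i; rewrite linear_L2_sub_ip//.
by case: (lP) => PL _ _; apply: ip_sub_le; exact: PL.
Qed.

Lemma Xnorm_scale a U : inX U -> Xnorm (scale_state a U) ^+ 2 = a ^+ 2 * Xnorm U ^+ 2.
Proof.
move=> UX; have SX := inX_scale a UX.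
rewrite !Xnorm_sqr// mulr_sumr; apply: eq_bigr => i _.
by rewrite linear_L2_scale_ip//; exact: Xcomp_linear_L2.
Qed.

Definition bounded_L2 P : Prop := linear_L2 P /\
  exists2 C, 0 <= C & forall U, inX U -> ip (P U) (P U) <= C * Xnorm U ^+ 2.

Lemma Xcomp_bounded_L2 n : (n < 11)%N -> bounded_L2 (nth (@s_eps R) Xcomp n).
Proof.
move=> n11; split; first exact: Xcomp_linear_L2.
exists 1 => // U UX; rewrite mul1r Xnorm_sqr// (bigD1 (Ordinal n11))//=.
by rewrite lerDl sumr_ge0// => i _; exact: ip_ge0.
Qed.

Lemma bounded_L2_add P Q : bounded_L2 P -> bounded_L2 Q -> bounded_L2 (fun U => P U \+ Q U).
Proof.
move=> [[PL PB PZ] [C C0 PC]] [[QL QB QZ] [C' C'0 QC]]; split; first split.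
- by move=> U UX; apply: L2D; [exact: PL|exact: QL].
- move=> U V UX VX.
  apply: eq_ae01_trans (eq_ae01_comp2 (fun _ a b => a + b) (PB _ _ UX VX) (QB _ _ UX VX)) _.
  by apply/aeW => x _ /=; ring.
- move=> a U UX.
  apply: eq_ae01_trans (eq_ae01_comp2 (fun _ a b => a + b) (PZ a _ UX) (QZ a _ UX)) _.
  by apply/aeW => x _ /=; ring.
- exists (2 * C + 2 * C'); first by rewrite addr_ge0 ?mulr_ge0.
  move=> U UX; have := ip_sub_le (PL _ UX) (L2N (QL _ UX)).
  have -> : P U \- (\- Q U) = P U \+ Q U by apply/funext => x /=; rewrite opprK.
  have -> : ip (\- Q U) (\- Q U) = ip (Q U) (Q U).
    by apply: eq_Rintegral => x _ /=; rewrite mulrNN.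
  by have := PC _ UX; have := QC _ UX; lra.
Qed.

Lemma bounded_L2_aff (a b : R) P : bounded_L2 P -> bounded_L2 (fun U x => (a + b * x) * P U x).
Proof.
move=> [[PL PB PZ] [C C0 PC]]; split; first split.
- by move=> U UX; apply: L2_affM; exact: PL.
- move=> U V UX VX.
  apply: eq_ae01_trans (eq_ae01_comp2 (fun x u _ => (a + b * x) * u) (PB _ _ UX VX) (eq_ae01_refl (P U))) _.
  by apply/aeW => x _ /=; ring.
- move=> k U UX.
  apply: eq_ae01_trans (eq_ae01_comp2 (fun x u _ => (a + b * x) * u) (PZ k _ UX) (eq_ae01_refl (P U))) _.
  by apply/aeW => x _ /=; ring.
- exists ((`|a| + `|b|) ^+ 2 * C); first by rewrite mulr_ge0 ?sqr_ge0.
  move=> U UX; rewrite -mulrA.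
  apply: (@le_trans _ _ ((`|a| + `|b|) ^+ 2 * ip (P U) (P U))); last first.
    by rewrite ler_wpM2l ?sqr_ge0// PC.
  have PU := PL _ UX; have PU' := L2Z (`|a| + `|b|) PU.
  rewrite (_ : _ * ip _ _ = ip ((`|a| + `|b|) \*o P U) ((`|a| + `|b|) \*o P U)).
    apply: ip_le => //; first exact: L2_affM.
    move=> x /andP[x0 x1] /=; rewrite !normrM ler_wpM2r//.
    rewrite (le_trans (ler_normD _ _))// ger0_norm ?addr_ge0// lerD2l normrM.
    by rewrite ler_piMr// ger0_norm ltW.
  by rewrite ipZl// ipZr//; ring.
Qed.

Definition linear_form p : Prop :=
  [/\ forall U V, inX U -> inX V -> p (sub_state U V) = p U - p V,
      forall a U, inX U -> p (scale_state a U) = a * p U &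
      exists2 C, 0 <= C & forall U, inX U -> `|p U| <= C * Xnorm U].

Definition bilinear_form B : Prop :=
  [/\ forall U V W, inX U -> inX V -> inX W ->
        B (sub_state U V) W = B U W - B V W /\ B W (sub_state U V) = B W U - B W V,
      forall a U W, inX U -> inX W ->
        B (scale_state a U) W = a * B U W /\ B W (scale_state a U) = a * B W U &
      exists2 C, 0 <= C & forall U V, inX U -> inX V ->
        `|B U V| <= C * (Xnorm U * Xnorm V)].

Lemma bilinear_form_mul p p' : linear_form p -> linear_form p' -> bilinear_form (fun U V => p U * p' V).
Proof.
move=> [pB pZ [C C0 pC]] [pB' pZ' [C' C'0 pC']]; split.
- by move=> U V W UX VX WX; rewrite pB// pB'//; split; ring.
- by move=> a U W UX WX; rewrite pZ// pZ'//; split; ring.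
- exists (C * C') => [|U V UX VX]; first exact: mulr_ge0.
  by rewrite normrM mulrACA ler_pM// ?pC ?pC'.
Qed.

Lemma bilinear_form_add B B' : bilinear_form B -> bilinear_form B' -> bilinear_form (fun U V => B U V + B' U V).
Proof.
move=> [BB BZ [C C0 BC]] [BB' BZ' [C' C'0 BC']]; split.
- move=> U V W UX VX WX; have [-> ->] := BB _ _ _ UX VX WX.
  by have [-> ->] := BB' _ _ _ UX VX WX; split; ring.
- move=> a U W UX WX; have [-> ->] := BZ a _ _ UX WX.
  by have [-> ->] := BZ' a _ _ UX WX; split; ring.
- exists (C + C') => [|U V UX VX]; first exact: addr_ge0.
  by rewrite (le_trans (ler_normD _ _))// mulrDl lerD ?BC ?BC'.
Qed.

Lemma bilinear_form_scale k B : bilinear_form B -> bilinear_form (fun U V => k * B U V).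
Proof.
move=> [BB BZ [C C0 BC]]; split.
- by move=> U V W UX VX WX; have [-> ->] := BB _ _ _ UX VX WX; split; ring.
- by move=> a U W UX WX; have [-> ->] := BZ a _ _ UX WX; split; ring.
- exists (`|k| * C) => [|U V UX VX]; first exact: mulr_ge0.
  by rewrite normrM -mulrA ler_wpM2l ?BC.
Qed.

Lemma norm_le_sqr (x y : R) : 0 <= y -> x ^+ 2 <= y ^+ 2 -> `|x| <= y.
Proof.
by move=> y0 xy; rewrite -(@ler_pXn2r _ 2)// ?nnegrE// real_normK ?num_real.
Qed.

Lemma bilinear_form_ip P Q : bounded_L2 P -> bounded_L2 Q -> bilinear_form (fun U V => ip (P U) (Q V)).
Proof.
move=> [[PL PB PZ] [C C0 PC]] [[QL QB QZ] [C' C'0 QC]]; split.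
- move=> U V W UX VX WX; have SX := inX_sub UX VX.
  have PW := PL _ WX; have QW := QL _ WX.
  have PUV := L2B (PL _ UX) (PL _ VX); have QUV := L2B (QL _ UX) (QL _ VX).
  rewrite (ip_ae (PL _ SX) PUV QW (PB _ _ UX VX)).
  rewrite [ip (P W) _]ipC (ip_ae (QL _ SX) QUV PW (QB _ _ UX VX)).
  have PU := PL _ UX; have PV := PL _ VX.
  have QU := QL _ UX; have QV := QL _ VX.
  by split; rewrite ipBl// !(ipC _ (P W)).
- move=> a U W UX WX; have SX := inX_scale a UX.
  have PW := PL _ WX; have QW := QL _ WX.
  have PU := L2Z a (PL _ UX); have QU := L2Z a (QL _ UX).
  rewrite (ip_ae (PL _ SX) PU QW (PZ _ _ UX)).
  rewrite [ip (P W) _]ipC (ip_ae (QL _ SX) QU PW (QZ _ _ UX)).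
  have PU' := PL _ UX; have QU' := QL _ UX.
  by split; rewrite ipZl// !(ipC _ (P W)).
- exists (Num.sqrt (C * C')) => [|U V UX VX]; first exact: sqrtr_ge0.
  apply: norm_le_sqr; first by rewrite !mulr_ge0 ?sqrtr_ge0.
  apply: le_trans (ip_CS (PL _ UX) (QL _ VX)) _.
  rewrite !exprMn sqr_sqrtr ?mulr_ge0// [leRHS]mulrACA.
  by rewrite ler_pM ?ip_ge0 ?PC ?QC.
Qed.

Lemma linear_form_ip (phi : R -> R) P : L2 phi -> bounded_L2 P -> linear_form (fun U => ip phi (P U)).
Proof.
move=> phiL [[PL PB PZ] [C C0 PC]]; split.
- move=> U V UX VX; have SX := inX_sub UX VX.
  rewrite ipC (ip_ae (PL _ SX) (L2B (PL _ UX) (PL _ VX)) phiL (PB _ _ UX VX)).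
  by rewrite ipBl ?(ipC phi)//; exact: PL.
- move=> a U UX; have SX := inX_scale a UX.
  rewrite ipC (ip_ae (PL _ SX) (L2Z a (PL _ UX)) phiL (PZ _ _ UX)).
  by rewrite ipZl ?(ipC phi)//; exact: PL.
- exists (Num.sqrt (ip phi phi * C)) => [|U UX]; first exact: sqrtr_ge0.
  apply: norm_le_sqr; first by rewrite mulr_ge0 ?sqrtr_ge0// ?Xnorm_ge0.
  apply: le_trans (ip_CS phiL (PL _ UX)) _.
  by rewrite exprMn sqr_sqrtr ?mulr_ge0 ?ip_ge0// -mulrA ler_wpM2l ?ip_ge0 ?PC.
Qed.

Lemma linear_form_add p p' : linear_form p -> linear_form p' -> linear_form (fun U => p U + p' U).
Proof.
move=> [pB pZ [C C0 pC]] [pB' pZ' [C' C'0 pC']]; split.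
- by move=> U V UX VX; rewrite pB// pB'//; ring.
- by move=> a U UX; rewrite pZ// pZ'//; ring.
- exists (C + C') => [|U UX]; first exact: addr_ge0.
  by rewrite (le_trans (ler_normD _ _))// mulrDl lerD ?pC ?pC'.
Qed.

Lemma linear_form_scale k p : linear_form p -> linear_form (fun U => k * p U).
Proof.
move=> [pB pZ [C C0 pC]]; split.
- by move=> U V UX VX; rewrite pB// mulrBr.
- by move=> a U UX; rewrite pZ//; ring.
- exists (`|k| * C) => [|U UX]; first exact: mulr_ge0.
  by rewrite normrM -mulrA ler_wpM2l ?pC.
Qed.

(** The constant [u 0] is the difference of [u] and [u - u 0], and the latter is bounded pointwise
    by the norm of the derivative. *)
Lemma trace0_le (u v : R -> R) : H1deriv u v -> u 0 ^+ 2 <= 2 * ip u u + 2 * ip v v.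
Proof.
move=> uv; have uL := H1deriv_L2 uv.
have -> : u 0 ^+ 2 = ip (cst (u 0)) (cst (u 0)).
  rewrite /ip (_ : (fun x => _) = cst (u 0 ^+ 2)).
    by rewrite Rintegral_cst// -[LHS]mulr1; congr (_ * _); rewrite fine_mu_itvoo.
  by apply/funext => x; rewrite /= expr2.
have dL : L2 (fun x => u x - u 0) by apply: L2B => //; exact: L2_cst.
have -> : cst (u 0) = u \- (fun x => u x - u 0).
  by apply/funext => x /=; ring.
apply: le_trans (ip_sub_le uL dL) _; rewrite lerD2l ler_pM2l//.
rewrite [leRHS](_ : _ = ip (cst (Num.sqrt (ip v v))) (cst (Num.sqrt (ip v v)))).
  apply: ip_le => //; first exact: L2_cst.
  move=> x /andP[x0 x1]; rewrite [leRHS]ger0_norm ?sqrtr_ge0//.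
  apply: norm_le_sqr; first exact: sqrtr_ge0.
  by rewrite sqr_sqrtr ?ip_ge0// (H1deriv_trace uv)// !ltW.
rewrite /ip [RHS](_ : _ = \int[mu]_(x in D) (ip v v)).
  by rewrite Rintegral_cst// -[LHS]mulr1; congr (_ * _); rewrite fine_mu_itvoo.
by apply: eq_Rintegral => x _; rewrite /= -expr2 sqr_sqrtr// ip_ge0.
Qed.

Lemma linear_form_trace0 (f : state R -> (R -> R)) :
  (forall U V, f (sub_state U V) = f U \- f V) ->
  (forall a U, f (scale_state a U) = a \*o f U) ->
  (forall U, inX U -> H1 (f U)) ->
  bounded_L2 f -> bounded_L2 (fun U => deriv01 (f U)) -> linear_form (fun U => f U 0).
Proof.
move=> fB fZ fH [_ [C C0 fC]] [_ [C' C'0 fC']]; split.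
- by move=> U V _ _; rewrite fB.
- by move=> a U _; rewrite fZ.
- exists (Num.sqrt (2 * C + 2 * C')) => [|U UX]; first exact: sqrtr_ge0.
  apply: norm_le_sqr; first by rewrite mulr_ge0 ?sqrtr_ge0 ?Xnorm_ge0.
  apply: le_trans (trace0_le (H1_deriv01 (fH _ UX))) _.
  rewrite exprMn sqr_sqrtr; last by rewrite addr_ge0// mulr_ge0.
  by have := fC _ UX; have := fC' _ UX; lra.
Qed.

End Xcalc.

(** * Differentiating a quadratic form along a curve, and exponential decay *)

Section dynamics.
Variable R : realType.
Implicit Types (U V W : state R) (B : state R -> state R -> R).

Lemma cvg_le_dist (T : Type) (F : set_system T) (FF : Filter F) (f g : T -> R) (l : R) :
  (\forall x \near F, `|f x - l| <= g x) -> g x @[x --> F] --> (0 : R) ->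
  f x @[x --> F] --> l.
Proof.
move=> fg g0; apply/cvgrPdist_le => e e0.
have g1 : \forall x \near F, `|0 - g x| <= e by exact: cvgr_dist_le.
near=> x; rewrite distrC (@le_trans _ _ (g x))//; first by near: x.
by rewrite (le_trans (ler_norm _))// -normrN -sub0r; near: x.
Unshelve. all: by end_near. Qed.

(** Writes [U] as a difference of [U - W] and [- W], so that [Xnorm_sub_le] bounds it. *)
Lemma sub_stateK U W : sub_state (sub_state U W) (scale_state (-1) W) = U.
Proof.
by case: U W => ? ? ? ? ? ? ? [? ? ? ? ? ? ?]; congr State; apply/funext => x /=; ring.
Qed.

(** With D the difference quotient of [U], the quotient of the quadratic form is
    [B D (U t) + B (U t) D + (s - t) * B D D]. Replacing D by its limit [W] in the first two terms
    costs the error of the quotient, and the last term tends to 0. *)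
Lemma bilinear_form_derive B (U : R -> state R) W (t : R) : bilinear_form B ->
  0 <= t -> (forall s, 0 <= s -> inX (U s)) -> inX W ->
  Xdist (scale_state (s - t)^-1 (sub_state (U s) (U t))) W
    @[s --> within [set s | 0 <= s] (dnbhs t)] --> (0 : R) ->
  (B (U s) (U s) - B (U t) (U t)) / (s - t)
    @[s --> within [set s | 0 <= s] (dnbhs t)] --> B (U t) W + B W (U t).
Proof.
move=> [BB BZ [C C0 BC]] t0 UX WX h.
set F := within _ _ in h *.
have FF : Filter F by exact: within_filter.
pose e s := Xdist (scale_state (s - t)^-1 (sub_state (U s) (U t))) W.
(* The first summand bounds the effect of replacing the quotient by [W]; the second bounds the
   quadratic remainder, as the squared norm of the quotient is at most
   [2 * e s ^+ 2 + 2 * Xnorm W ^+ 2]. *)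
pose g s := C * (2 * Xnorm (U t)) * e s + C * (2 * (e s * e s) + 2 * Xnorm W ^+ 2) * `|s - t|.
apply: (@cvg_le_dist _ F FF _ g); last first.
  have st : `|s - t| @[s --> F] --> (0 : R).
    have : s - t @[s --> F] --> t - t.
      apply: cvgB; last exact: cvg_cst.
      by move=> P Pt; have : nbhs t P by []; apply: filterS => x Px _ _; exact: Px.
    by rewrite subrr => /cvg_norm; rewrite normr0.
  rewrite (_ : 0 = C * (2 * Xnorm (U t)) * 0 + C * (2 * (0 * 0) + 2 * Xnorm W ^+ 2) * 0).
    apply: cvgD; first by apply: cvgM => //; exact: cvg_cst.
    apply: cvgM => //; apply: cvgM; first exact: cvg_cst.
    apply: cvgD; last exact: cvg_cst.
    by apply: cvgM; [exact: cvg_cst|exact: cvgM].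
  by rewrite !mulr0 addr0.
have nF (P : set R) : (forall s, 0 <= s -> s != t -> P s) -> F P.
  by move=> h'; apply: (@nearW _ (nbhs t)) => s st s0; exact: h'.
apply: nF => s s0 st; have st0 : s - t != 0 by rewrite subr_eq0.
set Dl := scale_state (s - t)^-1 (sub_state (U s) (U t)).
have UtX := UX _ t0; have UsX := UX _ s0; have SX := inX_sub UsX UtX.
have DX : inX Dl by exact: inX_scale.
have EX := inX_sub DX WX.
have -> : (B (U s) (U s) - B (U t) (U t)) / (s - t) - (B (U t) W + B W (U t)) =
   B (sub_state Dl W) (U t) + B (U t) (sub_state Dl W) + (s - t) * B Dl Dl.
  have [-> ->] := BB _ _ _ DX WX UtX.
  have [-> _] := BZ (s - t)^-1 _ _ SX DX.
  have [_ ->] := BZ (s - t)^-1 _ _ SX SX.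
  have [-> ->] := BZ (s - t)^-1 _ _ SX UtX.
  have [-> _] := BB _ _ _ UsX UtX SX.
  have [-> ->] := BB _ _ _ UsX UtX UtX.
  have [_ ->] := BB _ _ _ UsX UtX UsX.
  by field.
have EE : Xnorm (sub_state Dl W) = e s by [].
rewrite (le_trans (ler_normD _ _))// lerD//.
  rewrite (le_trans (ler_normD _ _))//.
  have := BC _ _ EX UtX; have := BC _ _ UtX EX; rewrite EE.
  by set a := Xnorm (U t); lra.
rewrite normrM mulrC ler_wpM2r//.
apply: le_trans (BC _ _ DX DX) _; rewrite ler_wpM2l//.
rewrite -!expr2 -EE; have := Xnorm_sub_le EX (inX_scale (-1) WX).
rewrite sub_stateK (Xnorm_scale _ WX) sqrrN expr1n mul1r.
exact.
Unshelve. all: by end_near. Qed.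

Lemma cvg_within_dnbhsP (f : R -> R) (t l : R) :
  f s @[s --> within [set s | 0 <= s] (dnbhs t)] --> l <->
  forall e, 0 < e -> exists2 d, 0 < d &
    forall s, 0 <= s -> s != t -> `|s - t| < d -> `|f s - l| <= e.
Proof.
split=> [/cvgrPdist_le h e e0|h].
  have : \forall s \near t, s != t -> 0 <= s -> `|l - f s| <= e by exact: h.
  move=> /nbhs_ballP[d /= d0 hd]; exists d => // s s0 st sd.
  by rewrite distrC; apply: hd => //; rewrite /ball/= distrC.
apply/cvgrPdist_le => e e0; have [d d0 hd] := h e e0.
have : \forall s \near t, s != t -> 0 <= s -> `|l - f s| <= e.
  apply/nbhs_ballP; exists d => // s; rewrite /ball/= distrC => sd st s0.
  by rewrite distrC; exact: hd.
exact.
Qed.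

Lemma cvg_within_nbhsP (f : R -> R) (t l : R) :
  f s @[s --> within [set s | 0 <= s] (nbhs t)] --> l <->
  forall e, 0 < e -> exists2 d, 0 < d &
    forall s, 0 <= s -> `|s - t| < d -> `|f s - l| <= e.
Proof.
split=> [/cvgrPdist_le h e e0|h].
  have : \forall s \near t, 0 <= s -> `|l - f s| <= e by exact: h.
  move=> /nbhs_ballP[d /= d0 hd]; exists d => // s s0 sd.
  by rewrite distrC; apply: hd => //; rewrite /ball/= distrC.
apply/cvgrPdist_le => e e0; have [d d0 hd] := h e e0.
have : \forall s \near t, 0 <= s -> `|l - f s| <= e.
  apply/nbhs_ballP; exists d => // s; rewrite /ball/= distrC => sd s0.
  by rewrite distrC; exact: hd.
exact.
Qed.

Lemma is_derive_expRM (m t : R) :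
  is_derive t 1 (fun s : R => expR (m * s)) (m * expR (m * t)).
Proof.
have dm : is_derive t 1 (fun s => m * s) m.
  have := @is_deriveZ _ _ _ (id : R -> R) m t 1 1 _.
  by rewrite /GRing.scale/= mulr1; exact.
have := @is_derive1_comp _ (@expR R) (fun s => m * s) t (expR (m * t)) m _ dm.
by rewrite [m * expR _]mulrC; apply; exact: is_derive_expR.
Qed.

(** Gronwall by an integrating factor: [expR (m * t) * e t] is nonincreasing. At 0 the limit is
    one-sided, so monotonicity comes from the derivative on the open half-line and from continuity
    at 0. *)
Lemma exp_decay (e de : R -> R) (m : R) :
  (forall t, 0 <= t -> (e s - e t) / (s - t)
     @[s --> within [set s | 0 <= s] (dnbhs t)] --> de t) ->
  (forall t, 0 <= t -> de t <= - m * e t) ->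
  forall t, 0 <= t -> e t <= expR (- m * t) * e 0.
Proof.
move=> he dele.
have de0 (t : R) : 0 < t -> is_derive t 1 e (de t).
  move=> t0; have /cvg_within_dnbhsP het := he t (ltW t0).
  have het2 : h^-1 *: ((e \o shift t) (h *: 1) - e t) @[h --> 0^'] --> de t.
    apply/cvgrPdist_le => eps eps0; have [d d0 hd] := het _ eps0.
    near=> h; rewrite distrC.
    have h0 : h != 0 by near: h; exact: nbhs_dnbhs_neq.
    have ht : `|h| < t by near: h; exact: dnbhs0_lt.
    have hd' : `|h| < d by near: h; exact: dnbhs0_lt.
    have := hd (h + t) _ _ _; rewrite addrK /= [h%:A]mulr1 [_ *: _]mulrC; apply => //.
      by move: ht; rewrite ltr_norml => /andP[]; lra.
    by rewrite -subr_eq0 addrK.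
  by apply: DeriveDef; [apply/cvg_ex; exists (de t)|exact/cvg_lim].
have ct (t : R) : 0 <= t -> e s @[s --> within [set s | 0 <= s] (nbhs t)] --> e t.
  move=> t0; apply/cvg_within_nbhsP => eps eps0.
  have /cvg_within_dnbhsP/(_ 1 ltr01)[d d0 hd] := he t t0.
  have M0 : 0 < `|de t| + 1 by rewrite ltr_wpDl.
  exists (Num.min d (eps / (`|de t| + 1))); first by rewrite lt_min d0 divr_gt0.
  move=> s s0; rewrite lt_min => /andP[sd se].
  have [->|st] := eqVneq s t; first by rewrite subrr normr0 ltW.
  have := hd s s0 st sd; set q := _ / _ => hq.
  have -> : e s - e t = q * (s - t) by rewrite /q divfK// subr_eq0.
  rewrite normrM (@le_trans _ _ ((`|de t| + 1) * `|s - t|))//.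
    rewrite ler_wpM2r// -[q](subrK (de t)) addrC.
    by rewrite (le_trans (ler_normD _ _))// lerD2l.
  by rewrite mulrC -ler_pdivlMr// ltW.
pose phi t := expR (m * t) * e t.
have dphi (t : R) : 0 < t -> is_derive t 1 phi (expR (m * t) * (de t + m * e t)).
  move=> t0; have := de0 t t0 => ?.
  have dE := is_derive_expRM m t.
  have := is_deriveM dE (de0 t t0).
  rewrite (_ : _ * e = phi)// => h; apply: is_derive_eq h _.
  by rewrite /GRing.scale/=; ring.
have phi_le t : 0 <= t -> phi t <= phi 0.
  move=> t0; apply: (@ler0_derive1_nincry _ phi 0) => //.
  - by move=> x; rewrite in_itv/= andbT => x0; have [] := dphi x x0.
  - move=> x; rewrite in_itv/= andbT => x0; rewrite derive1E.
    have := dphi x x0 => ?; rewrite derive_val pmulr_rle0 ?expR_gt0//.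
    by have := dele x (ltW x0); lra.
  - apply/continuous_within_itvcyP; split.
      move=> x; rewrite in_itv/= andbT => x0.
      by have [dx _] := dphi x x0; apply: differentiable_continuous; apply/derivable1_diffP.
    apply: cvgM.
      have dE := is_derive_expRM m 0; have [dx _] := dE.
      have c0 : {for (0 : R), continuous (fun s : R => expR (m * s))}.
        by apply: differentiable_continuous; apply/derivable1_diffP.
      exact: cvg_at_right_filter c0.
    have := ct 0 (lexx 0) => c0 P /c0 hP.
    have : \forall s \near 0, 0 <= s -> P (e s) by exact: hP.
    by apply: filterS => s hs s0; apply: hs; exact: ltW.
move=> t t0; have := phi_le t t0; rewrite /phi mulr0 expR0 mul1r => h.
by rewrite mulNr expRN -ler_pdivrMl ?invr_gt0 ?expR_gt0// invrK.
Unshelve. all: by end_near. Qed.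

End dynamics.

(** * Transfer of dissipation from the operator to mild solutions *)

Section decay.
Variable R : realType.
Variables q c0 c1 c2 c3 : R.
Implicit Types (U V W : state R) (B : state R -> state R -> R).
Local Notation op := (system_op q c0 c1 c2 c3).

Lemma Xnorm_sub_le2 U V : inX U -> inX V ->
  Xnorm (sub_state U V) <= 2 * (Xnorm U + Xnorm V).
Proof.
move=> UX VX; have := Xnorm_sub_le UX VX; have := Xnorm_ge0 U; have := Xnorm_ge0 V.
move=> u0 v0 h; rewrite -(@ler_pXn2r _ 2)// ?nnegrE ?Xnorm_ge0 ?mulr_ge0 ?addr_ge0//.
by apply: le_trans h _; nra.
Qed.

Lemma Xnorm_scale_abs a U : inX U -> Xnorm (scale_state a U) = `|a| * Xnorm U.
Proof.
move=> UX; apply/eqP; rewrite -(@eqrXn2 _ 2)// ?mulr_ge0 ?Xnorm_ge0//.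
by rewrite Xnorm_scale// exprMn real_normK ?num_real.
Qed.

Lemma system_op_sub V W V' W' : op V W -> op V' W' ->
  op (sub_state V V') (sub_state W W').
Proof.
move=> [zx [zxx [ex [exx [yx [wx [wxx [[Z1 [Z2 Z2'] Z3 Z4] [E1 [E2 E2'] E3 E4]
  [[Y1 [yxx Y1']] Y2 Y3] [W1 [W2 W2'] W3 W4]]]]]]]]].
move=> [zx' [zxx' [ex' [exx' [yx' [wx' [wxx' [[A1 [A2 A2'] A3 A4] [F1 [F2 F2'] F3 F4]
  [[G1 [yxx' G1']] G2 G3] [H1 [H2 H2'] H3 H4]]]]]]]]].
have aeB (u v u' v' : R -> R) : eq_ae01 u v -> eq_ae01 u' v' -> eq_ae01 (u \- u') (v \- v') :> Prop.
  by move=> h h'; exact: (eq_ae01_comp2 (fun _ a b => a - b) h h').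
exists (zx \- zx'), (zxx \- zxx'), (ex \- ex'), (exx \- exx'), (yx \- yx'),
  (wx \- wx'), (wxx \- wxx'); split; split=> /=.
- by case: Z1 => *; case: A1 => *; split; exact: H1derivB.
- by split; exact: aeB.
- by rewrite Z3 A3; ring.
- by rewrite Z4 A4 subrr.
- by case: E1 => *; case: F1 => *; split; exact: H1derivB.
- by split; exact: aeB.
- by rewrite E3 F3; ring.
- by rewrite E4 F4; ring.
- by split; [|exists (yxx \- yxx')]; exact: H1derivB.
- apply: eq_ae01_trans (aeB _ _ _ _ Y2 G2) _.
  by apply/aeW => x _ /=; ring.
- by rewrite Y3 G3; ring.
- by case: W1 => *; case: H1 => *; split; exact: H1derivB.
- split; first exact: aeB.
  apply: eq_ae01_trans (aeB _ _ _ _ W2' H2') _.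
  by apply/aeW => x _ /=; ring.
- by rewrite W3 H3; ring.
- by rewrite W4 H4; ring.
Qed.

Lemma system_op_scale k V W : op V W -> op (scale_state k V) (scale_state k W).
Proof.
move=> [zx [zxx [ex [exx [yx [wx [wxx [[Z1 [Z2 Z2'] Z3 Z4] [E1 [E2 E2'] E3 E4]
  [[Y1 [yxx Y1']] Y2 Y3] [W1 [W2 W2'] W3 W4]]]]]]]]].
have aeZ (u v : R -> R) : eq_ae01 u v -> eq_ae01 (k \*o u) (k \*o v) :> Prop.
  by move=> h; exact: (eq_ae01_comp2 (fun _ a b => k * a) h h).
exists (k \*o zx), (k \*o zxx), (k \*o ex), (k \*o exx), (k \*o yx),
  (k \*o wx), (k \*o wxx); split; split=> /=.
- by case: Z1 => *; split; exact: H1derivZ.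
- by split; exact: aeZ.
- by rewrite Z3; ring.
- by rewrite Z4 mulr0.
- by case: E1 => *; split; exact: H1derivZ.
- by split; exact: aeZ.
- by rewrite E3; ring.
- by rewrite E4; ring.
- by split; [|exists (k \*o yxx)]; exact: H1derivZ.
- apply: eq_ae01_trans (aeZ _ _ Y2) _.
  by apply/aeW => x _ /=; ring.
- by rewrite Y3; ring.
- by case: W1 => *; split; exact: H1derivZ.
- split; first exact: aeZ.
  apply: eq_ae01_trans (aeZ _ _ W2') _.
  by apply/aeW => x _ /=; ring.
- by rewrite W3; ring.
- by rewrite W4; ring.
Qed.

Definition compat U : Prop := s_Y U 0 = - c0 * s_eps U 0.

Lemma linear_form_traceeps : linear_form (fun U => s_eps U 0).
Proof.
apply: (@linear_form_trace0 _ (@s_eps R)) => //; first by move=> U /inX_H1[].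
  exact: (@Xcomp_bounded_L2 _ 0).
exact: (@Xcomp_bounded_L2 _ 1).
Qed.

Lemma linear_form_traceY : linear_form (fun U => s_Y U 0).
Proof.
apply: (@linear_form_trace0 _ (@s_Y R)) => //; first by move=> U /inX_H1[].
  exact: (@Xcomp_bounded_L2 _ 3).
exact: (@Xcomp_bounded_L2 _ 4).
Qed.

Section curve.
Variables (U V : R -> state R).
Hypothesis cU : Xcontinuous U.
Hypothesis pV : Xprimitive U V.
Hypothesis UV : forall t, 0 <= t -> op (V t) (sub_state (U t) (U 0)).

Let UX t : 0 <= t -> inX (U t). Proof. by move=> /cU[]. Qed.
Let VX t : 0 <= t -> inX (V t). Proof. by case: pV => /(_ t). Qed.

(** The form [p] is bounded and vanishes on the domain of the operator, hence on every [V s]. As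
    [U t] is a limit of difference quotients of [V], it vanishes on [U t] as well. *)
Lemma solution_compat t : 0 <= t -> compat (U t).
Proof.
move=> t0; pose p U := s_Y U 0 + c0 * s_eps U 0.
have [pB pZ [C C0 pC]] : linear_form p by apply: linear_form_add linear_form_traceY (linear_form_scale _ linear_form_traceeps).
have pV0 s : 0 <= s -> p (V s) = 0.
  move=> s0; have [zx [? [ex [? [yx [? [? [_ _ [_ _ YE] _]]]]]]]] := UV s0.
  by rewrite /p YE; ring.
suff : p (U t) = 0 by rewrite /p /compat => h; apply/eqP; rewrite -subr_eq0 -[X in _ == X]h; apply/eqP; ring.
apply/eqP; rewrite -normr_eq0; apply: contraT => p0.
have {}p0 : 0 < `|p (U t)| by rewrite lt0r p0 normr_ge0.
have [_ _ /(_ t t0)] := pV.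
(* With this tolerance [C] times the distance from the quotient to [U t] stays below the value [p]
   takes on [U t], a contradiction. *)
move=> /cvg_within_dnbhsP/(_ (`|p (U t)| / (2 * (C + 1)))).
case; first by rewrite divr_gt0// mulr_gt0// ltr_wpDl.
move=> d d0 hd; have d20 : 0 < d / 2 by rewrite divr_gt0.
have s0 : 0 <= t + d / 2 by rewrite addr_ge0// ltW.
have := hd (t + d / 2) s0; set s := t + d / 2 in s0 *.
have -> : s - t = d / 2 by rewrite /s; ring.
rewrite -subr_eq0; have -> : s - t = d / 2 by rewrite /s; ring.
rewrite gt_eqF// gtr0_norm// => /(_ isT); rewrite subr0 ger0_norm ?Xnorm_ge0// => h.
have {h} := h ltac:(lra); apply: contraLR => _; rewrite -ltNge.
have SX := inX_sub (VX s0) (VX t0).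
have DX := inX_scale (d / 2)^-1 SX.
have := pC _ (inX_sub DX (UX t0)).
rewrite (pB _ _ DX (UX t0)) (pZ _ _ SX) (pB _ _ (VX s0) (VX t0)) !pV0//.
rewrite subrr mulr0 sub0r normrN -/(Xdist _ _); set Y := Xdist _ _ => h.
have Y0 : 0 <= Y by exact: Xnorm_ge0.
rewrite ltr_pdivrMr ?mulr_gt0 ?ltr_wpDl//.
by move: h p0 Y0; lra.
Qed.

(* dquot V h is a strong solution with time derivative dquot U h, so dissipation
   applies to it; letting h tend to 0 transfers the decay to U. *)
Definition dquot (W : R -> state R) h t := scale_state h^-1 (sub_state (W (t + h)) (W t)).

Lemma dquot_derive h t : 0 < h -> 0 <= t ->
  Xdist (scale_state (s - t)^-1 (sub_state (dquot V h s) (dquot V h t))) (dquot U h t)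
    @[s --> within [set s | 0 <= s] (dnbhs t)] --> (0 : R).
Proof.
move=> h0 t0; have th0 : 0 <= t + h by rewrite addr_ge0// ltW.
have [_ _ dV] := pV; have /cvg_within_dnbhsP d1 := dV _ t0.
have /cvg_within_dnbhsP d2 := dV _ th0.
apply/cvg_within_dnbhsP => e e0.
(* [Xnorm_sub_le2] costs a factor 2 and the quotient a factor [h^-1]:
   [h^-1 * (2 * (e' + e')) = e]. *)
pose e' := e * h / 4; have e'0 : 0 < e' by rewrite divr_gt0// mulr_gt0.
have [r1 r10 H1] := d1 _ e'0; have [r2 r20 H2] := d2 _ e'0.
exists (Num.min r1 r2); first by rewrite lt_min r10.
move=> s s0 st; rewrite lt_min => /andP[sr1 sr2].
have sh0 : 0 <= s + h by rewrite addr_ge0// ltW.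
have := H1 s s0 st sr1; have := H2 (s + h) sh0; rewrite (inj_eq (addIr h)) => /(_ st).
have -> : s + h - (t + h) = s - t by ring.
move=> /(_ sr2); rewrite !subr0 !ger0_norm ?Xnorm_ge0//.
rewrite /Xdist; set A := sub_state _ (U (t + h)); set A' := sub_state _ (U t).
have AX : inX A by apply: inX_sub; [apply: inX_scale; apply: inX_sub; exact: VX|exact: UX].
have A'X : inX A' by apply: inX_sub; [apply: inX_scale; apply: inX_sub; exact: VX|exact: UX].
rewrite (_ : sub_state _ _ = scale_state h^-1 (sub_state A A')); last first.
  rewrite /A /A' /dquot; case: (V (s + h)) (V s) (V (t + h)) (V t) (U (t + h)) (U t).
  move=> ? ? ? ? ? ? ? [? ? ? ? ? ? ?] [? ? ? ? ? ? ?] [? ? ? ? ? ? ?] [? ? ? ? ? ? ?] [? ? ? ? ? ? ?].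
  by congr State; apply/funext => x /=; ring.
move=> hA hA'; rewrite Xnorm_scale_abs; last exact: inX_sub.
have := Xnorm_sub_le2 AX A'X; set N := Xnorm (sub_state A A') => hN.
rewrite gtr0_norm ?invr_gt0// ler_pdivrMl//.
by move: hA hA'; rewrite /e'; lra.
Qed.

Lemma dquot_op h t : 0 < h -> 0 <= t -> op (dquot V h t) (dquot U h t).
Proof.
move=> h0 t0; have th0 : 0 <= t + h by rewrite addr_ge0// ltW.
have := system_op_scale h^-1 (system_op_sub (UV th0) (UV t0)).
rewrite (_ : sub_state (sub_state _ _) _ = sub_state (U (t + h)) (U t))//.
case: (U (t + h)) (U t) (U 0) => ? ? ? ? ? ? ? [? ? ? ? ? ? ?] [? ? ? ? ? ? ?].
by congr State; apply/funext => x /=; ring.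
Qed.

Lemma dquot_inX (W : R -> state R) h t : (forall s, 0 <= s -> inX (W s)) -> 0 < h -> 0 <= t ->
  inX (dquot W h t).
Proof.
move=> WX h0 t0; have th0 : 0 <= t + h by rewrite addr_ge0// ltW.
by apply: inX_scale; apply: inX_sub; exact: WX.
Qed.

(** Continuity of the quadratic form at [U t]. Only forward quotients are used, so the time 0 is
    covered. *)
Lemma bilinear_form_dquot_cvg B t : bilinear_form B -> 0 <= t ->
  forall e, 0 < e -> exists2 d, 0 < d & forall h, 0 < h -> h < d ->
    `|B (dquot V h t) (dquot V h t) - B (U t) (U t)| <= e.
Proof.
move=> [BB BZ [C C0 BC]] t0 e e0.
have [_ _ /(_ t t0)/cvg_within_dnbhsP dV] := pV.
(* As soon as the error has norm at most 1, its square is at most itself, and [K] bounds the linear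
   and quadratic terms together. *)
pose K := C * (2 * Xnorm (U t) + 1) + 1.
have K0 : 0 < K by rewrite ltr_wpDl// mulr_ge0// addr_ge0// mulr_ge0// Xnorm_ge0.
have e1 : 0 < Num.min 1 (e / K) by rewrite lt_min ltr01 divr_gt0.
have [d d0 hd] := dV _ e1.
exists d => // h h0 hd'; have th0 : 0 <= t + h by rewrite addr_ge0// ltW.
have := hd (t + h) th0; rewrite -subr_eq0 addrAC subrr add0r gt_eqF// gtr0_norm//.
move=> /(_ isT hd'); rewrite subr0 ger0_norm ?Xnorm_ge0// -/(dquot V h t) /Xdist.
have DX : inX (dquot V h t) by exact: dquot_inX.
have EX := inX_sub DX (UX t0).
set E := sub_state _ _ in EX *; rewrite le_min => /andP[E1 Ee].
have -> : B (dquot V h t) (dquot V h t) - B (U t) (U t) =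
    B E (U t) + B (U t) E + B E E.
  have [-> ->] := BB _ _ _ DX (UX t0) (UX t0).
  have [-> _] := BB _ _ _ DX (UX t0) EX.
  have [_ ->] := BB _ _ _ DX (UX t0) DX.
  have [_ ->] := BB _ _ _ DX (UX t0) (UX t0).
  by ring.
have b1 := BC _ _ EX (UX t0); have b2 := BC _ _ (UX t0) EX; have b3 := BC _ _ EX EX.
rewrite (le_trans (ler_normD _ _))// (@le_trans _ _ (K * Xnorm E))//; last first.
  by rewrite mulrC -ler_pdivlMr.
have := ler_normD (B E (U t)) (B (U t) E); have := Xnorm_ge0 E; have := Xnorm_ge0 (U t).
move: b1 b2 b3 E1 C0; rewrite /K; set n := Xnorm E; set m := Xnorm (U t).
set x := `|_|; set y := `|B (U t) E|; set z := `|B E E|; set w := `|_ + _|.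
clear; move=> b1 b2 b3 n1 C0 m0 n0 w1.
have : C * (n * n) <= C * n by rewrite ler_wpM2l// ler_piMl.
by nra.
Qed.

Lemma solution_decay B m : bilinear_form B ->
  (forall V W, inX V -> inX W -> op V W -> compat W ->
     B V W + B W V <= - m * B V V) ->
  forall t, 0 <= t -> B (U t) (U t) <= expR (- m * t) * B (U 0) (U 0).
Proof.
move=> bB diss t t0.
have UX' s : 0 <= s -> inX (U s) by exact: UX.
have VX' s : 0 <= s -> inX (V s) by exact: VX.
have dec h : 0 < h -> B (dquot V h t) (dquot V h t) <=
    expR (- m * t) * B (dquot V h 0) (dquot V h 0).
  move=> h0; apply: (@exp_decay _ (fun s => B (dquot V h s) (dquot V h s))
    (fun s => B (dquot V h s) (dquot U h s) + B (dquot U h s) (dquot V h s))) => // s s0.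
    apply: bilinear_form_derive => //; [|exact: dquot_inX|exact: dquot_derive].
    by move=> r r0; exact: dquot_inX.
  apply: diss; [exact: dquot_inX|exact: dquot_inX|exact: dquot_op|].
  (* The dissipation estimate wants the compatibility condition on the time derivative [dquot U h];
     it is inherited from [U]. *)
  have sh0 : 0 <= s + h by rewrite addr_ge0// ltW.
  have := solution_compat s0; have := solution_compat sh0.
  by rewrite /compat /dquot/= => -> ->; ring.
apply/ler_addgt0Pr => e e0.
pose a := expR (- m * t); have a0 : 0 < a by exact: expR_gt0.
(* The error is spent once at time [t] and [a] times at time 0. *)
have e1 : 0 < e / (1 + a) by rewrite divr_gt0// addr_gt0.
have [d1 d10 H1] := bilinear_form_dquot_cvg bB t0 e1.
have [d2 d20 H2] := bilinear_form_dquot_cvg bB (lexx 0) e1.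
pose h := Num.min d1 d2 / 2.
have m0 : 0 < Num.min d1 d2 by rewrite lt_min d10.
have h0 : 0 < h by rewrite divr_gt0.
have hm : h < Num.min d1 d2 by rewrite /h; lra.
move: (hm); rewrite lt_min => /andP[hd1 hd2].
have := H1 h h0 hd1; have := H2 h h0 hd2; have := dec h h0; rewrite -/a.
rewrite !ler_norml => h3 /andP[h1 h1'] /andP[h2 h2'].
have : a * B (dquot V h 0) (dquot V h 0) <= a * (B (U 0) (U 0) + e / (1 + a)).
  by rewrite ler_pM2l//; lra.
have : e = (1 + a) * (e / (1 + a)) by field; rewrite gt_eqF// addr_gt0.
by lra.
Qed.

End curve.
End decay.

(** * Scalar inequalities behind the three dissipation estimates *)

Section real_inequalities.
Variable R : realType.

(** Here [a], [a'] stand for z(0) and z_t(0), [u0], [u1] for z_x(0) and z_x(1), [L], [S] for the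
    squared norms of the left- and right-moving invariants, [m] for the functional of the cross
    term. At x = 0 the unweighted flux is [- 4 * (a' * u0)]: its part in [a * a'] cancels against
    the potential term, and [- 4 * C0 * a' ^+ 2] remains to absorb everything of order [d]. The
    bounds on [d] and [d * C1] serve coercivity. *)
Lemma energy_inequality_z (C0 C1 : R) : 0 < C0 -> 0 < C1 ->
  exists d : R, [/\ 0 < d, d <= 8^-1, d * C1 <= 16^-1 &
  forall a a' u0 u1 L S m : R, u0 = C1 * a + C0 * a' -> m ^+ 2 <= 2 * L + 2 * S ->
  (1 - d) * u1 ^+ 2 - (1 - 2 * d) * (a' + u0) ^+ 2 - d * L
  - ((1 + d) * u1 ^+ 2 - (1 + 2 * d) * (a' - u0) ^+ 2 + d * S)
  + 4 * C1 * (a * a') + d * (8 * C1) * (a' * m + a * (2 * (- u0 - a)))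
  <= - (2 * d) * u1 ^+ 2 - d / 2 * (L + S) - 16 * d * C1 * a ^+ 2].
Proof.
(* [K] is the cost in [a' ^+ 2] of the terms of order [d]: 4 from the weights, [64 * C1 ^+ 2] from
   absorbing [a' * m] into [L + S], and [6 * C0 ^+ 2] from completing the square in [u0], where 4 +
   16/9 would do. *)
move=> C00 C10; pose K : R := 4 + 64 * C1 ^+ 2 + 6 * C0 ^+ 2.
have K0 : 0 < K by rewrite /K; nra.
pose d := Num.min 8^-1 (Num.min (16 * (1 + C1))^-1 (4 * C0 / K)).
have d0 : 0 < d.
  rewrite !lt_min invr_gt0 ltr0n /= invr_gt0 divr_gt0// ?andbT; [lra|lra].
have [d1 d2 d3] : [/\ d <= 8^-1, d <= (16 * (1 + C1))^-1 & d <= 4 * C0 / K].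
  by split; rewrite /d !ge_min lexx ?orbT.
exists d; split=> //.
  have : d * (16 * (1 + C1)) <= 1 by rewrite -ler_pdivlMr ?mul1r//; lra.
  by lra.
move=> a a' u0 u1 L S m u0E mLS.
have dK : d * K <= 4 * C0 by rewrite -ler_pdivlMr.
have E : - K * a' ^+ 2 <= - 4 * a' ^+ 2 - 4 * u0 ^+ 2 + (L + S) / 2 - 8 * C1 * (a' * m)
    + 16 * C1 ^+ 2 * a ^+ 2 + 16 * C1 * C0 * (a * a').
  have := sqr_ge0 (m / 2 - 8 * C1 * a'); have := sqr_ge0 (3 * C1 * a + 4 / 3 * (C0 * a')).
  rewrite /K u0E; have := sqr_ge0 (C1 * a); have := sqr_ge0 (C0 * a').
  move: mLS; clear; rewrite !expr2; lra.
have := ler_wpM2l (ltW d0) E; have := ler_wpM2r (sqr_ge0 a') dK.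
rewrite u0E /K !expr2; lra.
Qed.

(** In addition to the roles above, [y0], [y1], [N] are the traces and the squared norm of Y_x, and
    [Z] is the trace z_x(1), treated as a source. The flux [l0 ^+ 2 - s0 ^+ 2] contains
    [4 * c0 * (1 - c0) * a' ^+ 2], called [D * a' ^+ 2] in the proof. One half of it pays for the
    inflow of Y_x, which fixes the weight [k], the other half for the terms of order [d]. *)
Lemma energy_inequality_eps (c0 c1 : R) : 0 < c0 < 1 -> 0 < c1 ->
  exists d k C : R, [/\ [/\ 0 < d, d <= 8^-1, 64 * (d * c1) <= 1 & 36 * d <= 1 - c0],
   0 < k &
  forall a a' l0 l1 s0 s1 y0 y1 L S N J Z : R,
  l0 = a' + c1 * a -> s0 = a' - c1 * a - 2 * c0 * a' -> y0 = c0 * a' ->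
  l1 = s1 - 2 * Z -> 0 <= L -> 0 <= S ->
  J ^+ 2 <= 4 * L + 4 * S + 8 * a ^+ 2 ->
  (1 - d) * l1 ^+ 2 - (1 - 2 * d) * l0 ^+ 2 - d * L
  - ((1 + d) * s1 ^+ 2 - (1 + 2 * d) * s0 ^+ 2 + d * S)
  + 4 * c1 * (1 - c0) * (a * a')
  + d * (8 * c1) * (a' * J + a * ((l1 - l0) - (s1 - s0) + 2 * c0 * a'))
  + k * - (y1 ^+ 2 - 2 * y0 ^+ 2 + N)
  <= - (d / 2) * (L + S) - 3 * d * c1 ^+ 2 * a ^+ 2 - k * N + C * Z ^+ 2].
Proof.
move=> /andP[c00 c01] c10; pose D := 4 * c0 * (1 - c0).
have D0 : 0 < D by rewrite !mulr_gt0// subr_gt0.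
(* Weight of [J ^+ 2] in Young's inequality for [a' * J]: the bound on [J ^+ 2] then fits into
   [(L + S) / 2] and [c1 ^+ 2 * a ^+ 2]. *)
pose th := Num.min 8^-1 (c1 ^+ 2 / 8).
have th0 : 0 < th by rewrite lt_min invr_gt0 ltr0n /= divr_gt0// exprn_gt0.
have [th1 th2] : th <= 8^-1 /\ th <= c1 ^+ 2 / 8 by rewrite /th !ge_min !lexx orbT.
pose K := 8 + 16 * c1 ^+ 2 / th.
have K0 : 0 < K by rewrite addr_gt0// divr_gt0// mulr_gt0// exprn_gt0.
pose d := Num.min (Num.min 8^-1 (64 * c1)^-1) (Num.min ((1 - c0) / 36) (D / 2 / K)).
have d0 : 0 < d.
  rewrite !lt_min invr_gt0 ltr0n invr_gt0 mulr_gt0//= !divr_gt0//; lra.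
have [d1 d2 d3 d4] : [/\ d <= 8^-1, d <= (64 * c1)^-1, d <= (1 - c0) / 36 & d <= D / 2 / K].
  by split; rewrite /d !ge_min lexx ?orbT.
(* With the weight [D / 4] the inflow term is [D / 2 * y0 ^+ 2]. The constant of [Z ^+ 2] collects
   [2 / d + 4] from the reflection at x = 1 and a remainder from the cross term. *)
exists d, (D / 4), (2 / d + 6); split.
- split=> //; last by lra.
  have : d * (64 * c1) <= 1 by rewrite -ler_pdivlMr ?mul1r//; lra.
  by lra.
- by rewrite divr_gt0.
move=> a a' l0 l1 s0 s1 y0 y1 L S N J Z l0E s0E y0E l1E L0 S0 JLS.
have dK : d * K <= D / 2 by rewrite -ler_pdivlMr.
have E0 : - (1 - 2 * d) * l0 ^+ 2 + (1 + 2 * d) * s0 ^+ 2 + 4 * c1 * (1 - c0) * (a * a')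
    <= - D * a' ^+ 2 + 8 * d * a' ^+ 2 + 8 * d * c1 ^+ 2 * a ^+ 2.
  have h : l0 ^+ 2 + s0 ^+ 2 <= 4 * a' ^+ 2 + 4 * c1 ^+ 2 * a ^+ 2.
    have := sqr_ge0 (a' - c1 * a); have := sqr_ge0 ((1 - 2 * c0) * a' + c1 * a).
    have : (1 - 2 * c0) ^+ 2 * a' ^+ 2 <= a' ^+ 2.
      by rewrite ler_piMl ?sqr_ge0//; nra.
    by rewrite l0E s0E; lra.
  have := ler_wpM2l (ltW d0) h; rewrite l0E s0E /D; lra.
have E1 : (1 - d) * l1 ^+ 2 - (1 + d) * s1 ^+ 2 <= (2 / d + 4) * Z ^+ 2.
  have h : 0 <= (2 / d) * (d * s1 + (1 - d) * Z) ^+ 2.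
    by rewrite mulr_ge0 ?sqr_ge0// divr_ge0// ltW.
  have hE : (2 / d) * (d * s1 + (1 - d) * Z) ^+ 2 = 2 * d * s1 ^+ 2 + 4 * (1 - d) * (s1 * Z)
     + (2 / d - 4 + 2 * d) * Z ^+ 2 by field; rewrite gt_eqF.
  rewrite l1E; have := mulr_ge0 (ltW d0) (sqr_ge0 Z); have := sqr_ge0 Z; move: h; rewrite hE; nra.
have E2 : 8 * c1 * (a' * J) <= th * J ^+ 2 + (K - 8) * a' ^+ 2.
  have h : 0 <= (th * J - 4 * c1 * a') ^+ 2 / th by rewrite divr_ge0 ?sqr_ge0// ltW.
  have hE : (th * J - 4 * c1 * a') ^+ 2 / th = th * J ^+ 2 - 8 * c1 * (a' * J)
     + 16 * c1 ^+ 2 / th * a' ^+ 2 by field; rewrite gt_eqF.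
  by move: h; rewrite hE /K; lra.
have E3 : th * J ^+ 2 <= (L + S) / 2 + c1 ^+ 2 * a ^+ 2.
  have := ler_wpM2l (ltW th0) JLS.
  have := ler_wpM2r L0 th1; have := ler_wpM2r S0 th1; have := ler_wpM2r (sqr_ge0 a) th2.
  by lra.
have E4 : 0 <= d * (2 * c1 * a + 4 * Z) ^+ 2 by rewrite mulr_ge0 ?sqr_ge0// ltW.
have E5 : D / 2 * y0 ^+ 2 <= D / 2 * a' ^+ 2.
  rewrite ler_pM2l ?divr_gt0// y0E exprMn ler_piMl ?sqr_ge0//; nra.
have E6 := ler_wpM2l (ltW d0) (le_trans E2 (lerD E3 (lexx _))).
have E7 := ler_wpM2r (sqr_ge0 a') dK.
have E8 := ler_wpM2r (sqr_ge0 Z) d1.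
have E9 : 0 <= D / 4 * y1 ^+ 2 by rewrite mulr_ge0 ?sqr_ge0 ?divr_ge0 ?ltW.
(* The trace added to [J] removes [a'] from its derivative; what is left, multiplied by [a], gives
   the sought term in [- a ^+ 2]. *)
have E10 : l1 - l0 - (s1 - s0) + 2 * c0 * a' = - 2 * Z - 2 * c1 * a.
  by rewrite l1E l0E s0E; ring.
rewrite E10; move: E0 E1 E4 E5 E6 E7 E8 E9; clear; lra.
Qed.

(** The damping sits at x = 1, where the flux is [- 4 * c3 * z1 ^+ 2], and the weights tilt the
    other way. At x = 0 they produce [- 2 * d * (a' ^+ 2 + u0 ^+ 2)]; since [u0] contains [c2 * a],
    the position trace is controlled without a cross term. *)
Lemma energy_inequality_w (c2 c3 G X : R) : 0 < c2 -> 0 < c3 -> 0 < X ->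
  exists d C : R, [/\ 0 < d, d <= 8^-1 &
  forall a a' e u0 z1 u1 L S I I' : R,
  u0 = c2 * a + G * e -> u1 = - c3 * z1 ->
  I ^+ 2 <= X * L -> I' ^+ 2 <= X * S ->
  (1 + 2 * d) * (z1 + u1) ^+ 2 - (1 + d) * (a' + u0) ^+ 2 - d * L + 2 * (e * I)
  - ((1 - 2 * d) * (z1 - u1) ^+ 2 - (1 - d) * (a' - u0) ^+ 2 + d * S) + 2 * (e * I')
  + 4 * c2 * (a * a')
  <= - (d / 2) * (L + S) - d * c2 ^+ 2 * a ^+ 2 + C * e ^+ 2].
Proof.
move=> c20 c30 X0.
have K0 : 0 < 1 + c3 ^+ 2 by nra.
(* The weights add [4 * d * (1 + c3 ^+ 2) * z1 ^+ 2] at x = 1, which must not exceed the damping. *)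
pose d := Num.min 8^-1 (c3 / (1 + c3 ^+ 2)).
have d0 : 0 < d by rewrite lt_min invr_gt0 ltr0n divr_gt0.
have [d1 d2] : d <= 8^-1 /\ d <= c3 / (1 + c3 ^+ 2) by rewrite /d !ge_min !lexx orbT.
exists d, (2 * G ^+ 2 / d + 2 * d * G ^+ 2 + 4 * X / d); split=> //.
move=> a a' e u0 z1 u1 L S I I' u0E u1E IL IS.
have dK : d * (1 + c3 ^+ 2) <= c3 by rewrite -ler_pdivlMr.
(* Young's inequality, which puts half of the available [d * Y] on the source. *)
have src (Y i : R) : i ^+ 2 <= X * Y -> 2 * (e * i) <= d / 2 * Y + 2 * X / d * e ^+ 2.
  move=> h.
  have h1 : 0 <= (d * i - 2 * X * e) ^+ 2 / (2 * X * d).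
    by rewrite divr_ge0 ?sqr_ge0// !mulr_ge0// ltW.
  have h2 : (d * i - 2 * X * e) ^+ 2 / (2 * X * d) =
     d / 2 * (i ^+ 2 / X) - 2 * (e * i) + 2 * X / d * e ^+ 2.
    by field; rewrite !gt_eqF.
  have h3 : i ^+ 2 / X <= Y by rewrite ler_pdivrMr// mulrC.
  have : d / 2 * (i ^+ 2 / X) <= d / 2 * Y by rewrite ler_pM2l// divr_gt0.
  by move: h1; rewrite h2; lra.
have E1 := src _ _ IL; have E2 := src _ _ IS.
have E3 : 0 <= (d * a' + G * e) ^+ 2 / d by rewrite divr_ge0 ?sqr_ge0// ltW.
have E3' : (d * a' + G * e) ^+ 2 / d = d * a' ^+ 2 + 2 * G * (e * a') + G ^+ 2 / d * e ^+ 2.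
  by field; rewrite gt_eqF.
rewrite E3' in E3.
have E4 : 0 <= d * (c2 * a + 2 * G * e) ^+ 2 by rewrite mulr_ge0 ?sqr_ge0// ltW.
have E5 := ler_wpM2r (sqr_ge0 z1) dK.
have E6 : 4 * X / d * e ^+ 2 = 2 * (2 * X / d * e ^+ 2) by ring.
have E7 : 2 * G ^+ 2 / d * e ^+ 2 = 2 * (G ^+ 2 / d * e ^+ 2) by ring.
have E8 : (2 * G ^+ 2 / d + 2 * d * G ^+ 2 + 4 * X / d) * e ^+ 2 =
  2 * (G ^+ 2 / d * e ^+ 2) + 2 * d * G ^+ 2 * e ^+ 2 + 2 * (2 * X / d * e ^+ 2) by ring.
rewrite E8 u0E u1E; move: E1 E2 E3 E4 E5; clear.
set A := G ^+ 2 / d * _; set B := 2 * X / d * _; lra.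
Qed.
End real_inequalities.

(** * Riemann invariants, and the Lyapunov form of z *)

Section riemann_invariants.
Variable R : realType.
Implicit Types (U V W : state R).

Definition weighted_ip (a b : R) (u v : R -> R) : R := ip (fun x => (a + b * x) * u x) v.

Lemma wipC a b u v : weighted_ip a b u v = weighted_ip a b v u.
Proof. by apply: eq_Rintegral => x _; ring. Qed.

Lemma weighted_ip_bounds a b lo hi u : L2 u ->
  (forall x, 0 < x < 1 -> lo <= a + b * x <= hi) ->
  lo * ip u u <= weighted_ip a b u u <= hi * ip u u.
Proof.
move=> uL h; have AL := L2_affM a b uL.
rewrite -!ipZl//; apply/andP; split; apply: le_Rintegral => //;
  try (apply: L2_mul_integrable => //; exact: L2Z).
  move=> x /=; rewrite in_itv/= => /h/andP[lx _].
  by rewrite -!mulrA ler_wpM2r// -expr2 sqr_ge0.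
move=> x /=; rewrite in_itv/= => /h/andP[_ xh].
by rewrite -!mulrA ler_wpM2r// -expr2 sqr_ge0.
Qed.

(* Time derivative of the weighted energy of a component that satisfies
   v_t = sg v_x + r, where p is the continuous representative of v. *)
Lemma weighted_ip_transport a b sg (p p' r v w : R -> R) :
  H1deriv p p' -> L2 r -> L2 v -> L2 w -> eq_ae01 v p ->
  eq_ae01 w (fun x => sg * p' x + r x) ->
  weighted_ip a b v w + weighted_ip a b w v =
  sg * ((a + b) * p 1 ^+ 2 - a * p 0 ^+ 2 - b * ip v v) + 2 * weighted_ip a b v r.
Proof.
move=> pp' rL vL wL vp wp; have pL := H1deriv_L2 pp'; have p'L := pp'.1.
have cL : L2 (fun x => sg * p' x + r x) by apply: L2D => //; exact: L2Z.
rewrite [weighted_ip a b w v]wipC.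
have -> : weighted_ip a b v w = sg * weighted_ip a b p p' + weighted_ip a b v r.
  rewrite /weighted_ip [LHS]ipC (ip_ae wL cL (L2_affM _ _ vL) wp).
  have AvL := L2_affM a b vL.
  rewrite -[X in ip X _]/((sg \*o p') \+ r) (ipDl (L2Z sg p'L) rL AvL).
  rewrite (ipZl _ p'L AvL) (ipC r); congr (_ * _ + _).
  have vp' : eq_ae01 (fun x => (a + b * x) * v x) (fun x => (a + b * x) * p x).
    exact: (eq_ae01_comp2 (fun x u _ => (a + b * x) * u) vp vp).
  by rewrite ipC (ip_ae (L2_affM _ _ vL) (L2_affM _ _ pL) p'L vp').
have := weighted_ibp a b pp'; rewrite -/(weighted_ip a b p p').
rewrite -(ip_ae vL pL pL vp) ipC -(ip_ae vL pL vL vp) => h.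
by have -> : sg * weighted_ip a b p p' + weighted_ip a b v r + (sg * weighted_ip a b p p' + weighted_ip a b v r) =
  sg * (2 * weighted_ip a b p p') + 2 * weighted_ip a b v r; [ring|rewrite h].
Qed.

Lemma bounded_L2_sub (P Q : state R -> (R -> R)) : bounded_L2 P -> bounded_L2 Q -> bounded_L2 (fun U => P U \- Q U).
Proof.
move=> bP bQ; rewrite (_ : (fun U => _) =
   (fun U => P U \+ (fun x => (-1 + 0 * x) * Q U x))).
  by apply: bounded_L2_add bP (bounded_L2_aff _ _ bQ).
by apply/funext => U; apply/funext => x /=; ring.
Qed.

(* Riemann invariants u_t + u_x and u_t - u_x, travelling to the left and to
   the right; adding - 2 Y_x turns eps_x(1) = - z_x(1) - Y_x(1) into the plain
   reflection right(1) = left(1) + 2 z_x(1). *)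
Definition left_z U := s_zt U \+ deriv01 (s_z U).
Definition right_z U := s_zt U \- deriv01 (s_z U).
Definition left_eps U := s_epst U \+ deriv01 (s_eps U).
Definition right_eps U := (s_epst U \- deriv01 (s_eps U)) \- (fun x => (2 + 0 * x) * deriv01 (s_Y U) x).
Definition deriv_Y U := deriv01 (s_Y U).
Definition left_w U := s_wt U \+ deriv01 (s_w U).
Definition right_w U := s_wt U \- deriv01 (s_w U).

Lemma bounded_L2_components : [/\ [/\ bounded_L2 left_z & bounded_L2 right_z],
  [/\ bounded_L2 left_eps, bounded_L2 right_eps & bounded_L2 deriv_Y] &
  [/\ bounded_L2 left_w & bounded_L2 right_w]].
Proof.
have b n : (n < 11)%N -> bounded_L2 (nth (@s_eps R) (@Xcomp R) n) by exact: Xcomp_bounded_L2.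
split; split.
- exact: bounded_L2_add (b 7 isT) (b 6 isT).
- exact: bounded_L2_sub (b 7 isT) (b 6 isT).
- exact: bounded_L2_add (b 2 isT) (b 1 isT).
- exact: bounded_L2_sub (bounded_L2_sub (b 2 isT) (b 1 isT)) (bounded_L2_aff _ _ (b 4 isT)).
- exact: (b 4 isT).
- exact: bounded_L2_add (b 10 isT) (b 9 isT).
- exact: bounded_L2_sub (b 10 isT) (b 9 isT).
Qed.

Lemma bilinear_form_wip a b P Q : bounded_L2 P -> bounded_L2 Q -> bilinear_form (fun U V => weighted_ip a b (P U) (Q V)).
Proof. by move=> bP bQ; exact: bilinear_form_ip (bounded_L2_aff a b bP) bQ. Qed.

Lemma linear_form_tracez : linear_form (fun U => s_z U 0).
Proof.
apply: (@linear_form_trace0 _ (@s_z R)) => //; first by move=> U /inX_H1[].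
  exact: (@Xcomp_bounded_L2 _ 5).
exact: (@Xcomp_bounded_L2 _ 6).
Qed.

Lemma linear_form_tracew : linear_form (fun U => s_w U 0).
Proof.
apply: (@linear_form_trace0 _ (@s_w R)) => //; first by move=> U /inX_H1[].
  exact: (@Xcomp_bounded_L2 _ 8).
exact: (@Xcomp_bounded_L2 _ 9).
Qed.

Lemma ip_add_le (u v : R -> R) : L2 u -> L2 v ->
  ip (u \+ v) (u \+ v) <= 2 * ip u u + 2 * ip v v.
Proof.
move=> uL vL; have := ip_ge0 (u \- v).
have := L2D uL vL; have := L2B uL vL => ? ?.
by rewrite !(ipDl, ipDr, ipBl, ipBr)//; lra.
Qed.

Lemma ip_sum_sqr_le (phi u v : R -> R) : L2 phi -> L2 u -> L2 v ->
  (forall x, 0 < x < 1 -> `|phi x| <= 1) ->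
  ip phi (u \+ v) ^+ 2 <= 2 * ip u u + 2 * ip v v.
Proof.
move=> phiL uL vL phi1; apply: le_trans (ip_CS phiL (L2D uL vL)) _.
apply: le_trans (ip_add_le uL vL).
rewrite ler_piMl ?ip_ge0// -(ip11 R); apply: ip_le => //; first exact: L2_cst.
by move=> x /phi1; rewrite normr1.
Qed.

Definition energy_z U := ip (left_z U) (left_z U) + ip (right_z U) (right_z U) + s_z U 0 ^+ 2.
Definition energy_eps U := ip (left_eps U) (left_eps U) + ip (right_eps U) (right_eps U) + ip (deriv_Y U) (deriv_Y U) + s_eps U 0 ^+ 2.
Definition energy_w U := ip (left_w U) (left_w U) + ip (right_w U) (right_w U) + s_w U 0 ^+ 2.

Lemma weight_le (d x : R) : 0 < d -> 0 < x < 1 -> 0 <= d * x <= d.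
Proof.
by move=> d0 /andP[x0 x1]; apply/andP; split; nra.
Qed.

(** The weight increases for the left-moving invariant and decreases for the right-moving one, so
    both bulk terms are negative. The square z_x(1)^2 is kept in the decay because that trace drives
    eps. *)
Lemma lyapunov_z (c0 c1 : R) : 0 < c0 < 1 -> 0 < c1 ->
  exists B k, [/\ bilinear_form B, 0 < k,
    forall V, inX V -> k * energy_z V <= B V V &
    forall V W zx zxx, inX V -> inX W ->
      H1deriv (s_z V) zx -> H1deriv zx zxx ->
      eq_ae01 (s_z W) (s_zt V) -> eq_ae01 (s_zt W) zxx ->
      zx 0 = c1 / (1 - c0) * s_z V 0 + c0 / (1 - c0) * s_z W 0 ->
      B V W + B W V <= - k * (energy_z V + zx 1 ^+ 2)].
Proof.
move=> /andP[c00 c01] c10; have c0' : 0 < 1 - c0 by rewrite subr_gt0.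
set C1 := c1 / _; set C0 := c0 / _.
have C10 : 0 < C1 by rewrite divr_gt0.
have C00 : 0 < C0 by rewrite divr_gt0.
have [d [d0 d8 dC1 ineq]] := energy_inequality_z C00 C10.
have [[blz brz] _ _] := bounded_L2_components.
(* The cross term multiplies z(0) by twice the integral of (1 - x) z_t. Its derivative is - 2
   (z_x(0) + z(0)): the factor 1 - x removes the trace z_x(1), and z(0)^2 appears with a negative
   sign. *)
pose phi (x : R) := 1 + (-1) * x.
have phiL : L2 phi.
  by apply: L2_ext (L2_affM 1 (-1) (L2_cst 1)) => x _ /=; rewrite mulr1.
have phi1 x : 0 < x < 1 -> `|phi x| <= 1.
  by move=> /andP[x0 x1]; rewrite /phi ger0_norm; lra.
pose m U := ip phi (left_z U \+ right_z U).
have bm : linear_form m by exact: linear_form_ip phiL (bounded_L2_add blz brz).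
pose B U V := weighted_ip (1 - 2 * d) d (left_z U) (left_z V) + weighted_ip (1 + 2 * d) (- d) (right_z U) (right_z V)
  + 2 * C1 * (s_z U 0 * s_z V 0) + d * (8 * C1) * (s_z U 0 * m V).
have mle V : inX V -> m V ^+ 2 <= 2 * ip (left_z V) (left_z V) + 2 * ip (right_z V) (right_z V).
  move=> VX; apply: ip_sum_sqr_le => //; [by case: blz => -[/(_ V VX)]|by case: brz => -[/(_ V VX)]].
exists B, (Num.min (Num.min 4^-1 (C1 / 2)) (Num.min (d / 2) (16 * d * C1))).
set k := Num.min _ _.
have [k0 k1 k2 k3 k4] : [/\ 0 < k, k <= 4^-1, k <= C1 / 2, k <= d / 2 & k <= 16 * d * C1].
  split; rewrite /k ?ge_min ?lexx ?orbT//.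
  by rewrite !lt_min invr_gt0 ltr0n !divr_gt0//= mulr_gt0// mulr_gt0.
split=> //.
- apply: bilinear_form_add; [apply: bilinear_form_add; [apply: bilinear_form_add|]|].
  + exact: bilinear_form_wip. + exact: bilinear_form_wip.
  + exact: bilinear_form_scale (bilinear_form_mul linear_form_tracez linear_form_tracez).
  + exact: bilinear_form_scale (bilinear_form_mul linear_form_tracez bm).
- move=> V VX; have lL : L2 (left_z V) by case: blz => -[/(_ V VX)].
  have rL : L2 (right_z V) by case: brz => -[/(_ V VX)].
  have /andP[b1 _] := @weighted_ip_bounds (1 - 2 * d) d (1 - 2 * d) 1 _ lL (fun x hx =>
    ltac:(have /andP[h1 h2] := weight_le d0 hx; apply/andP; split; lra)).
  have /andP[b2 _] := @weighted_ip_bounds (1 + 2 * d) (- d) 1 (1 + 2 * d) _ rL (fun x hx =>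
    ltac:(have /andP[h1 h2] := weight_le d0 hx; apply/andP; split; lra)).
  have := mle V VX; rewrite /B /energy_z.
  move: b1 b2; set L := ip (left_z V) _; set S := ip (right_z V) _; set a := s_z V 0; set M := m V.
  set w1 := weighted_ip _ _ _ _; set w2 := weighted_ip _ _ _ _ => b1 b2 hM.
  have L0 : 0 <= L by exact: ip_ge0. have S0 : 0 <= S by exact: ip_ge0.
  (* A square plus the slack in the bound on [M ^+ 2]: this bounds the cross term from below. *)
  have h : 0 <= (4 * (d * C1)) * ((a + M) ^+ 2 + (2 * L + 2 * S - M ^+ 2)).
    apply: mulr_ge0; first exact: mulr_ge0 (ler0n _ 4) (mulr_ge0 (ltW d0) (ltW C10)).
    by rewrite addr_ge0 ?sqr_ge0 ?subr_ge0.
  have h1 := ler_wpM2r L0 d8; have h2 := ler_wpM2r L0 dC1; have h3 := ler_wpM2r S0 dC1.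
  have h4 : d * C1 * a ^+ 2 <= 8^-1 * C1 * a ^+ 2.
    by rewrite ler_wpM2r ?sqr_ge0// ler_wpM2r// ltW.
  have h5 := ler_wpM2r L0 k1; have h6 := ler_wpM2r S0 k1.
  have h7 := ler_wpM2r (sqr_ge0 a) k2.
  move: b1 b2 h h1 h2 h3 h4 h5 h6 h7 L0 S0 (mulr_ge0 (ltW C10) (sqr_ge0 a)); clear; lra.
- move=> V W zx zxx VX WX zVx zxxE WV WV' z0.
  have lL : L2 (left_z V) by case: blz => -[/(_ V VX)].
  have rL : L2 (right_z V) by case: brz => -[/(_ V VX)].
  have lWL : L2 (left_z W) by case: blz => -[/(_ W WX)].
  have rWL : L2 (right_z W) by case: brz => -[/(_ W WX)].
  have [_ _ HzW _] := inX_H1 WX; have z'W := H1_deriv01 HzW.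
  set zt' := deriv01 (s_z W) in z'W.
  have zW1 : s_z W 1 = 0 by case: WX => _ _ [[]].
  have zV1 : s_z V 1 = 0 by case: VX => _ _ [[]].
  have dV := deriv01_ae zVx; have WV2 := eq_ae01_sym WV.
  have lp : H1deriv (s_z W \+ zx) (zt' \+ zxx) by exact: H1derivD.
  have rp : H1deriv (s_z W \- zx) (zt' \- zxx) by exact: H1derivB.
  have lVp : eq_ae01 (left_z V) (s_z W \+ zx) by exact: (eq_ae01_comp2 (fun _ a b => a + b) WV2 dV).
  have rVp : eq_ae01 (right_z V) (s_z W \- zx) by exact: (eq_ae01_comp2 (fun _ a b => a - b) WV2 dV).
  have zt'E : eq_ae01 (deriv01 (s_z W)) zt' by exact: aeW.
  have lWp : eq_ae01 (left_z W) (fun x => 1 * (zt' \+ zxx) x + cst 0 x).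
    apply: eq_ae01_trans (eq_ae01_comp2 (fun _ a b => a + b) WV' zt'E) _.
    by apply/aeW => x _ /=; ring.
  have rWp : eq_ae01 (right_z W) (fun x => -1 * (zt' \- zxx) x + cst 0 x).
    apply: eq_ae01_trans (eq_ae01_comp2 (fun _ a b => a - b) WV' zt'E) _.
    by apply/aeW => x _ /=; ring.
  have wip0 a b v : weighted_ip a b v (cst 0) = 0.
    by rewrite /weighted_ip /ip; under eq_Rintegral do rewrite mulr0; rewrite Rintegral_cst// mul0r.
  have T1 := weighted_ip_transport (1 - 2 * d) d lp (L2_cst 0) lL lWL lVp lWp.
  have T2 := weighted_ip_transport (1 + 2 * d) (- d) rp (L2_cst 0) rL rWL rVp rWp.
  rewrite wip0 mulr0 addr0 /= zW1 in T1; rewrite wip0 mulr0 addr0 /= zW1 in T2.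
  have zxL := zVx.1.
  (* Integration by parts against [phi], which vanishes at 1; then z(1) = 0 evaluates the integral
     of z_x. *)
  have mW : m W = 2 * (- zx 0 - s_z V 0).
    have PW : H1deriv (fun x => phi x * zx x) (fun x => phi x * zxx x + zx x * (-1)).
      exact: (H1derivM (H1deriv_affine 1 (-1)) zxxE).
    have e1 := H1deriv_int PW; have e2 := H1deriv_int zVx.
    have AL : L2 (fun x => phi x * zxx x) by exact: L2_affM zxxE.1.
    have zxN : L2 (fun x => zx x * (-1)) by apply: L2_ext (L2N zxL) => x _; rewrite mulrN1.
    rewrite /m ipC; have sumE : eq_ae01 (left_z W \+ right_z W) (2 \*o zxx).
      apply: eq_ae01_trans (eq_ae01_comp2 (fun _ a b => a + b) lWp rWp) _.
      by apply/aeW => x _ /=; ring.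
    rewrite (ip_ae (L2D lWL rWL) (L2Z 2 zxxE.1) phiL sumE) (ipZl _ zxxE.1 phiL).
    congr (_ * _); rewrite (ipDr AL zxN (L2_cst 1)) in e1.
    have -> : ip zxx phi = ip (cst 1) (fun x => phi x * zxx x).
      by apply: eq_Rintegral => x _ /=; ring.
    have e3 : ip (cst 1) (fun x => zx x * -1) = - ip (cst 1) zx.
      by rewrite (_ : (fun x => zx x * -1) = (-1) \*o zx) ?ipZr ?mulN1r//; [exact: L2_cst|apply/funext => x /=; rewrite mulrC].
    by move: e1; rewrite e3 e2 zV1 /phi; lra.
  have := ineq (s_z V 0) (s_z W 0) (zx 0) (zx 1) _ _ (m V) z0 (mle V VX).
  have hk : - (2 * d) * zx 1 ^+ 2 <= - k * zx 1 ^+ 2.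
    by rewrite ler_wpM2r ?sqr_ge0//; lra.
  have h5 := ler_wpM2r (ip_ge0 (left_z V)) k3; have h6 := ler_wpM2r (ip_ge0 (right_z V)) k3.
  have h7 := ler_wpM2r (sqr_ge0 (s_z V 0)) k4.
  have -> : B V W + B W V = (weighted_ip (1 - 2 * d) d (left_z V) (left_z W) + weighted_ip (1 - 2 * d) d (left_z W) (left_z V))
    + (weighted_ip (1 + 2 * d) (- d) (right_z V) (right_z W) + weighted_ip (1 + 2 * d) (- d) (right_z W) (right_z V))
    + 4 * C1 * (s_z V 0 * s_z W 0) + d * (8 * C1) * (s_z W 0 * m V + s_z V 0 * m W).
    by rewrite /B; ring.
  rewrite T1 T2 mW /energy_z.
  move: hk h5 h6 h7; clear; lra.
Qed.
End riemann_invariants.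

(** * The Lyapunov form of eps and Y *)

Section lyapunov_eps.
Variable R : realType.
Implicit Types (U V W : state R) (u v : R -> R).

Lemma H1deriv_ext u u' v : (forall x, 0 <= x <= 1 -> u x = u' x) ->
  H1deriv u v -> H1deriv u' v.
Proof.
move=> uu' [vL h]; split=> // x x01.
by rewrite -!uu' ?lexx ?ler01//; exact: h.
Qed.

Lemma weighted_ip_cst0 a b v : weighted_ip a b v (cst 0) = 0.
Proof.
by rewrite /weighted_ip /ip; under eq_Rintegral do rewrite mulr0; rewrite Rintegral_cst// mul0r.
Qed.

(** Y enters only through Y_x, transported to the right with the decreasing weight 2 - x.
    Compatibility of [W] identifies the inflow of Y_x with c0 eps_t(0), which the damping at x = 0
    controls. *)
Lemma lyapunov_e (c0 c1 : R) : 0 < c0 < 1 -> 0 < c1 ->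
  exists B k C, [/\ bilinear_form B, 0 < k, 0 <= C,
    forall V, inX V -> k * energy_eps V <= B V V &
    forall V W ex exx y yy Z, inX V -> inX W ->
      H1deriv (s_eps V) ex -> H1deriv ex exx ->
      eq_ae01 (s_eps W) (s_epst V) -> eq_ae01 (s_epst W) exx ->
      ex 0 = c1 * s_eps V 0 -> ex 1 = - Z - y 1 ->
      H1deriv (s_Y V) y -> H1deriv y yy -> eq_ae01 (s_Y W) (\- y) ->
      compat c0 W ->
      B V W + B W V <= - k * energy_eps V + C * Z ^+ 2].
Proof.
move=> c001 c10; have /andP[c00 c01] := c001; have c0' : 0 < 1 - c0 by rewrite subr_gt0.
have [d [g [C [[d0 d8 dc1 dc0] g0 ineq]]]] := energy_inequality_eps c001 c10.
have [_ [ble bre byx] _] := bounded_L2_components R.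
(* The sum of the invariants is in divergence form, so its integral has only traces in its
   derivative; the added multiple of eps(0) cancels the velocity among them. *)
pose J U := ip (cst 1) (left_eps U \+ right_eps U) + 2 * c0 * s_eps U 0.
have bJ : linear_form J.
  apply: linear_form_add (linear_form_ip (L2_cst 1) (bounded_L2_add ble bre)) _.
  exact: linear_form_scale (linear_form_traceeps R).
pose B U V := weighted_ip (1 - 2 * d) d (left_eps U) (left_eps V) + weighted_ip (1 + 2 * d) (- d) (right_eps U) (right_eps V)
  + 2 * c1 * (1 - c0) * (s_eps U 0 * s_eps V 0) + d * (8 * c1) * (s_eps U 0 * J V)
  + g * weighted_ip 2 (-1) (deriv_Y U) (deriv_Y V).
have Jle V : inX V -> J V ^+ 2 <=
    4 * ip (left_eps V) (left_eps V) + 4 * ip (right_eps V) (right_eps V) + 8 * s_eps V 0 ^+ 2.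
  move=> VX.
  have : ip (cst 1) (left_eps V \+ right_eps V) ^+ 2 <= 2 * ip (left_eps V) (left_eps V) + 2 * ip (right_eps V) (right_eps V).
    apply: ip_sum_sqr_le; [exact: L2_cst|by case: ble => -[/(_ V VX)]|by case: bre => -[/(_ V VX)]|].
    by move=> x _; rewrite normr1.
  rewrite /J; set i := ip _ (_ \+ _); set a := s_eps V 0; set L := ip _ _; set S := ip _ _.
  have : c0 ^+ 2 * a ^+ 2 <= a ^+ 2 by rewrite ler_piMl ?sqr_ge0//; nra.
  by have := sqr_ge0 (i - 2 * c0 * a); clear; nra.
pose k := Num.min (Num.min 4^-1 (c1 * (1 - c0))) (Num.min (Num.min (d / 2) g) (3 * d * c1 ^+ 2)).
have [k0 k1 k2 [k3 k4 k5]] : [/\ 0 < k, k <= 4^-1, k <= c1 * (1 - c0) & [/\ k <= d / 2, k <= g & k <= 3 * d * c1 ^+ 2]].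
  split; last split; rewrite /k ?ge_min ?lexx ?orbT//.
  have p1 : 0 < 4^-1 :> R by rewrite invr_gt0.
  have p2 : 0 < d / 2 by rewrite divr_gt0.
  have p3 : 0 < c1 * (1 - c0) by rewrite mulr_gt0.
  have p4 : 0 < 3 * d * c1 ^+ 2 by rewrite mulr_gt0 ?exprn_gt0// mulr_gt0.
  by rewrite !lt_min p1 p2 p3 g0 p4.
exists B, k, (`|C|); split=> //.
- do 4?[apply: bilinear_form_add].
  + exact: bilinear_form_wip. + exact: bilinear_form_wip.
  + exact: bilinear_form_scale (bilinear_form_mul (linear_form_traceeps R) (linear_form_traceeps R)).
  + exact: bilinear_form_scale (bilinear_form_mul (linear_form_traceeps R) bJ).
  + exact: bilinear_form_scale (bilinear_form_wip _ _ byx byx).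
- move=> V VX; have lL : L2 (left_eps V) by case: ble => -[/(_ V VX)].
  have rL : L2 (right_eps V) by case: bre => -[/(_ V VX)].
  have yL : L2 (deriv_Y V) by case: byx => -[/(_ V VX)].
  have /andP[b1 _] := @weighted_ip_bounds _ (1 - 2 * d) d (1 - 2 * d) 1 _ lL (fun x hx =>
    ltac:(have /andP[h1 h2] := weight_le d0 hx; apply/andP; split; lra)).
  have /andP[b2 _] := @weighted_ip_bounds _ (1 + 2 * d) (- d) 1 (1 + 2 * d) _ rL (fun x hx =>
    ltac:(have /andP[h1 h2] := weight_le d0 hx; apply/andP; split; lra)).
  have /andP[b3 _] := @weighted_ip_bounds _ 2 (-1) 1 2 _ yL (fun x hx =>
    ltac:(have /andP[h1 h2] := hx; apply/andP; split; lra)).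
  have hM := Jle V VX; have L0 := ip_ge0 (left_eps V); have S0 := ip_ge0 (right_eps V).
  have N0 := ip_ge0 (deriv_Y V).
  rewrite /B /energy_eps; move: b1 b2 b3 hM L0 S0 N0.
  set L := ip (left_eps V) _; set S := ip (right_eps V) _; set a := s_eps V 0; set M := J V.
  set N := ip (deriv_Y V) _.
  set w1 := weighted_ip _ _ _ _; set w2 := weighted_ip _ _ _ _; set w3 := weighted_ip _ _ _ _ => b1 b2 b3 hM L0 S0 N0.
  have h : 0 <= (4 * (d * c1)) * ((a + M) ^+ 2 + (4 * L + 4 * S + 8 * a ^+ 2 - M ^+ 2)).
    apply: mulr_ge0; first exact: mulr_ge0 (ler0n _ 4) (mulr_ge0 (ltW d0) (ltW c10)).
    by rewrite addr_ge0 ?sqr_ge0 ?subr_ge0.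
  have h1 := ler_wpM2r L0 d8; have h2 := ler_wpM2r L0 dc1; have h3 := ler_wpM2r S0 dc1.
  have h4 : c1 * (36 * d) * a ^+ 2 <= c1 * (1 - c0) * a ^+ 2.
    by rewrite ler_wpM2r ?sqr_ge0// ler_wpM2l// ltW.
  have h5 := ler_wpM2r L0 k1; have h6 := ler_wpM2r S0 k1.
  have h7 := ler_wpM2r (sqr_ge0 a) k2.
  have h8 := ler_wpM2r N0 k4; have h9 := ler_wpM2l (ltW g0) b3.
  move: b1 b2 h h1 h2 h3 h4 h5 h6 h7 h8 h9 L0 S0; clear; lra.
- move=> V W ex exx y yy Z VX WX eVx exE WV WV' e0 e1 yVx yE WY cW.
  have lL : L2 (left_eps V) by case: ble => -[/(_ V VX)].
  have rL : L2 (right_eps V) by case: bre => -[/(_ V VX)].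
  have yL : L2 (deriv_Y V) by case: byx => -[/(_ V VX)].
  have lWL : L2 (left_eps W) by case: ble => -[/(_ W WX)].
  have rWL : L2 (right_eps W) by case: bre => -[/(_ W WX)].
  have yWL : L2 (deriv_Y W) by case: byx => -[/(_ W WX)].
  have [/H1_deriv01 e'W /H1_deriv01 y'W _ _] := inX_H1 WX.
  set et' := deriv01 (s_eps W) in e'W.
  have yN : H1deriv (-1 \*o y) (-1 \*o yy) by exact: H1derivZ.
  have WY' : eq_ae01 (s_Y W) (-1 \*o y).
    by apply: eq_ae01_trans WY _; apply/aeW => x _ /=; ring.
  (* Two absolutely continuous functions that agree a.e. agree at every point, in particular at 0,
     where the trace is needed. *)
  have WYE x : 0 <= x <= 1 -> (-1 \*o y) x = s_Y W x.
    by move=> x01; rewrite (H1deriv_ae_eq y'W yN WY' x01).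
  have dYW := deriv01_ae (H1deriv_ext WYE yN).
  have y0 : y 0 = c0 * s_eps W 0.
    by have := WYE 0; rewrite lexx ler01 => /(_ isT)/=; rewrite cW; lra.
  have dV := deriv01_ae eVx; have WV2 := eq_ae01_sym WV; have dY := deriv01_ae yVx.
  have lp : H1deriv (s_eps W \+ ex) (et' \+ exx) by exact: H1derivD.
  have rp : H1deriv ((s_eps W \- ex) \- (2 \*o y)) ((et' \- exx) \- (2 \*o yy)).
    by apply: H1derivB; [exact: H1derivB|exact: H1derivZ].
  have et'E : eq_ae01 (deriv01 (s_eps W)) et' by exact: aeW.
  have lVp : eq_ae01 (left_eps V) (s_eps W \+ ex) by exact: (eq_ae01_comp2 (fun _ a b => a + b) WV2 dV).
  have rVp : eq_ae01 (right_eps V) ((s_eps W \- ex) \- (2 \*o y)).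
    apply: eq_ae01_trans (eq_ae01_comp2 (fun x a b => a - (2 + 0 * x) * b)
      (eq_ae01_comp2 (fun _ a b => a - b) WV2 dV) dY) _.
    by apply/aeW => x _ /=; ring.
  have lWp : eq_ae01 (left_eps W) (fun x => 1 * (et' \+ exx) x + cst 0 x).
    apply: eq_ae01_trans (eq_ae01_comp2 (fun _ a b => a + b) WV' et'E) _.
    by apply/aeW => x _ /=; ring.
  have rWp : eq_ae01 (right_eps W) (fun x => -1 * ((et' \- exx) \- (2 \*o yy)) x + cst 0 x).
    apply: eq_ae01_trans (eq_ae01_comp2 (fun x a b => a - (2 + 0 * x) * b)
      (eq_ae01_comp2 (fun _ a b => a - b) WV' et'E) dYW) _.
    by apply/aeW => x _ /=; ring.
  have yWp : eq_ae01 (deriv_Y W) (fun x => -1 * yy x + cst 0 x).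
    by apply: eq_ae01_trans dYW _; apply/aeW => x _ /=; ring.
  have T1 := weighted_ip_transport (1 - 2 * d) d lp (L2_cst 0) lL lWL lVp lWp.
  have T2 := weighted_ip_transport (1 + 2 * d) (- d) rp (L2_cst 0) rL rWL rVp rWp.
  have T3 := weighted_ip_transport 2 (-1) yE (L2_cst 0) yL yWL dY yWp.
  rewrite weighted_ip_cst0 mulr0 addr0 in T1; rewrite weighted_ip_cst0 mulr0 addr0 in T2.
  rewrite weighted_ip_cst0 mulr0 addr0 in T3.
  set l := s_eps W \+ ex in lp T1; set r := _ \- (2 \*o y) in rp T2.
  have JW : J W = (l 1 - l 0) - (r 1 - r 0) + 2 * c0 * s_eps W 0.
    rewrite /J -(H1deriv_int lp) -(H1deriv_int rp) -(ipBr lp.1 rp.1 (L2_cst 1)).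
    congr (_ + _); rewrite ipC [RHS]ipC.
    apply: (ip_ae (L2D lWL rWL) (L2B lp.1 rp.1) (L2_cst 1)).
    apply: eq_ae01_trans (eq_ae01_comp2 (fun _ a b => a + b) lWp rWp) _.
    by apply/aeW => x _ /=; ring.
  have l0E : l 0 = s_eps W 0 + c1 * s_eps V 0 by rewrite /l/= e0.
  have r0E : r 0 = s_eps W 0 - c1 * s_eps V 0 - 2 * c0 * s_eps W 0.
    by rewrite /r/= e0 y0; ring.
  have l1E : l 1 = r 1 - 2 * Z by rewrite /l /r/= e1; ring.
  have := ineq (s_eps V 0) (s_eps W 0) (l 0) (l 1) (r 0) (r 1) (y 0) (y 1) _ _
    (ip (deriv_Y V) (deriv_Y V)) (J V) Z l0E r0E y0 l1E (ip_ge0 (left_eps V)) (ip_ge0 (right_eps V)) (Jle V VX).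
  have h5 := ler_wpM2r (ip_ge0 (left_eps V)) k3; have h6 := ler_wpM2r (ip_ge0 (right_eps V)) k3.
  have h7 := ler_wpM2r (sqr_ge0 (s_eps V 0)) k5; have h8 := ler_wpM2r (ip_ge0 (deriv_Y V)) k4.
  have h9 : C * Z ^+ 2 <= `|C| * Z ^+ 2 by rewrite ler_wpM2r ?sqr_ge0// ler_norm.
  have -> : B V W + B W V = (weighted_ip (1 - 2 * d) d (left_eps V) (left_eps W) + weighted_ip (1 - 2 * d) d (left_eps W) (left_eps V))
    + (weighted_ip (1 + 2 * d) (- d) (right_eps V) (right_eps W) + weighted_ip (1 + 2 * d) (- d) (right_eps W) (right_eps V))
    + 4 * c1 * (1 - c0) * (s_eps V 0 * s_eps W 0)
    + d * (8 * c1) * (s_eps W 0 * J V + s_eps V 0 * J W)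
    + g * (weighted_ip 2 (-1) (deriv_Y V) (deriv_Y W) + weighted_ip 2 (-1) (deriv_Y W) (deriv_Y V)).
    rewrite /B; do ?[set w := weighted_ip _ _ _ _]; ring.
  rewrite T1 T2 T3 JW /energy_eps; move: h5 h6 h7 h8 h9; clear.
  set L := ip (left_eps V) _; set S := ip (right_eps V) _; set N := ip (deriv_Y V) _; set a := s_eps V 0.
  set a' := s_eps W 0; set j := J V; set l0 := l 0; set l1 := l 1; set r0 := r 0; set r1 := r 1.
  set y0 := y 0; set y1 := y 1; set cc := `|C|; lra.
Qed.
End lyapunov_eps.

(** * The Lyapunov form of w, coercivity, and the combined form *)

Section lyapunov_all.
Variable R : realType.
Implicit Types (U V W : state R) (u v : R -> R).

Lemma expRM_L2 (k : R) : L2 (fun x => expR (k * x)).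
Proof.
have := @L2_bM R (fun x => expR (k * x)) (expR `|k|) (cst 1) _ _ (L2_cst 1).
rewrite (_ : _ \* _ = (fun x => expR (k * x))); last by apply/funext => x; rewrite /= mulr1.
apply=> [|x /andP[x0 x1]].
  by apply: measurable_funTS; apply: measurableT_comp.
rewrite ger0_norm ?expR_ge0// ler_expR (le_trans (ler_norm _))// normrM.
by rewrite ler_piMr// ger0_norm ltW.
Qed.

(** The added 1 makes the constant positive, as [energy_inequality_w] requires. *)
Lemma weighted_ip_sqr_le a b u v : L2 u -> L2 v -> (forall x, 0 < x < 1 -> `|a + b * x| <= 2) ->
  weighted_ip a b u v ^+ 2 <= (4 * ip v v + 1) * ip u u.
Proof.
move=> uL vL h; apply: le_trans (ip_CS (L2_affM a b uL) vL) _.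
have : ip (fun x => (a + b * x) * u x) (fun x => (a + b * x) * u x) <= 4 * ip u u.
  have -> : 4 * ip u u = ip (2 \*o u) (2 \*o u).
    by rewrite (ipZl 2 uL (L2Z 2 uL)) (ipZr 2 uL uL); ring.
  apply: ip_le; [exact: L2_affM|exact: L2Z|] => x /h hx.
  by rewrite !normrM ler_wpM2r// [leRHS]ger0_norm.
set A := ip _ _ => hA; have := ip_ge0 v; have := ip_ge0 u.
by move=> u0 v0; have := ler_wpM2r v0 hA; nra.
Qed.

Lemma lyapunov_w (q c1 c2 c3 : R) : 0 < c2 -> 0 < c3 ->
  exists B k C, [/\ bilinear_form B, 0 < k, 0 <= C,
    forall V, inX V -> k * energy_w V <= B V V &
    forall V W wx wxx e, inX V -> inX W ->
      H1deriv (s_w V) wx -> H1deriv wx wxx ->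
      eq_ae01 (s_w W) (s_wt V) ->
      eq_ae01 (s_wt W) (fun x => wxx x - (c1 + q) * (c2 + q) * expR (q * x) * e) ->
      wx 0 = c2 * s_w V 0 + (c1 + q) * e -> wx 1 = - c3 * s_w W 1 ->
      B V W + B W V <= - k * energy_w V + C * e ^+ 2].
Proof.
move=> c20 c30.
(* Profile of the source: the trace eps(0) times [g] is added to the transport equation of both
   invariants. *)
pose g (x : R) := - ((c1 + q) * (c2 + q)) * expR (q * x).
have gL : L2 g by apply: L2Z; exact: expRM_L2.
have X0 : 0 < 4 * ip g g + 1 by rewrite ltr_wpDl// mulr_ge0// ip_ge0.
have [d [C [d0 d8 ineq]]] := energy_inequality_w (c1 + q) c20 c30 X0.
have [_ _ [blw brw]] := bounded_L2_components R.
pose B U V := weighted_ip (1 + d) d (left_w U) (left_w V) + weighted_ip (1 - d) (- d) (right_w U) (right_w V)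
  + 2 * c2 * (s_w U 0 * s_w V 0).
pose k := Num.min (Num.min 2^-1 (2 * c2)) (Num.min (d / 2) (d * c2 ^+ 2)).
have [k0 k1 k2 [k3 k4]] : [/\ 0 < k, k <= 2^-1, k <= 2 * c2 & k <= d / 2 /\ k <= d * c2 ^+ 2].
  split; last split; rewrite /k ?ge_min ?lexx ?orbT//.
  have p1 : 0 < 2^-1 :> R by rewrite invr_gt0.
  have p2 : 0 < d / 2 by rewrite divr_gt0.
  have p3 : 0 < 2 * c2 by rewrite mulr_gt0.
  have p4 : 0 < d * c2 ^+ 2 by rewrite mulr_gt0 ?exprn_gt0.
  by rewrite !lt_min p1 p2 p3 p4.
exists B, k, (`|C|); split=> //.
- do 2?[apply: bilinear_form_add].
  + exact: bilinear_form_wip. + exact: bilinear_form_wip.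
  + exact: bilinear_form_scale (bilinear_form_mul (linear_form_tracew R) (linear_form_tracew R)).
- move=> V VX; have lL : L2 (left_w V) by case: blw => -[/(_ V VX)].
  have rL : L2 (right_w V) by case: brw => -[/(_ V VX)].
  have /andP[b1 _] := @weighted_ip_bounds _ (1 + d) d 1 (1 + 2 * d) _ lL (fun x hx =>
    ltac:(have /andP[h1 h2] := weight_le d0 hx; apply/andP; split; lra)).
  have /andP[b2 _] := @weighted_ip_bounds _ (1 - d) (- d) (1 - 2 * d) 1 _ rL (fun x hx =>
    ltac:(have /andP[h1 h2] := weight_le d0 hx; apply/andP; split; lra)).
  have L0 := ip_ge0 (left_w V); have S0 := ip_ge0 (right_w V).
  rewrite /B /energy_w; move: b1 b2 L0 S0.
  set L := ip (left_w V) _; set S := ip (right_w V) _; set a := s_w V 0.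
  set w1 := weighted_ip _ _ _ _; set w2 := weighted_ip _ _ _ _ => b1 b2 L0 S0.
  have h1 := ler_wpM2r S0 d8.
  have h5 := ler_wpM2r L0 k1; have h6 := ler_wpM2r S0 k1.
  have h7 := ler_wpM2r (sqr_ge0 a) k2.
  move: b1 b2 h1 h5 h6 h7 L0 S0; clear; lra.
- move=> V W wx wxx e VX WX wVx wxE WV WV' w0 w1.
  have lL : L2 (left_w V) by case: blw => -[/(_ V VX)].
  have rL : L2 (right_w V) by case: brw => -[/(_ V VX)].
  have lWL : L2 (left_w W) by case: blw => -[/(_ W WX)].
  have rWL : L2 (right_w W) by case: brw => -[/(_ W WX)].
  have [_ _ _ /H1_deriv01 w'W] := inX_H1 WX.
  set wt' := deriv01 (s_w W) in w'W.
  have dV := deriv01_ae wVx; have WV2 := eq_ae01_sym WV.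
  have lp : H1deriv (s_w W \+ wx) (wt' \+ wxx) by exact: H1derivD.
  have rp : H1deriv (s_w W \- wx) (wt' \- wxx) by exact: H1derivB.
  have wt'E : eq_ae01 (deriv01 (s_w W)) wt' by exact: aeW.
  have lVp : eq_ae01 (left_w V) (s_w W \+ wx) by exact: (eq_ae01_comp2 (fun _ a b => a + b) WV2 dV).
  have rVp : eq_ae01 (right_w V) (s_w W \- wx) by exact: (eq_ae01_comp2 (fun _ a b => a - b) WV2 dV).
  have egL : L2 (e \*o g) by exact: L2Z.
  have lWp : eq_ae01 (left_w W) (fun x => 1 * (wt' \+ wxx) x + (e \*o g) x).
    apply: eq_ae01_trans (eq_ae01_comp2 (fun _ a b => a + b) WV' wt'E) _.
    by apply/aeW => x _ /=; rewrite /g; ring.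
  have rWp : eq_ae01 (right_w W) (fun x => -1 * (wt' \- wxx) x + (e \*o g) x).
    apply: eq_ae01_trans (eq_ae01_comp2 (fun _ a b => a - b) WV' wt'E) _.
    by apply/aeW => x _ /=; rewrite /g; ring.
  have T1 := weighted_ip_transport (1 + d) d lp egL lL lWL lVp lWp.
  have T2 := weighted_ip_transport (1 - d) (- d) rp egL rL rWL rVp rWp.
  rewrite {3}/weighted_ip (ipZr e gL (L2_affM (1 + d) d lL)) -/(weighted_ip _ _ _ _) /= in T1.
  rewrite {3}/weighted_ip (ipZr e gL (L2_affM (1 - d) (- d) rL)) -/(weighted_ip _ _ _ _) /= in T2.
  have I1 := @weighted_ip_sqr_le (1 + d) d _ _ lL gL (fun x hx => ltac:(
    have /andP[h1 h2] := weight_le d0 hx; rewrite ler_norml; apply/andP; split; lra)).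
  have I2 := @weighted_ip_sqr_le (1 - d) (- d) _ _ rL gL (fun x hx => ltac:(
    have /andP[h1 h2] := weight_le d0 hx; rewrite ler_norml; apply/andP; split; lra)).
  have := ineq (s_w V 0) (s_w W 0) e (wx 0) (s_w W 1) (wx 1) _ _ _ _ w0 w1 I1 I2.
  have h5 := ler_wpM2r (ip_ge0 (left_w V)) k3; have h6 := ler_wpM2r (ip_ge0 (right_w V)) k3.
  have h7 := ler_wpM2r (sqr_ge0 (s_w V 0)) k4.
  have h9 : C * e ^+ 2 <= `|C| * e ^+ 2 by rewrite ler_wpM2r ?sqr_ge0// ler_norm.
  have -> : B V W + B W V = (weighted_ip (1 + d) d (left_w V) (left_w W) + weighted_ip (1 + d) d (left_w W) (left_w V))
    + (weighted_ip (1 - d) (- d) (right_w V) (right_w W) + weighted_ip (1 - d) (- d) (right_w W) (right_w V))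
    + 4 * c2 * (s_w V 0 * s_w W 0).
    rewrite /B; do ?[set w := weighted_ip _ _ _ _]; ring.
  rewrite T1 T2 /energy_w; move: h5 h6 h7 h9; clear.
  set L := ip (left_w V) _; set S := ip (right_w V) _; set a := s_w V 0.
  set a' := s_w W 0; set i := weighted_ip _ _ _ _; set i' := weighted_ip _ _ _ _; set cc := `|C|.
  set u0 := wx 0; set u1 := wx 1; set z1 := s_w W 1; lra.
Qed.

(** Poincare inequality with the trace at 0, for components whose energy contains only the
    derivative and that trace. *)
Lemma ip_le_trace u v : H1deriv u v -> ip u u <= 2 * u 0 ^+ 2 + 2 * ip v v.
Proof.
move=> uv; have uL := H1deriv_L2 uv.
pose w := cst (Num.sqrt (2 * u 0 ^+ 2 + 2 * ip v v)) : R -> R.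
have s0 : 0 <= 2 * u 0 ^+ 2 + 2 * ip v v by rewrite addr_ge0// mulr_ge0 ?sqr_ge0 ?ip_ge0.
have <- : ip w w = 2 * u 0 ^+ 2 + 2 * ip v v.
  have -> : ip w w = w 0 ^+ 2 * ip (cst 1) (cst 1).
    rewrite -(ipZl _ (L2_cst 1) (L2_cst 1)); apply: eq_Rintegral => x _ /=.
    by rewrite !mulr1 -expr2.
  by rewrite ip11 mulr1 /w sqr_sqrtr.
apply: ip_le => //; first exact: L2_cst.
move=> x /andP[x0 x1]; rewrite [leRHS]ger0_norm ?sqrtr_ge0//.
apply: norm_le_sqr; first exact: sqrtr_ge0.
have x01 : 0 <= x <= 1 by rewrite !ltW.
rewrite sqr_sqrtr//; have := H1deriv_trace uv x01; set a := u x; set b := u 0.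
by have := sqr_ge0 (a - 2 * b); nra.
Qed.

(** Parallelogram law: [ip l l + ip r r] is twice [ip u u + ip v v]. *)
Lemma riemann_ip_le (u v l r : R -> R) : L2 u -> L2 v ->
  (forall x, l x = u x + v x) -> (forall x, r x = u x - v x) ->
  ip u u <= ip l l + ip r r /\ ip v v <= ip l l + ip r r.
Proof.
move=> uL vL lE rE.
have -> : l = u \+ v by apply/funext => x; rewrite lE.
have -> : r = u \- v by apply/funext => x; rewrite rE.
have := ip_ge0 u; have := ip_ge0 v.
have := L2D uL vL; have := L2B uL vL => ? ?.
by rewrite !(ipDl, ipDr, ipBl, ipBr)//; split; lra.
Qed.

(** The energies see Y only through Y_x. Its size is recovered from the trace Y(0), which
    compatibility expresses by eps(0). The constant 100 is generous. *)
Lemma Xnorm_coercive (c0 : R) : 0 < c0 < 1 ->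
  exists2 K, 0 < K & forall V, inX V -> compat c0 V ->
    Xnorm V ^+ 2 <= K * (energy_z V + energy_eps V + energy_w V).
Proof.
move=> /andP[c00 c01]; exists 100 => // V VX cV.
have [/H1_deriv01 dE /H1_deriv01 dY /H1_deriv01 dZ /H1_deriv01 dW] := inX_H1 VX.
have [etL ztL wtL] := inX_L2 VX.
have [z1 z2] := @riemann_ip_le _ _ (left_z V) (right_z V) ztL dZ.1 (fun x => erefl) (fun x => erefl).
have [w1 w2] := @riemann_ip_le _ _ (left_w V) (right_w V) wtL dW.1 (fun x => erefl) (fun x => erefl).
have [e1 e2] := @riemann_ip_le _ _ (left_eps V) (s_epst V \- deriv01 (s_eps V)) etL dE.1
  (fun x => erefl) (fun x => erefl).
have e3 : ip (s_epst V \- deriv01 (s_eps V)) (s_epst V \- deriv01 (s_eps V)) <=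
    2 * ip (right_eps V) (right_eps V) + 8 * ip (deriv_Y V) (deriv_Y V).
  have y2L : L2 (2 \*o deriv_Y V) by exact: L2Z dY.1.
  have rL : L2 (right_eps V) by have [_ [_ [[/(_ V VX)]]]] := bounded_L2_components R.
  have := ip_add_le rL y2L; rewrite (ipZl _ dY.1 y2L) (ipZr _ dY.1 dY.1).
  have -> : right_eps V \+ 2 \*o deriv_Y V = s_epst V \- deriv01 (s_eps V).
    by apply/funext => x; rewrite /right_eps /deriv_Y/=; ring.
  by clear; lra.
have t1 := ip_le_trace dE; have t2 := ip_le_trace dY; have t3 := ip_le_trace dZ.
have t4 := ip_le_trace dW.
have cY : s_Y V 0 ^+ 2 <= s_eps V 0 ^+ 2.
  by rewrite cV exprMn sqrrN ler_piMl ?sqr_ge0// exprn_ile1// ltW.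
have -> : Xnorm V ^+ 2 = \sum_(P <- @Xcomp R) ip (P V) (P V).
  by rewrite Xnorm_sqr// (big_nth (@s_eps R)) big_mkord.
rewrite /Xcomp !big_cons big_nil.
move: (ip_ge0 (left_eps V)) (ip_ge0 (right_eps V)) (ip_ge0 (deriv_Y V))
  (ip_ge0 (left_z V)) (ip_ge0 (right_z V)) (ip_ge0 (left_w V)) (ip_ge0 (right_w V)) (sqr_ge0 (s_eps V 0))
  (sqr_ge0 (s_w V 0)) (sqr_ge0 (s_z V 0)).
rewrite /energy_z /energy_eps /energy_w; move: z1 z2 w1 w2 e1 e2 e3 t1 t2 t3 t4 cY.
rewrite -/(deriv_Y V); clear.
do 20?[match goal with |- context [@ip R ?a ?b] => let n := fresh "i" in set n := @ip R a b end].
lra.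
Qed.

Lemma lyapunov (q c0 c1 c2 c3 : R) : 0 < c0 < 1 -> 0 < c1 -> 0 < c2 -> 0 < c3 ->
  exists B k m, [/\ bilinear_form B, 0 < k, 0 < m,
    forall V, inX V -> compat c0 V -> k * Xnorm V ^+ 2 <= B V V &
    forall V W, inX V -> inX W -> system_op q c0 c1 c2 c3 V W -> compat c0 W ->
      B V W + B W V <= - m * B V V].
Proof.
move=> c001 c10 c20 c30.
have [Bz [kz [bz kz0 lbz dz]]] := lyapunov_z c001 c10.
have [Be [ke [Ce [be ke0 Ce0 lbe de]]]] := lyapunov_e c001 c10.
have [Bw [kw [Cw [bw kw0 Cw0 lbw dw]]]] := lyapunov_w q c1 c20 c30.
have [K K0 coer] := Xnorm_coercive c001.
(* Constants of the cascade: [Me * ke] pays for the trace eps(0) in the estimate of w, [Mz * kz] for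
   the trace z_x(1) in that of eps, and each leaves [kw] over for its own decay. *)
pose Me := (Cw + kw) / ke; pose Mz := (Me * Ce + kw) / kz.
have Me0 : 0 < Me by rewrite divr_gt0// ltr_wpDl.
have Mz0 : 0 < Mz by rewrite divr_gt0// ltr_wpDl// mulr_ge0// ltW.
have MeE : Me * ke = Cw + kw by rewrite /Me divfK// gt_eqF.
have MzE : Mz * kz = Me * Ce + kw by rewrite /Mz divfK// gt_eqF.
pose B U V := Bw U V + (Me * Be U V + Mz * Bz U V).
have bB : bilinear_form B by apply: bilinear_form_add => //; apply: bilinear_form_add; exact: bilinear_form_scale.
have [_ _ [CB CB0 BC]] := bB.
pose N V := energy_z V + energy_eps V + energy_w V.
have Ne0 V : 0 <= energy_eps V by rewrite !addr_ge0 ?ip_ge0 ?sqr_ge0.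
have Nz0 V : 0 <= energy_z V by rewrite !addr_ge0 ?ip_ge0 ?sqr_ge0.
have Nw0 V : 0 <= energy_w V by rewrite !addr_ge0 ?ip_ge0 ?sqr_ge0.
exists B, (kw / K), (kw / (K * (CB + 1))).
have CB1 : 0 < CB + 1 by rewrite ltr_wpDl.
split=> //; [by rewrite divr_gt0|by rewrite divr_gt0// mulr_gt0| |].
- move=> V VX cV; have := coer V VX cV => h.
  have hN : kw / K * Xnorm V ^+ 2 <= kw * N V.
    by rewrite mulrAC ler_pdivrMr// -mulrA ler_wpM2l ?(ltW kw0)// mulrC.
  apply: le_trans hN _; rewrite /B /N.
  have h1 := lbw V VX; have h2 := ler_wpM2l (ltW Me0) (lbe V VX).
  have h3 := ler_wpM2l (ltW Mz0) (lbz V VX).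
  rewrite mulrA MeE in h2; rewrite mulrA MzE in h3.
  have := mulr_ge0 Cw0 (Ne0 V); have := mulr_ge0 (mulr_ge0 (ltW Me0) Ce0) (Nz0 V).
  by move: h1 h2 h3; clear; lra.
- move=> V W VX WX [zx [zxx [ex [exx [yx [wx [wxx [[Z1 [Z2 Z2'] Z3 Z4] [E1 [E2 E2'] E3 E4]
  [[Y1 [yxx Y1']] Y2 Y3] [W1 [W2 W2'] W3 W4]]]]]]]]] cW.
  have cV : compat c0 V by exact: Y3.
  case: Z1 => Z1 Z1'; case: E1 => E1 E1'; case: W1 => W1 W1'.
  have h1 := dz V W zx zxx VX WX Z1 Z1' Z2 Z2' Z3.
  have h2 := de V W ex exx yx yxx (zx 1) VX WX E1 E1' E2 E2' E3 E4 Y1 Y1' Y2 cW.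
  have h3 := dw V W wx wxx (s_eps V 0) VX WX W1 W1' W2 W2' W3 W4.
  have aN : s_eps V 0 ^+ 2 <= energy_eps V by rewrite /energy_eps lerDr !addr_ge0 ?ip_ge0.
  have h4 : B V W + B W V <= - kw * N V.
    have g2 := ler_wpM2l (ltW Me0) h2; have g1 := ler_wpM2l (ltW Mz0) h1.
    have g3 := ler_wpM2l Cw0 aN.
    have e1 : Me * (- ke * energy_eps V + Ce * zx 1 ^+ 2) = - (Cw + kw) * energy_eps V + Me * Ce * zx 1 ^+ 2.
      by rewrite -MeE; ring.
    have e2 : Mz * (- kz * (energy_z V + zx 1 ^+ 2)) = - (Me * Ce + kw) * (energy_z V + zx 1 ^+ 2).
      by rewrite -MzE; ring.
    rewrite e1 in g2; rewrite e2 in g1; rewrite /B /N.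
    have := mulr_ge0 (mulr_ge0 (ltW Me0) Ce0) (Nz0 V).
    have := mulr_ge0 (ltW kw0) (sqr_ge0 (zx 1)).
    move: g1 g2 g3 h3; clear.
    set a := s_eps V 0; set z := zx 1; set n1 := energy_z V; set n2 := energy_eps V; set n3 := energy_w V.
    by lra.
  apply: le_trans h4 _; rewrite !mulNr lerN2.
  (* Boundedness of [B] and coercivity compare [B V V] with the energies, so decay in the energies
     becomes decay in [B]. *)
  have h5 : B V V <= (CB + 1) * (K * N V).
    apply: le_trans (ler_norm _) _; apply: le_trans (BC V V VX VX) _.
    rewrite -expr2; have := coer V VX cV; rewrite -/(N V); have := sqr_ge0 (Xnorm V).
    set x := Xnorm V ^+ 2; set y := K * N V => x0 xy.
    by have := ler_wpM2l CB0 xy; lra.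
  rewrite mulrAC ler_pdivrMr ?mulr_gt0// -mulrA ler_wpM2l ?(ltW kw0)//.
  by apply: le_trans h5 _; rewrite mulrCA mulrA mulrC.
Qed.

End lyapunov_all.

(** * Exponential stability and uniqueness *)

Section stability.
Variable R : realType.
Variables q c0 c1 c2 c3 : R.
Hypotheses (c001 : 0 < c0 < 1) (c10 : 0 < c1) (c20 : 0 < c2) (c30 : 0 < c3).
Local Notation op := (system_op q c0 c1 c2 c3).

(** A mild solution with its primitive exposed and no initial datum, a notion that is stable under
    differences. *)
Definition solution (U V : R -> state R) : Prop :=
  [/\ Xcontinuous U, Xprimitive U V &
      forall t, 0 <= t -> op (V t) (sub_state (U t) (U 0))].

Lemma solution_stable : exists C m : R, [/\ 0 < C, 0 < m &
  forall U V : R -> state R, solution U V -> forall t, 0 <= t ->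
    Xnorm (U t) <= C * Xnorm (U 0) * expR (- m * t)].
Proof.
have [B [k [m [bB k0 m0 coer diss]]]] := lyapunov q c001 c10 c20 c30.
have [_ _ [CB CB0 BC]] := bB.
have K0 : 0 < (CB + 1) / k by rewrite divr_gt0// ltr_wpDl.
(* [B] is comparable to the squared norm, so the norm decays at half the rate of [B]. *)
exists (Num.sqrt ((CB + 1) / k)), (m / 2); split; [by rewrite sqrtr_gt0|by rewrite divr_gt0|].
move=> U V [cU pV UV] t t0.
have UX s : 0 <= s -> inX (U s) by move=> /cU[].
have h := solution_decay cU pV UV bB diss t0.
have h1 := coer _ (UX t t0) (solution_compat cU pV UV t0).
have h2 := BC _ _ (UX 0 (lexx 0)) (UX 0 (lexx 0)).
rewrite -(@ler_pXn2r _ 2)// ?nnegrE ?Xnorm_ge0 ?mulr_ge0 ?sqrtr_ge0 ?Xnorm_ge0 ?expR_ge0//.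
rewrite !exprMn (sqr_sqrtr (ltW K0)).
have -> : expR (- (m / 2) * t) ^+ 2 = expR (- m * t).
  by rewrite expr2 -expRD; congr expR; field.
rewrite -(ler_pM2l k0).
have -> : k * ((CB + 1) / k * Xnorm (U 0) ^+ 2 * expR (- m * t)) =
    expR (- m * t) * ((CB + 1) * Xnorm (U 0) ^+ 2) by field; rewrite gt_eqF.
apply: le_trans h1 _; apply: le_trans h _; rewrite ler_wpM2l ?expR_ge0//.
apply: le_trans (ler_norm _) _; apply: le_trans h2 _.
by rewrite -expr2 ler_wpM2r ?sqr_ge0// lerDl.
Qed.

Lemma sub_state_subC (A B C D : state R) :
  sub_state (sub_state A B) (sub_state C D) = sub_state (sub_state A C) (sub_state B D).
Proof.
case: A B C D => ? ? ? ? ? ? ? [? ? ? ? ? ? ?] [? ? ? ? ? ? ?] [? ? ? ? ? ? ?].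
by congr State; apply/funext => x /=; ring.
Qed.

Lemma scale_state_sub a (A B : state R) :
  scale_state a (sub_state A B) = sub_state (scale_state a A) (scale_state a B).
Proof.
case: A B => ? ? ? ? ? ? ? [? ? ? ? ? ? ?].
by congr State; apply/funext => x /=; ring.
Qed.

Lemma solution_sub U V U' V' : solution U V -> solution U' V' ->
  solution (fun t => sub_state (U t) (U' t)) (fun t => sub_state (V t) (V' t)).
Proof.
move=> [cU [VX V0 dV] UV] [cU' [VX' V0' dV'] UV'].
have UX s : 0 <= s -> inX (U s) by move=> /cU[].
have UX' s : 0 <= s -> inX (U' s) by move=> /cU'[].
split.
- move=> t t0; split; first by apply: inX_sub; [exact: UX|exact: UX'].
  apply/cvg_within_nbhsP => e e0; have e4 : 0 < e / 4 by rewrite divr_gt0.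
  have [_ /cvg_within_nbhsP/(_ _ e4)[d d0 hd]] := cU t t0.
  have [_ /cvg_within_nbhsP/(_ _ e4)[d' d'0 hd']] := cU' t t0.
  exists (Num.min d d'); first by rewrite lt_min d0.
  move=> s s0; rewrite lt_min => /andP[sd sd'].
  have := hd s s0 sd; have := hd' s s0 sd'.
  rewrite !subr0 !ger0_norm ?Xnorm_ge0// /Xdist sub_state_subC => h h'.
  have := Xnorm_sub_le2 (inX_sub (UX s s0) (UX t t0)) (inX_sub (UX' s s0) (UX' t t0)).
  by lra.
- split.
  + by move=> t t0; apply: inX_sub; [exact: VX|exact: VX'].
  + have := Xnorm_sub_le2 (VX 0 (lexx 0)) (VX' 0 (lexx 0)); rewrite V0 V0' addr0 mulr0.
    by move=> h; apply/eqP; rewrite eq_le h Xnorm_ge0.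
  + move=> t t0; apply/cvg_within_dnbhsP => e e0; have e4 : 0 < e / 4 by rewrite divr_gt0.
    have /cvg_within_dnbhsP/(_ _ e4)[d d0 hd] := dV t t0.
    have /cvg_within_dnbhsP/(_ _ e4)[d' d'0 hd'] := dV' t t0.
    exists (Num.min d d'); first by rewrite lt_min d0.
    move=> s s0 st; rewrite lt_min => /andP[sd sd'].
    have := hd s s0 st sd; have := hd' s s0 st sd'.
    rewrite !subr0 !ger0_norm ?Xnorm_ge0// /Xdist => h h'.
    rewrite sub_state_subC scale_state_sub sub_state_subC.
    have X1 := inX_sub (inX_scale (s - t)^-1 (inX_sub (VX s s0) (VX t t0))) (UX t t0).
    have X2 := inX_sub (inX_scale (s - t)^-1 (inX_sub (VX' s s0) (VX' t t0))) (UX' t t0).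
    by have := Xnorm_sub_le2 X1 X2; lra.
- move=> t t0; rewrite sub_state_subC.
  exact: system_op_sub (UV t t0) (UV' t t0).
Qed.

(** The two initial states agree with [U0] only at distance 0, so their own distance is first shown
    to vanish; stability applied to the difference propagates this. *)
Lemma mild_solution_unique (U0 : state R) (U U' : R -> state R) : inX U0 ->
  mild_solution q c0 c1 c2 c3 U0 U -> mild_solution q c0 c1 c2 c3 U0 U' ->
  forall t, 0 <= t -> Xdist (U' t) (U t) = 0.
Proof.
move=> U0X [cU U0E [V [pV UV]]] [cU' U0E' [V' [pV' UV']]] t t0.
have [C [m [C0 m0 stab]]] := solution_stable.
have SU : solution U V by [].
have SU' : solution U' V' by [].
have := stab _ _ (solution_sub SU' SU) t t0; rewrite -/(Xdist _ _).
have X0 : inX (U 0) by have [] := cU 0 (lexx 0).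
have X0' : inX (U' 0) by have [] := cU' 0 (lexx 0).
have -> : Xnorm (sub_state (U' 0) (U 0)) = 0.
  have -> : sub_state (U' 0) (U 0) =
      sub_state (sub_state (U' 0) U0) (sub_state (U 0) U0).
    clear; case: (U' 0) (U 0) U0 => ? ? ? ? ? ? ? [? ? ? ? ? ? ?] [? ? ? ? ? ? ?].
    by congr State; apply/funext => x /=; ring.
  have := Xnorm_sub_le2 (inX_sub X0' U0X) (inX_sub X0 U0X).
  rewrite -/(Xdist (U' 0) U0) -/(Xdist (U 0) U0) U0E U0E' addr0 mulr0.
  by move=> h; apply/eqP; rewrite eq_le h Xnorm_ge0.
rewrite mulr0 mul0r => h; apply/eqP; rewrite eq_le h; exact: Xnorm_ge0.
Qed.

End stability.

(** * Translations and reflections in integrals *)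

Section change_of_variables.
Variable R : realType.
Local Notation mu := (@lebesgue_measure R).

(** Lebesgue measure is characterised by its values on half-open intervals, and these are
    preserved. *)
Lemma lebesgue_measure_shift (t : R) (A : set R) : measurable A ->
  pushforward mu ((fun x => t + x) : _ -> measurableTypeR R) A = mu A.
Proof.
move=> mA; apply/esym; apply: lebesgue_measure_unique => //=.
  exact: measurable_funD.
move=> mphi _ [[a b]] _ <-.
rewrite /pushforward/= (_ : _ @^-1` _ = `]a - t, b - t]%classic); last first.
  by apply/seteqP; split => x /=; rewrite !in_itv/= ltrBlDl lerBrDl.
rewrite !lebesgue_measure_itv/= !lte_fin ltrD2r.
by case: ifP => // _; rewrite -!EFinD; congr EFin; ring.
Qed.

(** Splitting into positive and negative parts keeps the identity valid for non-integrable [f], so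
    that it can also be used to prove integrability. *)
Lemma integral_pushforward_id (phi : measurableTypeR R -> measurableTypeR R)
    (E : set (measurableTypeR R)) (f : measurableTypeR R -> \bar R) :
  measurable_fun setT phi ->
  (forall A : set (measurableTypeR R), measurable A -> pushforward mu phi A = mu A) ->
  measurable E -> measurable_fun setT f ->
  (\int[mu]_(x in phi @^-1` E) f (phi x) = \int[mu]_(y in E) f y)%E.
Proof.
move=> mphi pm mE mf.
have ge0 g : measurable_fun setT g -> (forall x, 0 <= g x)%E ->
    (\int[mu]_(x in phi @^-1` E) g (phi x) = \int[mu]_(y in E) g y)%E.
  move=> mg g0.
  rewrite -[LHS]/(\int[mu]_(x in phi @^-1` E) (g \o phi) x)%E.
  rewrite -ge0_integral_pushforward//; last exact: measurable_funTS.
  by apply: eq_measure_integral => A mA _; exact: pm.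
rewrite -[LHS]/(\int[mu]_(x in phi @^-1` E) (f \o phi) x)%E.
rewrite integralE [RHS]integralE funepos_comp funeneg_comp; congr (_ - _)%E.
  by rewrite -(ge0 (f^\+)%E); [|exact: measurable_funepos|exact: funepos_ge0].
by rewrite -(ge0 (f^\-)%E); [|exact: measurable_funeneg|exact: funeneg_ge0].
Qed.

Lemma integral_shift (t a b : R) (f : R -> R) : measurable_fun setT f ->
  (\int[mu]_(x in `]a, b[) (f (t + x)%R)%:E =
   \int[mu]_(y in `](t + a)%R, (t + b)%R[) (f y)%:E)%E.
Proof.
move=> mf.
have := @integral_pushforward_id (fun x : R => t + x) (`]t + a, t + b[%classic : set R) (EFin \o f).
rewrite (_ : _ @^-1` _ = `]a, b[%classic); last first.
  by apply/seteqP; split => x /=; rewrite !in_itv/= !ltrD2l.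
apply=> //; [exact: measurable_funD|exact: lebesgue_measure_shift|].
exact/measurable_EFinP.
Qed.

Lemma integral_reflect (t a b : R) (f : R -> R) : measurable_fun setT f ->
  (\int[mu]_(x in `]a, b[) (f (t - x)%R)%:E =
   \int[mu]_(y in `](t - b)%R, (t - a)%R[) (f y)%:E)%E.
Proof.
move=> mf.
have mft : measurable_fun setT (fun x => f (t + x)).
  by apply: measurableT_comp => //; exact: measurable_funD.
have := @integral_pushforward_id (fun x : R => - x) (`]- b, - a[%classic : set R) (EFin \o (fun x => f (t + x))).
rewrite (_ : _ @^-1` _ = `]a, b[%classic); last first.
  by apply/seteqP; split => x /=; rewrite !in_itv/= !ltrN2 andbC.
move=> h; rewrite -integral_shift//; apply: h => //.
- exact: oppr_measurable.
- exact: lebesgue_measureN.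
- exact/measurable_EFinP.
Qed.

Lemma Rintegral_shift (t a b : R) (f : R -> R) : measurable_fun setT f ->
  \int[mu]_(x in `]a, b[) f (t + x) = \int[mu]_(y in `]t + a, t + b[) f y.
Proof. by move=> mf; rewrite /Rintegral integral_shift. Qed.

Lemma Rintegral_reflect (t a b : R) (f : R -> R) : measurable_fun setT f ->
  \int[mu]_(x in `]a, b[) f (t - x) = \int[mu]_(y in `]t - b, t - a[) f y.
Proof. by move=> mf; rewrite /Rintegral integral_reflect. Qed.

Lemma integrable_shift (t a b : R) (f : R -> R) : measurable_fun setT f ->
  mu.-integrable `]t + a, t + b[ (EFin \o f) ->
  mu.-integrable `]a, b[ (EFin \o (fun x => f (t + x))).
Proof.
move=> mf /integrableP[_ fi]; apply/integrableP; split.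
  apply/measurable_EFinP; apply: measurableT_comp => //.
  exact: measurable_funD.
have := @integral_shift t a b (fun x => `|f x|); rewrite /= => ->//.
exact: measurableT_comp.
Qed.

Lemma integrable_reflect (t a b : R) (f : R -> R) : measurable_fun setT f ->
  mu.-integrable `]t - b, t - a[ (EFin \o f) ->
  mu.-integrable `]a, b[ (EFin \o (fun x => f (t - x))).
Proof.
move=> mf /integrableP[_ fi]; apply/integrableP; split.
  apply/measurable_EFinP; apply: measurableT_comp => //.
  exact: measurable_funB.
have := @integral_reflect t a b (fun x => `|f x|); rewrite /= => ->//.
exact: measurableT_comp.
Qed.
End change_of_variables.

(** * Continuity of translations in L^2 *)

Section translation.
Variables (R : realType) (o : R).
Local Notation mu := (@lebesgue_measure R).
Local Notation D := (`]0, 1[%classic : set R).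
Implicit Types v f h : R -> R.

Lemma measurable_shift (t : R) f : measurable_fun setT f ->
  measurable_fun setT (fun x : R => f (t + x)).
Proof. by move=> mf; apply: measurableT_comp => //; exact: measurable_funD. Qed.

Lemma Rintegral_subset (A B : set R) f : measurable A -> measurable B -> A `<=` B ->
  (forall x, 0 <= f x) -> mu.-integrable B (EFin \o f) ->
  \int[mu]_(x in A) f x <= \int[mu]_(x in B) f x.
Proof.
move=> mA mB AB f0 fi.
rewrite /Rintegral fine_le//; first exact: integrable_fin_num (integrableS _ _ _ fi).
  exact: integrable_fin_num fi.
apply: ge0_subset_integral => //; first exact: (measurable_int mu).
by move=> x _; rewrite lee_fin.
Qed.

Lemma Rintegral_shift_le (t b : R) f : measurable_fun setT f -> (forall x, 0 <= f x) ->
  mu.-integrable `]o, b[ (EFin \o f) -> o <= t -> t + 1 <= b ->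
  mu.-integrable D (EFin \o (fun x => f (t + x))) /\
  \int[mu]_(x in D) f (t + x) <= \int[mu]_(x in `]o, b[) f x.
Proof.
move=> mf f0 fi t1 tb.
have S : `]t + 0, t + 1[%classic `<=` (`]o, b[%classic : set R).
  by move=> x /=; rewrite !in_itv/= => /andP[? ?]; apply/andP; split; lra.
split; first by apply: integrable_shift => //; exact: integrableS fi.
by rewrite Rintegral_shift// Rintegral_subset.
Qed.

Definition clamp (M x : R) : R := Num.min (Num.max x (- M)) M.

Lemma clamp_id M x : `|x| <= M -> clamp M x = x.
Proof.
rewrite ler_norml /clamp => /andP[a b].
by rewrite max_l// min_l.
Qed.

Lemma clamp_le M x : 0 <= M -> `|clamp M x| <= M.
Proof.
rewrite /clamp ler_norml => M0; rewrite ge_min lexx orbT andbT le_min.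
by rewrite le_max lexx orbT/=; lra.
Qed.

Lemma clamp_dist M x : 0 <= M -> (x - clamp M x) ^+ 2 <= x ^+ 2.
Proof.
move=> M0; rewrite /clamp.
case: (leP x (- M)) => h; last by case: (leP x M) => h'; nra.
by rewrite min_l; nra.
Qed.

Lemma measurable_clamp M v : measurable_fun setT v -> measurable_fun setT (clamp M \o v).
Proof.
move=> mv; rewrite /comp /clamp.
by apply: measurable_minr => //; apply: measurable_maxr => //.
Qed.

(** Dominated convergence: at each point the truncation error is eventually 0, and it is dominated
    by [v x ^+ 2]. *)
Lemma L2_clamp_cvg (E : set R) v (e : R) : measurable E -> measurable_fun setT v ->
  mu.-integrable E (EFin \o (fun x => v x ^+ 2)) -> 0 < e ->
  exists2 M, 0 <= M & mu.-integrable E (EFin \o (fun x => (v x - clamp M (v x)) ^+ 2)) /\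
     \int[mu]_(x in E) (v x - clamp M (v x)) ^+ 2 <= e.
Proof.
move=> mE mv vi e0.
have mr M : measurable_fun setT (fun x => (v x - clamp M (v x)) ^+ 2).
  by apply/measurable_funX; apply: measurable_funB => //; exact: measurable_clamp.
have ri M : 0 <= M -> mu.-integrable E (EFin \o (fun x => (v x - clamp M (v x)) ^+ 2)).
  move=> M0; apply: le_integrable_EFin vi => //; first exact: measurable_funTS.
  by move=> x _; rewrite ger0_norm ?sqr_ge0// clamp_dist.
have cv : (\int[mu]_(x in E) ((v x - clamp n%:R (v x)) ^+ 2)%:E)%E @[n --> \oo] --> 0%:E.
  rewrite -[0%:E](@integral0 _ _ R mu E).
  apply: (@dominated_cvg _ _ R mu E mE _ (cst 0%E) (fun x => (v x ^+ 2)%:E)) => //.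
  - by move=> n; apply/measurable_EFinP; apply: measurable_funTS; exact: mr.
  - move=> x _; apply: cvg_near_cst.
    near=> n; rewrite clamp_id ?subrr ?expr0n//=.
    by near: n; exact: nbhs_infty_ger.
  - by move=> n x _; rewrite /= lee_fin ger0_norm ?sqr_ge0// clamp_dist.
move/fine_cvg : cv => /cvgrPdist_le /(_ e e0)[n _ /(_ n (leqnn n))] /=.
rewrite sub0r normrN => h; exists n%:R => //; split; first exact: ri.
exact: le_trans (ler_norm _) h.
Unshelve. all: by end_near. Qed.

Lemma L1_approx (E : set R) f (e : R) : measurable E -> (mu E < +oo)%E ->
  mu.-integrable E (EFin \o f) -> 0 < e ->
  exists h, [/\ continuous h, mu.-integrable E (EFin \o h) & \int[mu]_(x in E) `|f x - h x| <= e].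
Proof.
move=> mE Efin fi e0.
have [g [cg gi gcv]] := approximation_continuous_integrable mE Efin fi.
move/fine_cvg : gcv => /cvgrPdist_le /(_ e e0)[n _ /(_ n (leqnn n))] /=.
rewrite sub0r normrN => h; exists (g n); split => //.
exact: le_trans (ler_norm _) h.
Qed.

(** Uniform continuity near the window from [t] to [t + 1], obtained from compactness of [0,1] in
    the form of near coverings. *)
Lemma continuous_shift_near h (t e : R) : continuous h -> 0 < e ->
  \forall s \near t, forall x, 0 <= x <= 1 -> `|h (s + x) - h (t + x)| <= e.
Proof.
move=> ch e0.
have /compact_near_coveringP := @segment_compact R 0 1.
move=> /(_ R (nbhs t) (fun s x => `|h (s + x) - h (t + x)| <= e) _) near01.
have {}near01 : \forall s \near t, `[0, 1]%classic `<=` (fun x => `|h (s + x) - h (t + x)| <= e).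
  apply: near01 => x _.
  have /cvgrPdist_le /(_ (e / 2) _)[|dl /= dl0 hd] := ch (t + x); first by rewrite divr_gt0.
  have dl2 : 0 < dl / 2 by rewrite divr_gt0.
  exists (ball x (dl / 2), ball t (dl / 2)) => /=; first by split; exact: nbhsx_ballx.
  move=> [y s] /= [xy ts]; rewrite /ball/= !ltr_norml in xy ts.
  have h1 : `|h (t + x) - h (s + y)| <= e / 2.
    by apply: hd; rewrite /= ltr_norml; apply/andP; split; lra.
  have h2 : `|h (t + x) - h (t + y)| <= e / 2.
    by apply: hd; rewrite /= ltr_norml; apply/andP; split; lra.
  by move: h1 h2; rewrite !ler_norml => /andP[? ?] /andP[? ?]; apply/andP; split; lra.
by apply: filterS near01 => s hs x x01; apply: hs; rewrite /= in_itv/=.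
Qed.

(** For a function bounded by [M], the squared difference of two translates is at most [2 * M] times
    its absolute value. This reduces the claim to L^1, where [v] is approximated by a continuous
    function. *)
Lemma bounded_translation v (M N t e : R) : measurable_fun setT v -> 0 <= M ->
  (forall x, `|v x| <= M) -> o <= t -> t + 1 < N -> 0 < e ->
  exists2 d, 0 < d & forall s, o <= s -> `|s - t| < d ->
    ip (fun x => v (s + x) - v (t + x)) (fun x => v (s + x) - v (t + x)) <= e.
Proof.
move=> mv M0 vM t1 tN e0.
set E := (`]o, N[%classic : set R).
have muE : (mu E < +oo)%E by rewrite lebesgue_measure_itv/=; case: ifP; rewrite ?ltry.
have mE : measurable E by exact: measurable_itv.
have vi : mu.-integrable E (EFin \o v).
  apply: (le_integrable_EFin mE _ _ (integrable_cstR M mE muE)); first exact: measurable_funTS.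
  by move=> x _; exact: vM.
(* Three errors of size [e'], times [2 * M]. *)
pose e' := e / (6 * (M + 1)).
have e'0 : 0 < e' by rewrite divr_gt0// mulr_gt0//; lra.
have [h [ch hi vh]] := L1_approx mE muE vi e'0.
have [d /= d0 hd] := continuous_shift_near t ch e'0.
have mh := continuous_measurable_fun ch.
have mvh : measurable_fun setT (fun x => `|v x - h x|).
  by apply: measurableT_comp => //; exact: measurable_funB.
have vhi : mu.-integrable E (EFin \o (fun x => `|v x - h x|)).
  have /integrable_abse := integrable_subR mE vi hi.
  by [].
have sh s : o <= s -> s + 1 <= N -> mu.-integrable D (EFin \o (fun x => `|v (s + x) - h (s + x)|)) /\
    \int[mu]_(x in D) `|v (s + x) - h (s + x)| <= e'.
  move=> s1 sN.
  have [? le] := Rintegral_shift_le mvh (fun x => normr_ge0 _) vhi s1 sN.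
  by split => //; exact: le_trans le vh.
exists (Num.min d (N - (t + 1))); first by rewrite lt_min d0/= subr_gt0.
move=> s s1; rewrite lt_min => /andP[sd sN].
have [i1 l1] := sh t t1 (ltW tN).
have [|i2 l2] := sh s s1.
  by move: sN; rewrite ltr_norml => /andP[_ ?]; lra.
have mD : measurable D by exact: measurable_itv.
have i3 : mu.-integrable D (EFin \o (fun x =>
    2 * M * (`|v (s + x) - h (s + x)| + `|v (t + x) - h (t + x)| + e'))).
  apply: integrable_scaleR => //; apply: integrable_addR => //; first exact: integrable_addR.
  by apply: integrable_cstR => //; rewrite muD ltry.
have le x : D x -> (v (s + x) - v (t + x)) * (v (s + x) - v (t + x)) <=
    2 * M * (`|v (s + x) - h (s + x)| + `|v (t + x) - h (t + x)| + e').
  rewrite /= in_itv/= => /andP[x0 x1].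
  have hx : `|h (s + x) - h (t + x)| <= e'.
    by apply: (hd s _ x); rewrite /= ?(distrC t)// !ltW.
  apply: le_trans (ler_norm _) _; rewrite normrM ler_pM//.
    by rewrite (le_trans (ler_normB _ _))//; move: (vM (s + x)) (vM (t + x)); lra.
  rewrite (_ : _ - _ = (v (s + x) - h (s + x)) - (v (t + x) - h (t + x)) + (h (s + x) - h (t + x))); last by ring.
  by rewrite (le_trans (ler_normD _ _))// lerD// ler_normB.
apply: (@le_trans _ _ (\int[mu]_(x in D) (2 * M * (`|v (s + x) - h (s + x)| + `|v (t + x) - h (t + x)| + e')))).
  apply: le_Rintegral => //.
  apply: (@le_integrable_EFin _ _ _ _ mD _ _ i3); last first.
    by move=> x Dx; rewrite ger0_norm ?le// -expr2 sqr_ge0.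
  by apply: measurable_funTS; apply: measurable_funM; apply: measurable_funB; exact: measurable_shift.
rewrite RintegralZl//; last first.
  apply: integrable_addR => //; first exact: integrable_addR.
  by apply: integrable_cstR => //; rewrite muD ltry.
rewrite RintegralD//; last 2 first.
- exact: integrable_addR.
- by apply: integrable_cstR => //; rewrite muD ltry.
rewrite RintegralD// Rintegral_cst// fine_mu_itvoo// mulr1.
have -> : e = 2 * (M + 1) * (3 * e') by rewrite /e'; field; rewrite gt_eqF//; lra.
move: l1 l2; set a := Rintegral _ _ _; set b := Rintegral _ _ _ => l1 l2.
clear -M0 e'0 l1 l2; apply: (@le_trans _ _ (2 * M * (3 * e'))).
  by apply: ler_wpM2l; lra.
by apply: ler_wpM2r; lra.
Qed.

(* Functions on [o, +oo); their values to the left of o do not matter. *)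
Definition locL2 v : Prop := measurable_fun setT v /\
  forall b, mu.-integrable `]o, b[ (EFin \o (fun x => v x ^+ 2)).

Lemma locL2_shift v (t : R) : locL2 v -> o <= t -> L2 (fun x => v (t + x)).
Proof.
move=> [mv vi] t1; apply/L2E; split.
  by apply: measurable_funTS; exact: measurable_shift.
by have [] := Rintegral_shift_le (measurable_funX 2 mv) (fun x => sqr_ge0 _) (vi (t + 1)) t1 (lexx _).
Qed.

Lemma locL2_translation v (t e : R) : locL2 v -> o <= t -> 0 < e ->
  exists2 d, 0 < d & forall s, o <= s -> `|s - t| < d ->
    ip (fun x => v (s + x) - v (t + x)) (fun x => v (s + x) - v (t + x)) <= e.
Proof.
move=> vL t1 e0; have [mv vi] := vL.
(* The bounded part contributes [2 * (e / 4)] and the two truncation remainders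
   [2 * (2 * (e / 16) + 2 * (e / 16))]. *)
have e16 : 0 < e / 16 by rewrite divr_gt0.
have mE : measurable (`]o, t + 2[%classic : set R) by exact: measurable_itv.
have [M M0 [ri rle]] := L2_clamp_cvg mE mv (vi (t + 2)) e16.
set w := clamp M \o v.
have mw : measurable_fun setT w by exact: measurable_clamp.
pose r x := v x - clamp M (v x).
have mr : measurable_fun setT r by exact: measurable_funB.
have tt2 : t + 1 < t + 2 by lra.
have e4 : 0 < e / 4 by rewrite divr_gt0.
have [d d0 wd] := bounded_translation mw M0 (fun x => clamp_le (v x) M0) t1 tt2 e4.
have sh s : o <= s -> s + 1 <= t + 2 -> L2 (fun x => r (s + x)) /\
    ip (fun x => r (s + x)) (fun x => r (s + x)) <= e / 16.
  move=> s1 sN.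
  have [? le] := Rintegral_shift_le (measurable_funX 2 mr) (fun x => sqr_ge0 _) ri s1 sN.
  split; first by apply/L2E; split => //; apply: measurable_funTS; exact: measurable_shift.
  apply: le_trans rle; apply: le_trans le.
  by rewrite le_eqVlt /ip; under eq_Rintegral do rewrite -expr2; rewrite eqxx.
exists (Num.min d 1); first by rewrite lt_min d0/= ltr01.
move=> s s1; rewrite lt_min => /andP[sd sN].
have [|r1L r1] := sh t t1; first by lra.
have [|r2L r2] := sh s s1.
  by move: sN; rewrite ltr_norml => /andP[_ ?]; lra.
have wL p : L2 (fun x => w (p + x)).
  apply: (@L2_ext _ ((fun x => w (p + x)) \* cst 1)); first by move=> x _; rewrite /= mulr1.
  apply: (@L2_bM _ _ M); last exact: L2_cst.
    by apply: measurable_funTS; exact: measurable_shift.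
  by move=> x _; exact: clamp_le.
have -> : (fun x => v (s + x) - v (t + x)) =
   ((fun x => w (s + x)) \- (fun x => w (t + x))) \+ ((fun x => r (s + x)) \- (fun x => r (t + x))).
  by apply/funext => x; rewrite /r /w /=; ring.
apply: le_trans (ip_add_le (L2B (wL s) (wL t)) (L2B r2L r1L)) _.
have := ip_sub_le r2L r1L; have := wd _ s1 sd.
lra.
Qed.
End translation.

(** * Locally square integrable functions on a half-line *)

Section locL2.
Variable R : realType.
Local Notation mu := (@lebesgue_measure R).
Implicit Types (o a b t : R) (f g u v w : R -> R).

Lemma mu_itvoo_lty a b : (mu (`]a, b[%classic : set R) < +oo)%E.
Proof. by rewrite lebesgue_measure_itv/=; case: ifP; rewrite ?ltry. Qed.

Lemma fine_mu_itv a b : a <= b -> fine (mu (`]a, b[%classic : set R)) = b - a.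
Proof.
rewrite lebesgue_measure_itv/= lte_fin le_eqVlt => /predU1P[->|->//].
by rewrite ltxx subrr.
Qed.

Lemma locL2_integrable o v b : locL2 o v -> mu.-integrable `]o, b[ (EFin \o v).
Proof.
move=> [mv vi].
have mE : measurable (`]o, b[%classic : set R) by exact: measurable_itv.
have i1 := integrable_addR mE (integrable_cstR 1 mE (mu_itvoo_lty o b)) (vi b).
apply: (@le_integrable_EFin _ _ _ _ mE _ _ i1); first exact: measurable_funTS.
by move=> x _; rewrite /= ler_norml; apply/andP; split; nra.
Qed.

Lemma locL2_integrableS o v a b : locL2 o v -> o <= a -> mu.-integrable `]a, b[ (EFin \o v).
Proof.
move=> vL oa; apply: integrableS (locL2_integrable b vL) => //.
by move=> x; rewrite /= !in_itv/= => /andP[? ->]; rewrite (le_lt_trans oa).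
Qed.

(** The variance of [g] about its mean [k] is nonnegative. *)
Lemma Rintegral_CS a b g : a <= b -> mu.-integrable `]a, b[ (EFin \o g) ->
  mu.-integrable `]a, b[ (EFin \o (fun x => g x ^+ 2)) ->
  (\int[mu]_(x in `]a, b[) g x) ^+ 2 <= (b - a) * \int[mu]_(x in `]a, b[) g x ^+ 2.
Proof.
rewrite le_eqVlt => /predU1P[->|ab gi g2i].
  by rewrite set_itvoo0 !Rintegral_set0 subrr expr0n mul0r.
have mE : measurable (`]a, b[%classic : set R) by exact: measurable_itv.
pose k := (\int[mu]_(x in `]a, b[) g x) / (b - a).
have ci := integrable_cstR (k ^+ 2) mE (mu_itvoo_lty a b).
have kgi := integrable_scaleR (2 * k) mE gi.
have : 0 <= \int[mu]_(x in `]a, b[) ((g x ^+ 2 - 2 * k * g x) + k ^+ 2).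
  apply: Rintegral_ge0 => x _.
  by rewrite (_ : _ + _ = (g x - k) ^+ 2) ?sqr_ge0//; ring.
rewrite RintegralD//; last exact: integrable_subR.
rewrite RintegralB// RintegralZl// Rintegral_cst// fine_mu_itv; last exact: ltW.
have : \int[mu]_(x in `]a, b[) g x = k * (b - a) by rewrite /k divfK// gt_eqF// subr_gt0.
by move=> ->; set A := Rintegral _ _ _; nra.
Qed.

Lemma locL2D o u v : locL2 o u -> locL2 o v -> locL2 o (fun x => u x + v x).
Proof.
move=> [mu_ ui] [mv vi]; split; first exact: measurable_funD.
move=> b; have mE : measurable (`]o, b[%classic : set R) by exact: measurable_itv.
have i2 := integrable_addR mE (integrable_scaleR 2 mE (ui b)) (integrable_scaleR 2 mE (vi b)).
apply: (@le_integrable_EFin _ _ _ _ mE _ _ i2).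
  by apply: measurable_funTS; apply/measurable_funX; exact: measurable_funD.
by move=> x _; rewrite ger0_norm ?sqr_ge0//; have := sqr_ge0 (u x - v x); nra.
Qed.

Lemma locL2_bM o u v : measurable_fun setT u ->
  (forall b, exists M, forall x, o < x < b -> `|u x| <= M) ->
  locL2 o v -> locL2 o (fun x => u x * v x).
Proof.
move=> mu_ ub [mv vi]; split; first exact: measurable_funM.
move=> b; have [M uM] := ub b.
have mE : measurable (`]o, b[%classic : set R) by exact: measurable_itv.
apply: (@le_integrable_EFin _ _ _ _ mE _ _ (integrable_scaleR (M ^+ 2) mE (vi b))).
  by apply: measurable_funTS; apply/measurable_funX; exact: measurable_funM.
move=> x; rewrite /= in_itv/= => /uM uMx.
rewrite ger0_norm ?sqr_ge0// exprMn ler_wpM2r ?sqr_ge0//.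
by rewrite -real_normK ?num_real// !expr2 ler_pM.
Qed.

Lemma locL2_cst o (k : R) : locL2 o (fun=> k).
Proof.
split; first exact: measurable_cst.
by move=> b; apply: integrable_cstR (mu_itvoo_lty o b); exact: measurable_itv.
Qed.

Lemma locL2Z o (k : R) v : locL2 o v -> locL2 o (fun x => k * v x).
Proof. by apply: locL2_bM => [|b]; [exact: measurable_cst|exists `|k|]. Qed.

Lemma locL2B o u v : locL2 o u -> locL2 o v -> locL2 o (fun x => u x - v x).
Proof.
move=> uL vL; have := locL2D uL (locL2Z (-1) vL).
by congr locL2; apply/funext => x; rewrite mulN1r.
Qed.

Lemma locL2_base o o' v : o <= o' -> locL2 o v -> locL2 o' v.
Proof.
move=> oo' [mv vi]; split => // b; apply: integrableS (vi b) => //.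
by move=> x; rewrite /= !in_itv/= => /andP[? ->]; rewrite (le_lt_trans oo').
Qed.

Lemma measurable_if_le o u v : measurable_fun setT u -> measurable_fun setT v ->
  measurable_fun setT (fun x : R => if x <= o then u x else v x).
Proof.
move=> mu_ mv; apply: measurable_fun_ifT => //.
apply: (measurable_fun_bool true); rewrite setTI.
by rewrite (_ : _ @^-1` _ = `]-oo, o]%classic) ?measurable_itv.
Qed.

Lemma locL2_if0 o o' v : locL2 o' v -> locL2 o (fun x : R => if x <= o' then 0 else v x).
Proof.
move=> [mv vi]; split; first exact: measurable_if_le.
move=> b; have mE : measurable (`]o', b[%classic : set R) by exact: measurable_itv.
have h := (@integrable_mkcond _ _ R mu _ _ mE).1 (vi b).
have mob : measurable (`]o, b[%classic : set R) by exact: measurable_itv.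
have {}h := @integrableS _ _ R mu setT _ _ measurableT mob (fun _ _ => I) h.
apply: eq_integrable h => // x.
rewrite inE/= in_itv/= patchE mem_setE in_itv/= => /andP[_ ->].
by rewrite andbT; case: leP => _ //=; rewrite expr0n.
Qed.

Lemma locL2_if o o' u v : locL2 o u -> locL2 o' v ->
  locL2 o (fun x : R => if x <= o' then u x else v x).
Proof.
move=> uL vL.
have -> : (fun x : R => if x <= o' then u x else v x) =
    fun x => (\1_(`]-oo, o']%classic : set R) x * u x) + (if x <= o' then 0 else v x).
  apply/funext => x; rewrite indicE mem_setE in_itv/=.
  by case: leP => _; rewrite ?mul1r ?addr0// mul0r add0r.
apply: locL2D (locL2_if0 o vL); apply: locL2_bM uL => [|b].
  by apply: measurable_indic; exact: measurable_itv.
by exists 1 => x _; exact: indic_bounded.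
Qed.

Lemma Rintegral_ge0_homo o v x y : (forall x, 0 <= v x) -> locL2 o v -> x <= y ->
  \int[mu]_(s in `]o, x[) v s <= \int[mu]_(s in `]o, y[) v s.
Proof.
move=> v0 vL xy; apply: Rintegral_subset => //; last exact: locL2_integrable.
by move=> s; rewrite /= !in_itv/= => /andP[-> /lt_le_trans]; exact.
Qed.

Lemma locL2_norm o v : locL2 o v -> locL2 o (fun x => `|v x|).
Proof.
move=> [mv vi]; split; first exact: measurableT_comp.
move=> b; rewrite (_ : (fun x => _) = fun x => v x ^+ 2) ?vi//.
by apply/funext => x; rewrite real_normK ?num_real.
Qed.

(** A difference of two nondecreasing functions, the primitives of [v + |v|] and of [|v|]. *)
Lemma measurable_prim o v : locL2 o v ->
  measurable_fun setT (fun x : R => \int[mu]_(y in `]o, x[) v y).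
Proof.
move=> vL; have nL := locL2_norm vL; have sL := locL2D vL nL.
have -> : (fun x => \int[mu]_(y in `]o, x[) v y) =
    fun x => \int[mu]_(y in `]o, x[) (v y + `|v y|) - \int[mu]_(y in `]o, x[) `|v y|.
  apply/funext => x; rewrite RintegralD//; do ?exact: locL2_integrable.
  by rewrite addrK.
apply: measurable_funB; apply: nondecreasing_measurable => // x y xy.
  by apply: Rintegral_ge0_homo => // s; have := ler_norm (- v s); rewrite normrN; lra.
by apply: Rintegral_ge0_homo.
Qed.
End locL2.

(** * Absolutely continuous functions on a half-line *)

Section H1on.
Variable R : realType.
Local Notation mu := (@lebesgue_measure R).
Implicit Types (o a b t : R) (f g u v w : R -> R).

(** Half-line counterpart of [H1deriv]. Measurability of [f] is asked for on the whole line, so that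
    translates and reflections of [f] stay measurable. *)
Definition H1on o f v : Prop := [/\ measurable_fun setT f, locL2 o v &
  forall x, o <= x -> f x = f o + \int[mu]_(y in `]o, x[) v y].

Lemma H1on_diff o f v a b : H1on o f v -> o <= a -> a <= b ->
  f b - f a = \int[mu]_(y in `]a, b[) v y.
Proof.
move=> [mf vL fE] oa ab; rewrite (fE _ oa) (fE _ (le_trans oa ab)).
rewrite (@Rintegral_itvoo_split _ v o a b) ?oa//; last exact: locL2_integrable.
by ring.
Qed.

Lemma H1on_window o f v t : H1on o f v -> o <= t ->
  H1deriv (fun x => f (t + x)) (fun x => v (t + x)).
Proof.
move=> fv ot; have [mf vL fE] := fv; split; first exact: locL2_shift vL ot.
move=> x /andP[x0 x1]; have [mv _] := vL.
have := @H1on_diff _ _ _ t (t + x) fv ot; rewrite lerDl => /(_ x0) h.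
by rewrite Rintegral_shift// addr0 -h; ring.
Qed.

Lemma H1on_reflect o f v t : H1on o f v -> o <= t - 1 ->
  H1deriv (fun x => f (t - x)) (fun x => - v (t - x)).
Proof.
move=> fv ot; have [mf vL fE] := fv; have [mv vi] := vL.
have mvr : measurable_fun setT (fun x : R => v (t - x)).
  by apply: measurableT_comp => //; exact: measurable_funB.
split.
  apply: L2N; apply/L2E; split; first exact: measurable_funTS.
  apply: (@integrable_reflect R t 0 1 (fun x => v x ^+ 2)); first exact: measurable_funX.
  by apply: integrableS (vi (t - 0)) => // x; rewrite /= !in_itv/= => /andP[? ->]; rewrite (le_lt_trans ot).
move=> x /andP[x0 x1].
have h := @H1on_diff _ _ _ (t - x) t fv _ _.
have vxi : mu.-integrable (`]0, x[%classic : set R) (EFin \o (fun x => v (t - x))).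
  by apply: integrable_reflect => //; apply: locL2_integrableS vL _; lra.
rewrite (_ : (fun y => - v (t - y)) = fun y => -1 * v (t - y)); last first.
  by apply/funext => y; rewrite mulN1r.
rewrite RintegralZl//.
by rewrite Rintegral_reflect// subr0 -h; [ring|lra|lra].
Qed.

(** The increment over a long interval is a sum of increments over unit windows. This carries
    results on [0,1], such as the product rule, to the half-line. *)
Lemma H1on_windows o f v : measurable_fun setT f -> locL2 o v ->
  (forall t, o <= t -> H1deriv (fun x => f (t + x)) (fun x => v (t + x))) -> H1on o f v.
Proof.
move=> mf vL fW; split => // x ox; have [mv _] := vL.
have step t y : o <= t -> 0 <= y <= 1 -> f (t + y) = f t + \int[mu]_(s in `]t, t + y[) v s.
  move=> ot y01; have [_ /(_ _ y01)] := fW t ot.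
  by rewrite addr0 Rintegral_shift// addr0.
have main n : forall z, o <= z -> z - o <= n%:R -> f z = f o + \int[mu]_(y in `]o, z[) v y.
  elim: n => [z oz zn|n IH z oz zn].
    have -> : z = o by apply/le_anti/andP; split => //; lra.
    by rewrite set_itvoo0 Rintegral_set0 addr0.
  have [z1|z1] := leP z (o + 1).
    by have := step o (z - o) (lexx _); rewrite addrCA subrr addr0; apply; lra.
  have oz1 : o <= z - 1 by lra.
  rewrite (@Rintegral_itvoo_split _ v o (z - 1) z) ?oz1/=; [|lra|exact: locL2_integrable].
  rewrite addrA -IH//; last by rewrite -natr1 in zn; lra.
  by have := step _ 1 oz1; rewrite subrK; apply; rewrite ler01 lexx.
by apply: (main (Num.truncn (x - o)).+1) => //; exact/ltW/truncnS_gt.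
Qed.

Lemma H1on_holder o f v a b : H1on o f v -> o <= a -> a <= b ->
  (f b - f a) ^+ 2 <= (b - a) * \int[mu]_(y in `]a, b[) v y ^+ 2.
Proof.
move=> fv oa ab; have [_ vL _] := fv; rewrite (H1on_diff fv oa ab).
apply: Rintegral_CS => //; first exact: locL2_integrableS vL oa.
by have [_ ->] := locL2_base oa vL.
Qed.

Lemma H1on_bounded o f v b : H1on o f v -> exists M, forall x, o <= x <= b -> `|f x| <= M.
Proof.
move=> fv; have [_ [mv vi] _] := fv.
pose I := \int[mu]_(y in `]o, b[) v y ^+ 2.
have I0 : 0 <= I by apply: Rintegral_ge0 => x _; exact: sqr_ge0.
exists (2 * (`|f o| + `|b - o| + I + 1)) => x /andP[ox xb].
have h := H1on_holder fv (lexx o) ox.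
have le : \int[mu]_(y in `]o, x[) v y ^+ 2 <= I.
  apply: Rintegral_subset => // [s|s]; last exact: sqr_ge0.
  by rewrite /= !in_itv/= => /andP[-> /lt_le_trans]; exact.
have h2 : (f x - f o) ^+ 2 <= (`|b - o| + I + 1) ^+ 2.
  apply: (le_trans h); apply: (@le_trans _ _ (`|b - o| * I)).
    apply: ler_pM => //; [by rewrite subr_ge0|by apply: Rintegral_ge0 => y _; exact: sqr_ge0|].
    by have := ler_norm (b - o); lra.
  by have := normr_ge0 (b - o); nra.
have nb := normr_ge0 (b - o).
have /norm_le_sqr : 0 <= `|b - o| + I + 1 by lra.
move=> /(_ _ h2) h3; have := ler_normD (f x - f o) (f o); rewrite subrK.
by have := normr_ge0 (f o); lra.
Qed.

Lemma H1on_locL2 o f v : H1on o f v -> locL2 o f.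
Proof.
move=> fv; have [mf _ _] := fv.
rewrite (_ : f = fun x => f x * 1); last by apply/funext => x; rewrite mulr1.
apply: (@locL2_bM R o f (fun=> 1)); [by []| |exact: locL2_cst].
move=> b; have [M fM] := H1on_bounded b fv.
by exists M => x /andP[? ?]; apply: fM; rewrite !ltW.
Qed.

Lemma H1on_continuous o f v t (e : R) : H1on o f v -> o <= t -> 0 < e ->
  exists2 d, 0 < d & forall s, o <= s -> `|s - t| < d -> `|f s - f t| <= e.
Proof.
move=> fv ot e0; have [_ [mv vi] _] := fv.
pose I := \int[mu]_(y in `]o, t + 1[) v y ^+ 2.
have I0 : 0 <= I by apply: Rintegral_ge0 => x _; exact: sqr_ge0.
have I1 : 0 < I + 1 by lra.
have H a b : o <= a -> a <= b -> b <= t + 1 -> (f b - f a) ^+ 2 <= (b - a) * (I + 1).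
  move=> oa ab bt; apply: le_trans (H1on_holder fv oa ab) _.
  rewrite ler_wpM2l ?subr_ge0//; apply: (@le_trans _ _ I); last by lra.
  apply: Rintegral_subset => // [s|s]; last exact: sqr_ge0.
  by rewrite /= !in_itv/= => /andP[? ?]; apply/andP; split; lra.
exists (Num.min 1 (e ^+ 2 / (I + 1))).
  by rewrite lt_min ltr01/= divr_gt0 ?exprn_gt0.
move=> s os; rewrite lt_min ltr_pdivlMr// => /andP[s1 s2].
apply: norm_le_sqr; first exact: ltW.
apply: le_trans (ltW s2); move: s1; case: (leP s t) => st.
  rewrite ler0_norm ?subr_le0// opprB => s1.
  by rewrite -sqrrN opprB; apply: H => //; lra.
rewrite gtr0_norm ?subr_gt0// => s1.
by apply: H => //; lra.
Qed.

Lemma H1onD o f v g w : H1on o f v -> H1on o g w ->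
  H1on o (fun x => f x + g x) (fun x => v x + w x).
Proof.
move=> [mf vL fE] [mg wL gE]; split; [exact: measurable_funD|exact: locL2D|].
move=> x ox; rewrite (fE x ox) (gE x ox) RintegralD//; do ?exact: locL2_integrable.
by ring.
Qed.

Lemma H1onZ o (k : R) f v : H1on o f v -> H1on o (fun x => k * f x) (fun x => k * v x).
Proof.
move=> [mf vL fE]; split; [exact: measurable_funM|exact: locL2Z|].
move=> x ox; rewrite (fE x ox) RintegralZl//; last exact: locL2_integrable.
by ring.
Qed.

Lemma H1onB o f v g w : H1on o f v -> H1on o g w ->
  H1on o (fun x => f x - g x) (fun x => v x - w x).
Proof.
move=> fv gw; have := H1onD fv (H1onZ (-1) gw).
by congr H1on; apply/funext => x; rewrite mulN1r.
Qed.

Lemma H1on_cst o (k : R) : H1on o (fun=> k) (fun=> 0).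
Proof.
split; [exact: measurable_cst|exact: locL2_cst|].
by move=> x ox; rewrite Rintegral_cst// mul0r addr0.
Qed.

Lemma H1on_prim o (k : R) v : locL2 o v ->
  H1on o (fun x => k + \int[mu]_(y in `]o, x[) v y) v.
Proof.
move=> vL; split=> //; first by apply: measurable_funD => //; exact: measurable_prim.
by move=> x ox; rewrite set_itvoo0 Rintegral_set0 addr0.
Qed.

Lemma H1on_base o o' f v : o <= o' -> H1on o f v -> H1on o' f v.
Proof.
move=> oo' fv; have [mf vL _] := fv; split => //; first exact: locL2_base vL.
by move=> x ox; rewrite -(H1on_diff fv oo' ox); ring.
Qed.

Lemma locL2_time_shift o v (r : R) : locL2 (r + o) v -> locL2 o (fun x => v (r + x)).
Proof.
move=> [mv vi]; split; first exact: measurable_shift.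
by move=> b; apply: (@integrable_shift R r o b (fun x => v x ^+ 2)) => //; exact: measurable_funX.
Qed.

Lemma H1on_time_shift o f v (r : R) : H1on (r + o) f v ->
  H1on o (fun x => f (r + x)) (fun x => v (r + x)).
Proof.
move=> fv; have [mf vL fE] := fv; split; [exact: measurable_shift|exact: locL2_time_shift|].
move=> x ox; have [mv _] := vL.
by rewrite Rintegral_shift// -(H1on_diff fv) ?lerD2l//; ring.
Qed.

Lemma H1onM o f v g w : H1on o f v -> H1on o g w ->
  H1on o (fun x => f x * g x) (fun x => f x * w x + g x * v x).
Proof.
move=> fv gw; have [mf vL _] := fv; have [mg wL _] := gw.
have bd h r : H1on o h r -> forall b, exists M, forall x, o < x < b -> `|h x| <= M.
  move=> hr b; have [M hM] := H1on_bounded b hr.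
  by exists M => x /andP[? ?]; apply: hM; rewrite !ltW.
apply: H1on_windows.
- exact: measurable_funM.
- by apply: locL2D; apply: locL2_bM => //; [exact: bd fv|exact: bd gw].
- by move=> t ot; exact: H1derivM (H1on_window fv ot) (H1on_window gw ot).
Qed.

Lemma H1on_expR o (k : R) : H1on o (fun x => expR (k * x)) (fun x => k * expR (k * x)).
Proof.
have ce : continuous (fun x : R => expR (k * x)).
  by move=> x; apply/differentiable_continuous/derivable1_diffP; have [] := is_derive_expRM k x.
have me := continuous_measurable_fun ce.
have L : locL2 o (fun x => k * expR (k * x)).
  apply: locL2Z; rewrite (_ : (fun x => _) = fun x => expR (k * x) * 1); last first.
    by apply/funext => x; rewrite mulr1.
  apply: (@locL2_bM R o (fun x => expR (k * x)) (fun=> 1)); [by []| |exact: locL2_cst].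
  move=> b; exists (expR (k * o) + expR (k * b)) => x /andP[ox xb].
  rewrite ger0_norm ?expR_ge0//; have := expR_ge0 (k * o); have := expR_ge0 (k * b).
  case: (leP 0 k) => k0.
    have : expR (k * x) <= expR (k * b) by rewrite ler_expR; nra.
  lra.
  have : expR (k * x) <= expR (k * o) by rewrite ler_expR; nra.
  lra.
split=> // x; rewrite le_eqVlt => /predU1P[<-|ox].
  by rewrite set_itvoo0 Rintegral_set0 addr0.
have := @continuous_FTC2 R (fun x => k * expR (k * x)) (fun x => expR (k * x)) o x ox.
rewrite -integral_itv_obnd_cbnd; last by apply: measurable_funTS; apply/measurable_EFinP; case: L.
rewrite -integral_itv_bndo_bndc; last by apply: measurable_funTS; apply/measurable_EFinP; case: L.
rewrite /Rintegral => ->/=; first by ring.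
- apply: continuous_subspaceT => y; apply: cvgM; [exact: cvg_cst|exact: ce].
- split; [|apply: cvg_at_right_filter; exact: ce|apply: cvg_at_left_filter; exact: ce].
  by move=> y _; have [] := is_derive_expRM k y.
- by move=> y _; rewrite derive1E; have [_ ->] := is_derive_expRM k y.
Qed.

(** Solution of [y' = - c * y + s] with value 0 at time 0. *)
Definition duhamel (c : R) s t : R :=
  expR (- c * t) * \int[mu]_(y in `]0, t[) (expR (c * y) * s y).

Lemma duhamel0 c s : duhamel c s 0 = 0.
Proof. by rewrite /duhamel set_itvoo0 Rintegral_set0 mulr0. Qed.

Lemma H1on_duhamel (c : R) s : locL2 0 s ->
  H1on 0 (duhamel c s) (fun t => - c * duhamel c s t + s t).
Proof.
move=> sL.
have esL : locL2 0 (fun y => expR (c * y) * s y).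
  have [me _ _] := H1on_expR 0 c; apply: locL2_bM => // b.
  have [M hM] := H1on_bounded b (H1on_expR 0 c).
  by exists M => x /andP[? ?]; apply: hM; rewrite !ltW.
have := H1onM (H1on_expR 0 (- c)) (H1on_prim 0 esL).
congr H1on; apply/funext => t; rewrite /duhamel add0r// mulNr expRN; field.
by rewrite gt_eqF ?expR_gt0.
Qed.
End H1on.

(** * Difference quotients of translates *)

Section curves.
Variable R : realType.
Local Notation mu := (@lebesgue_measure R).
Local Notation D := (`]0, 1[%classic : set R).
Implicit Types (o a b t : R) (f g u v w : R -> R).

Lemma Tonelli_rectangle (A B : set R) (h : R * R -> R) : measurable A -> measurable B ->
  measurable_fun setT h -> (forall p, 0 <= h p) ->
  (\int[mu]_(x in A) \int[mu]_(y in B) (h (x, y))%:E =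
   \int[mu]_(y in B) \int[mu]_(x in A) (h (x, y))%:E)%E.
Proof.
move=> mA mB mh h0.
pose F (p : R * R) := (h p * \1_A p.1 * \1_B p.2)%:E.
have mF : measurable_fun setT F.
  apply/measurable_EFinP; apply: measurable_funM; first apply: measurable_funM => //.
    by apply: measurableT_comp => //; exact: measurable_indic.
  by apply: measurableT_comp => //; exact: measurable_indic.
have F0 p : (0 <= F p)%E by rewrite lee_fin !mulr_ge0// indicE.
have := @fubini_tonelli _ _ _ _ R mu mu F mF F0.
have -> : (\int[mu]_x \int[mu]_y F (x, y) =
    \int[mu]_(x in A) \int[mu]_(y in B) (h (x, y))%:E)%E.
  rewrite [RHS]integral_mkcond; apply: eq_integral => x _; rewrite patchE.
  case: ifPn => xA.
    rewrite [RHS]integral_mkcond; apply: eq_integral => y _; rewrite patchE /F/= !indicE xA.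
    by case: ifPn => _; rewrite ?mulr1// mulr0.
  rewrite -[RHS](@integral0 _ _ R mu setT); apply: eq_integral => y _.
  by rewrite /F/= !indicE (negbTE xA) mulr0 mul0r.
move=> ->.
rewrite [RHS]integral_mkcond; apply: eq_integral => y _; rewrite patchE.
case: ifPn => yB.
  rewrite [RHS]integral_mkcond; apply: eq_integral => x _; rewrite patchE /F/= !indicE yB.
  by case: ifPn => _; rewrite ?mulr1// mulr0// mul0r.
rewrite -[RHS](@integral0 _ _ R mu setT); apply: eq_integral => x _.
by rewrite /F/= !indicE (negbTE yB) mulr0.
Qed.

Lemma measurable_slice_integral (B : set R) (h : R * R -> R) : measurable B ->
  measurable_fun setT h -> (forall p, 0 <= h p) ->
  measurable_fun setT (fun x => (\int[mu]_(y in B) (h (x, y))%:E)%E).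
Proof.
move=> mB mh h0; pose F (p : R * R) := (h p * \1_B p.2)%:E.
have mF : measurable_fun setT F.
  apply/measurable_EFinP; apply: measurable_funM => //.
  by apply: measurableT_comp => //; exact: measurable_indic.
have F0 p : (0 <= F p)%E by rewrite lee_fin mulr_ge0// indicE.
rewrite (_ : (fun x => _) = fun x => (\int[mu]_y F (x, y))%E).
  exact: (@measurable_fun_fubini_tonelli_F _ _ _ _ R mu F mF F0).
apply/funext => x; rewrite integral_mkcond; apply: eq_integral => y _.
by rewrite patchE /F/= indicE; case: ifPn => _; rewrite ?mulr1// mulr0.
Qed.

(* The difference quotient of f is the mean of the translates of v, so Jensen
   and Tonelli bound its distance to one translate by that of the others. *)
Lemma H1on_mean_translate o f v a b c (e : R) : H1on o f v -> o <= a -> a < b -> o <= c ->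
  (forall r, a < r < b ->
     ip (fun x => v (r + x) - v (c + x)) (fun x => v (r + x) - v (c + x)) <= e) ->
  ip (fun x => (f (b + x) - f (a + x)) / (b - a) - v (c + x))
     (fun x => (f (b + x) - f (a + x)) / (b - a) - v (c + x)) <= e.
Proof.
move=> fv oa ab oc ve; have [mf vL _] := fv; have [mv vi] := vL.
have ba0 : 0 < b - a by rewrite subr_gt0.
have bai0 : 0 <= (b - a)^-1 by rewrite invr_ge0 ltW.
pose h (p : R * R) := (v (p.2 + p.1) - v (c + p.1)) ^+ 2.
have mh : measurable_fun setT h.
  apply/measurable_funX; apply: measurable_funB; apply: measurableT_comp => //.
    by apply: measurable_funD.
  by apply: measurable_funD.
have h0 p : 0 <= h p by exact: sqr_ge0.
have mE : measurable (`]a, b[%classic : set R) by exact: measurable_itv.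
have mD : measurable D by exact: measurable_itv.
have hxi x : D x -> mu.-integrable `]a, b[ (EFin \o (fun r => v (r + x) - v (c + x))) /\
    mu.-integrable `]a, b[ (EFin \o (fun r => (v (r + x) - v (c + x)) ^+ 2)).
  rewrite /= in_itv/= => /andP[x0 x1].
  have oax : o <= a + x by rewrite (le_trans oa)// lerDl ltW.
  have vxL : locL2 a (fun r => v (x + r)).
    by apply: locL2_time_shift; apply: locL2_base vL; rewrite addrC.
  have dL := locL2B vxL (locL2_cst a (v (c + x))).
  have -> : (fun r => v (r + x) - v (c + x)) = (fun r => v (x + r) - v (c + x)).
    by apply/funext => r; rewrite (addrC r).
  have -> : (fun r => (v (r + x) - v (c + x)) ^+ 2) = (fun r => (v (x + r) - v (c + x)) ^+ 2).
    by apply/funext => r; rewrite (addrC r).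
  by split; [exact: locL2_integrable|have [_ ->] := dL].
have pt x : D x -> ((f (b + x) - f (a + x)) / (b - a) - v (c + x)) ^+ 2 <=
    (b - a)^-1 * \int[mu]_(r in `]a, b[) h (x, r).
  move=> Dx; have [i1 i2] := hxi x Dx; move: (Dx); rewrite /= in_itv/= => /andP[x0 x1].
  have oax : o <= a + x by rewrite (le_trans oa)// lerDl ltW.
  have abx : a + x <= b + x by rewrite lerD2r ltW.
  have -> : (f (b + x) - f (a + x)) / (b - a) - v (c + x) =
      (b - a)^-1 * \int[mu]_(r in `]a, b[) (v (r + x) - v (c + x)).
    rewrite (H1on_diff fv oax abx) RintegralB//; last 2 first.
    - have := integrable_addR mE i1 (integrable_cstR (v (c + x)) mE (mu_itvoo_lty a b)).
      by congr (integrable _ _ _); apply/funext => r /=; rewrite subrK.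
    - exact: integrable_cstR (mu_itvoo_lty a b).
    rewrite Rintegral_cst// fine_mu_itv; last exact: ltW.
    rewrite [a + x]addrC [b + x]addrC -Rintegral_shift//.
    under eq_Rintegral do rewrite addrC.
    by field; rewrite gt_eqF.
  rewrite exprMn expr2 -mulrA ler_wpM2l//.
  rewrite -ler_pdivlMl ?invr_gt0// invrK.
  exact: Rintegral_CS (ltW ab) i1 i2.
set u := fun x => _ - _.
have mfS (r : R) : measurable_fun setT (fun x : R => f (r + x)) by exact: measurable_shift.
have mu_ : measurable_fun setT u.
  apply: measurable_funB; last exact: measurable_shift.
  by apply: measurable_funM => //; apply: measurable_funB.
have vhi r : a < r < b -> (\int[mu]_(x in D) (h (x, r))%:E <= e%:E)%E.
  move=> /andP[ar rb]; have arb : a < r < b by rewrite ar.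
  have or_ : o <= r by rewrite (le_trans oa) ?ltW.
  have dL := L2B (locL2_shift vL or_) (locL2_shift vL oc).
  have di := L2_mul_integrable dL dL.
  have := ve r arb; rewrite -lee_fin; apply: le_trans; rewrite /ip /Rintegral fineK.
    rewrite le_eqVlt; apply/orP; left; apply/eqP.
    by apply: eq_integral => x _; rewrite /h/= expr2.
  exact: integrable_fin_num di.
have le1 : (\int[mu]_(x in D) (u x * u x)%:E <=
    \int[mu]_(x in D) (((b - a)^-1)%:E * \int[mu]_(r in `]a, b[) (h (x, r))%:E))%E.
  apply: ge0_le_integral => //.
  - by move=> x _; rewrite lee_fin -expr2 sqr_ge0.
  - by apply/measurable_EFinP; apply: measurable_funTS; exact: measurable_funM.
  - apply: measurable_funTS; apply: emeasurable_funM => //.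
    exact: measurable_slice_integral.
  - move=> x Dx; have := pt x Dx; rewrite -lee_fin -expr2 => /le_trans; apply.
    rewrite EFinM /Rintegral fineK ?lexx//; have [_ i2] := hxi x Dx.
    exact: integrable_fin_num i2.
have le2 : (\int[mu]_(x in D) (u x * u x)%:E <= e%:E)%E.
  apply: (le_trans le1); rewrite ge0_integralZl//; last 2 first.
  - by apply: measurable_funTS; exact: measurable_slice_integral.
  - by move=> x _; apply: integral_ge0 => r _; rewrite lee_fin.
  rewrite Tonelli_rectangle//.
  apply: (@le_trans _ _ (((b - a)^-1)%:E * \int[mu]_(r in `]a, b[) e%:E)%E).
    apply: lee_wpmul2l; first by rewrite lee_fin.
    apply: ge0_le_integral => //.
    - by move=> r _; apply: integral_ge0 => x _; rewrite lee_fin.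
    - apply: measurable_funTS.
      apply: (@measurable_slice_integral D (fun p => h (p.2, p.1))) => //.
      by apply: measurableT_comp => //; exact: measurable_swap.
  have muE : mu (`]a, b[%classic : set R) = (b - a)%:E.
    by rewrite lebesgue_measure_itv/= lte_fin ab.
  have := @integral_cst _ _ R mu (`]a, b[%classic : set R) mE e%:E; rewrite /cst => ->.
  rewrite [X in (_ * (_ * X) <= _)%E](_ : _ = (b - a)%:E); last exact: muE.
  by rewrite -!EFinM lee_fin mulrCA mulVf ?mulr1// gt_eqF.
rewrite -lee_fin /ip /Rintegral fineK//.
rewrite ge0_fin_numE; first exact: le_lt_trans le2 (ltry _).
by apply: integral_ge0 => x _; rewrite lee_fin -expr2 sqr_ge0.
Qed.

End curves.

(** * Continuity and differentiability of d'Alembert curves *)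

Section curve.
Variable R : realType.
Local Notation mu := (@lebesgue_measure R).
Implicit Types (t : R) (f g b u v w : R -> R).

(* d'Alembert form f(t+x) + g(t-x), plus a term b(t) e^{qx} for the source of w. *)
Definition curve (q : R) f g b t x := f (t + x) + g (t - x) + b t * expR (q * x).

Lemma ip_reflect01 u : measurable_fun setT u -> ip u u = ip (fun x => u (1 - x)) (fun x => u (1 - x)).
Proof.
move=> mu_; rewrite /ip.
have := @Rintegral_reflect R 1 0 1 (fun x => u x * u x) (measurable_funM mu_ mu_).
by rewrite subr0 subrr => ->.
Qed.

Lemma L2_reflect01 u : measurable_fun setT u -> L2 (fun x => u (1 - x)) -> L2 u.
Proof.
move=> mu_ /L2E[_ i]; apply/L2E; split; first exact: measurable_funTS.
have := @integrable_reflect R 1 0 1 (fun x => u (1 - x) ^+ 2).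
rewrite subr0 subrr => /(_ _ i) h.
rewrite (_ : (fun x => u x ^+ 2) = fun x => u (1 - (1 - x)) ^+ 2); last first.
  by apply/funext => x; congr (u _ ^+ 2); ring.
apply: h; apply/measurable_funX; apply: measurableT_comp => //.
exact: measurable_funB.
Qed.

Lemma ip_add3_le u v w : L2 u -> L2 v -> L2 w ->
  ip (fun x => u x + v x + w x) (fun x => u x + v x + w x) <=
  4 * ip u u + 4 * ip v v + 4 * ip w w.
Proof.
move=> uL vL wL; have h1 := ip_add_le (L2D uL vL) wL; have h2 := ip_add_le uL vL.
rewrite -[leLHS]/(ip (u \+ v \+ w) (u \+ v \+ w)).
by apply: le_trans h1 _; have := ip_ge0 w; lra.
Qed.

(** For [t >= 0] the argument [t - x] stays above -1; this is why every profile is given on the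
    half-line from -1. *)
Lemma locL2_reflect g t : locL2 (-1) g -> 0 <= t -> L2 (fun x => g (t - x)).
Proof.
move=> gL t0; have [mg _] := gL; apply: L2_reflect01.
  by apply: measurableT_comp => //; exact: measurable_funB.
rewrite (_ : (fun x => _) = fun x => g ((t - 1) + x)); first by apply: locL2_shift gL _; lra.
by apply/funext => x; congr g; ring.
Qed.

Lemma curve_L2 q f g b t : locL2 (-1) f -> locL2 (-1) g -> 0 <= t -> L2 (curve q f g b t).
Proof.
move=> fL gL t0; apply: L2D; last by apply: L2Z; exact: expRM_L2.
apply: L2D; last exact: locL2_reflect.
by apply: locL2_shift fL _; lra.
Qed.

Lemma curve_continuous q f g b b' t (e : R) : locL2 (-1) f -> locL2 (-1) g -> H1on 0 b b' ->
  0 <= t -> 0 < e -> exists2 d, 0 < d & forall s, 0 <= s -> `|s - t| < d ->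
    ip (curve q f g b s \- curve q f g b t) (curve q f g b s \- curve q f g b t) <= e.
Proof.
move=> fL gL bH t0 e0; have [mg _] := gL.
(* [ip_add3_le] multiplies each of the three terms by 4. *)
have e12 : 0 < e / 12 by rewrite divr_gt0.
pose X := ip (fun x => expR (q * x)) (fun x => expR (q * x)).
have X0 : 0 <= X by exact: ip_ge0.
have eX : 0 < e / 12 / (X + 1) by rewrite divr_gt0//; lra.
(* The bound by 1 lets the square of the increment of [b] be bounded by its absolute value; [X + 1]
   avoids dividing by 0. *)
have eX' : 0 < Num.min 1 (e / 12 / (X + 1)) by rewrite lt_min ltr01.
have t1 : -1 <= t by lra.
have t2 : -1 <= t - 1 by lra.
have [d1 d10 h1] := locL2_translation fL t1 e12.
have [d2 d20 h2] := locL2_translation gL t2 e12.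
have [d3 d30 h3] := H1on_continuous bH t0 eX'.
exists (Num.min d1 (Num.min d2 d3)); first by rewrite !lt_min d10 d20.
move=> s s0; rewrite !lt_min => /and3P[/h1 {}h1 {}sd2 /(h3 s s0) {}h3].
have s1 : -1 <= s by lra.
have s2 : -1 <= s - 1 by lra.
have -> : curve q f g b s \- curve q f g b t = fun x => (f (s + x) - f (t + x)) +
    (g (s - x) - g (t - x)) + (b s - b t) * expR (q * x).
  by apply/funext => x; rewrite /curve /=; ring.
apply: le_trans (ip_add3_le _ _ _) _.
- exact: L2B (locL2_shift fL s1) (locL2_shift fL t1).
- exact: L2B (locL2_reflect gL s0) (locL2_reflect gL t0).
- exact: L2Z (expRM_L2 q).
have -> : ip (fun x => g (s - x) - g (t - x)) (fun x => g (s - x) - g (t - x)) =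
    ip (fun x => g ((s - 1) + x) - g ((t - 1) + x)) (fun x => g ((s - 1) + x) - g ((t - 1) + x)).
  rewrite ip_reflect01; last first.
    by apply: measurable_funB; apply: measurableT_comp => //; exact: measurable_funB.
  by congr ip; apply/funext => x; congr (g _ - g _); ring.
have {}h2 : ip (fun x => g ((s - 1) + x) - g ((t - 1) + x)) (fun x => g ((s - 1) + x) - g ((t - 1) + x)) <= e / 12.
  by apply: h2 => //; rewrite opprB addrA subrK.
have h3' : ip (fun x => (b s - b t) * expR (q * x)) (fun x => (b s - b t) * expR (q * x)) <= e / 12.
  have eL := expRM_L2 q.
  have -> : ip (fun x => (b s - b t) * expR (q * x)) (fun x => (b s - b t) * expR (q * x)) = (b s - b t) ^+ 2 * X.
    rewrite -[LHS]/(ip ((b s - b t) \*o (fun x => expR (q * x))) ((b s - b t) \*o (fun x => expR (q * x)))).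
    by rewrite ipZl ?ipZr//; [rewrite -/X; ring|exact: L2Z].
  move: h3; rewrite le_min => /andP[h3 h4].
  apply: (@le_trans _ _ ((e / 12 / (X + 1)) * (X + 1))); last by rewrite divfK// gt_eqF//; lra.
  apply: ler_pM; rewrite ?sqr_ge0//; last by lra.
  by rewrite -real_normK ?num_real// expr2; have := normr_ge0 (b s - b t); nra.
have := h1 s1; lra.
Qed.

Lemma H1on_dquot o f v t (e : R) : H1on o f v -> o <= t -> 0 < e ->
  exists2 d, 0 < d & forall s, o <= s -> s != t -> `|s - t| < d ->
    ip (fun x => (f (s + x) - f (t + x)) / (s - t) - v (t + x))
       (fun x => (f (s + x) - f (t + x)) / (s - t) - v (t + x)) <= e.
Proof.
move=> fv ot e0; have [_ vL _] := fv.
have [d d0 vd] := locL2_translation vL ot e0; exists d => // s os st sd.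
have [lts|lts|h] := ltgtP s t; last by rewrite h eqxx in st.
  have -> : (fun x => (f (s + x) - f (t + x)) / (s - t) - v (t + x)) =
      (fun x => (f (t + x) - f (s + x)) / (t - s) - v (t + x)).
    by apply/funext => x; field; rewrite !subr_eq0 st eq_sym st.
  apply: (H1on_mean_translate fv os lts ot) => r /andP[sr rt].
  apply: vd; first by rewrite (le_trans os)// ltW.
  by move: sd; rewrite !ltr_norml => /andP[? ?]; apply/andP; split; lra.
apply: (H1on_mean_translate fv ot lts ot) => r /andP[tr rs].
apply: vd; first by rewrite (le_trans ot)// ltW.
by move: sd; rewrite !ltr_norml => /andP[? ?]; apply/andP; split; lra.
Qed.

Lemma H1on_derivative B b b' t (e : R) : H1on 0 B b -> H1on 0 b b' -> 0 <= t -> 0 < e ->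
  exists2 d, 0 < d & forall s, 0 <= s -> s != t -> `|s - t| < d ->
    `|(B s - B t) / (s - t) - b t| <= e.
Proof.
move=> Bb bb t0 e0; have [d d0 bd] := H1on_continuous bb t0 e0.
have [_ bL _] := Bb.
have mean x y : 0 <= x -> x < y -> (forall r, x < r < y -> `|b r - b t| <= e) ->
    `|(B y - B x) / (y - x) - b t| <= e.
  move=> x0 xy be; have xy0 : 0 < y - x by rewrite subr_gt0.
  have mE : measurable (`]x, y[%classic : set R) by exact: measurable_itv.
  have bi := locL2_integrableS y bL x0.
  have ci k := integrable_cstR k mE (mu_itvoo_lty x y).
  have ub : B y - B x <= (b t + e) * (y - x).
    rewrite (H1on_diff Bb x0 (ltW xy)).
    have := @le_Rintegral _ _ R mu _ b (fun=> b t + e) mE bi (ci _).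
    rewrite Rintegral_cst// fine_mu_itv; last exact: ltW.
    apply=> r; rewrite /= in_itv/= => /be; rewrite ler_norml => /andP[_]; lra.
  have lb : (b t - e) * (y - x) <= B y - B x.
    rewrite (H1on_diff Bb x0 (ltW xy)).
    have := @le_Rintegral _ _ R mu _ (fun=> b t - e) b mE (ci _) bi.
    rewrite Rintegral_cst// fine_mu_itv; last exact: ltW.
    apply=> r; rewrite /= in_itv/= => /be; rewrite ler_norml => /andP[]; lra.
  have {}ub : (B y - B x) / (y - x) <= b t + e by rewrite ler_pdivrMr.
  have {}lb : b t - e <= (B y - B x) / (y - x) by rewrite ler_pdivlMr.
  by rewrite ler_norml; apply/andP; split; lra.
exists d => // s s0 st; rewrite ltr_norml => /andP[sd1 sd2].
have [lts|lts|h] := ltgtP s t; last by rewrite h eqxx in st.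
  have -> : (B s - B t) / (s - t) = (B t - B s) / (t - s).
    by field; rewrite !subr_eq0 st eq_sym st.
  apply: mean => // r /andP[? ?]; apply: bd; first by lra.
  by rewrite ltr_norml; apply/andP; split; lra.
apply: mean => // r /andP[? ?]; apply: bd; first by lra.
by rewrite ltr_norml; apply/andP; split; lra.
Qed.

Lemma curve_derivative q F f G g B b b' t (e : R) :
  H1on (-1) F f -> H1on (-1) G g -> H1on 0 B b -> H1on 0 b b' -> 0 <= t -> 0 < e ->
  exists2 d, 0 < d & forall s, 0 <= s -> s != t -> `|s - t| < d ->
    ip (fun x => (s - t)^-1 * (curve q F G B s x - curve q F G B t x) - curve q f g b t x)
       (fun x => (s - t)^-1 * (curve q F G B s x - curve q F G B t x) - curve q f g b t x) <= e.
Proof.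
move=> FH GH BH bH t0 e0; have [mG gL _] := GH; have [mF fL _] := FH; have [mg _] := gL.
have FL := H1on_locL2 FH; have GL := H1on_locL2 GH.
have e12 : 0 < e / 12 by rewrite divr_gt0.
pose X := ip (fun x => expR (q * x)) (fun x => expR (q * x)).
have X0 : 0 <= X by exact: ip_ge0.
have eX : 0 < e / 12 / (X + 1) by rewrite divr_gt0//; lra.
have eX' : 0 < Num.min 1 (e / 12 / (X + 1)) by rewrite lt_min ltr01.
have t1 : -1 <= t by lra.
have t2 : -1 <= t - 1 by lra.
have [d1 d10 h1] := H1on_dquot FH t1 e12.
have [d2 d20 h2] := H1on_dquot GH t2 e12.
have [d3 d30 h3] := H1on_derivative BH bH t0 eX'.
exists (Num.min d1 (Num.min d2 d3)); first by rewrite !lt_min d10 d20.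
move=> s s0 st; rewrite !lt_min => /and3P[sd1 sd2 /(h3 s s0 st) {}h3].
have s1 : -1 <= s by lra.
have s2 : -1 <= s - 1 by lra.
have {}h1 := h1 s s1 st sd1.
set k := (s - t)^-1; set De := (B s - B t) / (s - t) - b t.
have -> : (fun x => k * (curve q F G B s x - curve q F G B t x) - curve q f g b t x) =
    fun x => ((F (s + x) - F (t + x)) / (s - t) - f (t + x)) +
    ((G (s - x) - G (t - x)) / (s - t) - g (t - x)) + De * expR (q * x).
  by apply/funext => x; rewrite /curve /De -/k; ring.
apply: le_trans (ip_add3_le _ _ _) _.
- apply: L2B (locL2_shift fL t1).
  have := L2Z k (L2B (locL2_shift FL s1) (locL2_shift FL t1)).
  by congr L2; apply/funext => x /=; rewrite mulrC.
- apply: L2B (locL2_reflect gL t0).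
  have := L2Z k (L2B (locL2_reflect GL s0) (locL2_reflect GL t0)).
  by congr L2; apply/funext => x /=; rewrite mulrC.
- exact: L2Z (expRM_L2 q).
have {}h2 : ip (fun x => (G (s - x) - G (t - x)) / (s - t) - g (t - x))
     (fun x => (G (s - x) - G (t - x)) / (s - t) - g (t - x)) <= e / 12.
  have E : s - 1 - (t - 1) = s - t by ring.
  rewrite ip_reflect01; last first.
    apply: measurable_funB; last by apply: measurableT_comp => //; exact: measurable_funB.
    apply: measurable_funM => //.
    by apply: measurable_funB; apply: measurableT_comp => //; exact: measurable_funB.
  rewrite (_ : (fun x => _) = fun x => (G ((s - 1) + x) - G ((t - 1) + x)) / ((s - 1) - (t - 1)) - g ((t - 1) + x)); last first.
    by apply/funext => x; rewrite E; congr ((G _ - G _) / _ - g _); ring.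
  apply: h2; rewrite ?E//.
  by apply: contra_neq st => h; lra.
have h3' : ip (fun x => De * expR (q * x)) (fun x => De * expR (q * x)) <= e / 12.
  have eL := expRM_L2 q.
  have -> : ip (fun x => De * expR (q * x)) (fun x => De * expR (q * x)) = De ^+ 2 * X.
    rewrite -[LHS]/(ip (De \*o (fun x => expR (q * x))) (De \*o (fun x => expR (q * x)))).
    by rewrite ipZl ?ipZr//; [rewrite -/X; ring|exact: L2Z].
  move: h3; rewrite -/De le_min => /andP[h3 h4].
  apply: (@le_trans _ _ ((e / 12 / (X + 1)) * (X + 1))); last by rewrite divfK// gt_eqF//; lra.
  apply: ler_pM; rewrite ?sqr_ge0//; last by lra.
  by rewrite -real_normK ?num_real// expr2; have := normr_ge0 De; nra.
move: h1 h2 h3'; lra.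
Qed.

Lemma curve_H1deriv q f f' g g' b t : H1on (-1) f f' -> H1on (-1) g g' -> 0 <= t ->
  H1deriv (curve q f g b t) (curve q f' (\- g') (q \*o b) t).
Proof.
move=> ff gg t0; have t1 : -1 <= t by lra.
have t2 : -1 <= t - 1 by lra.
apply: H1derivD; first exact: H1derivD (H1on_window ff t1) (H1on_reflect gg t2).
have e0 : 0 <= 0 :> R by [].
have := H1derivZ (b t) (H1on_window (H1on_expR 0 q) e0).
rewrite (_ : b t \*o _ = fun x => b t * expR (q * x)); last first.
  by apply/funext => x /=; rewrite add0r.
by congr H1deriv; apply/funext => x /=; rewrite add0r; ring.
Qed.
End curve.

(** * Solving the boundary conditions as a delay system *)

Section solver.
Variable R : realType.
Local Notation mu := (@lebesgue_measure R).
Implicit Types (o t : R) (f g p : R -> R).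

(* K p on (-oo, T+1] only depends on p on (-oo, T], so the iterates of K are
   eventually constant on every bounded interval. *)
Lemma causal_fixpoint o (K : (R -> R) -> (R -> R)) p0 :
  locL2 o p0 -> (forall p, locL2 o p -> locL2 o (K p)) ->
  (forall p t, t <= 1 -> K p t = p0 t) ->
  (forall T p p', (forall t, t <= T -> p t = p' t) -> forall t, t <= T + 1 -> K p t = K p' t) ->
  exists2 p, locL2 o p & forall t, p t = K p t.
Proof.
move=> p0L KL K1 Kc; pose q n := iter n K p0.
have qL n : locL2 o (q n) by elim: n => //= n; exact: KL.
have qS n : forall t, t <= n.+1%:R -> q n t = q n.+1 t.
  elim: n => [t t1|n IH t tn]; first by rewrite /q/= K1.
  by rewrite /q !iterS; apply: (Kc n.+1%:R) => //; rewrite natr1.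
have qE n m t : (n <= m)%N -> t <= n.+1%:R -> q n t = q m t.
  move=> /subnK <- tn; elim: (m - n)%N => //= k ->.
  by apply: qS; apply: (le_trans tn); rewrite ler_nat ltnS leq_addl.
(* Since [t <= truncn t + 1] for every real [t], the iterate with this index has already stabilised
   at [t]. *)
pose p t := q (Num.truncn t) t.
have ptr t : t <= (Num.truncn t).+1%:R by exact/ltW/truncnS_gt.
have pE n t : t <= n.+1%:R -> p t = q n t.
  move=> tn; rewrite /p; case: (leqP (Num.truncn t) n) => h; first exact: qE.
  by apply/esym/qE => //; exact: ltnW.
exists p; last first.
  move=> t; pose n := Num.truncn t.
  rewrite (pE n.+1); last by apply: (le_trans (ptr t)); rewrite ler_nat.
  apply: (Kc n.+1%:R) => [s sn|]; first exact/esym/pE.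
  by apply: (le_trans (ptr t)); rewrite natr1 ler_nat.
have mp : measurable_fun setT p.
  apply: (@measurable_fun_cvg _ _ R setT q) => [n|t _]; first by case: (qL n).
  apply: cvg_near_cst; exists (Num.truncn t) => // n /= tn.
  by apply/eqP; rewrite (pE n)//; apply: (le_trans (ptr t)); rewrite ler_nat.
split=> // b; have [_ /(_ b)] := qL (Num.truncn b).
apply: eq_integrable => // t; rewrite inE/= in_itv/= => /andP[_ tb].
by rewrite (pE (Num.truncn b))// (le_trans (ltW tb)).
Qed.

Lemma locL2_le_eq (o x : R) p p' : (forall t, t <= x -> p t = p' t) ->
  \int[mu]_(y in `]o, x[) p y = \int[mu]_(y in `]o, x[) p' y.
Proof.
move=> pp; apply: eq_Rintegral => y; rewrite inE/= in_itv/= => /andP[_ yx].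
by apply: pp; exact: ltW.
Qed.

Lemma H1on_deriv_ext o f p p' : locL2 o p' -> (forall x, o < x -> p x = p' x) ->
  H1on o f p -> H1on o f p'.
Proof.
move=> p'L pp [mf pL fE]; split => // x ox; rewrite (fE x ox); congr (_ + _).
by apply: eq_Rintegral => y; rewrite inE/= in_itv/= => /andP[oy _]; exact: pp.
Qed.

Variables (k0 k1 k2 c phi gam : R) (f0 g0 eta eta' xi xi' : R -> R).
Hypotheses (f0L : locL2 (-1) f0) (g0L : locL2 (-1) g0).
Hypotheses (etaH : H1on 0 eta eta') (eta0 : eta 0 = 0).
Hypotheses (xiH : H1on 0 xi xi') (xi0 : xi 0 = 0).

Let prm p x := \int[mu]_(y in `]-1, x[) p y.
(* The unknown is p = f'.  With a = \int_0^t (f + g), the condition at x = 0 reads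
   g = k0 f - d - c a - eta, hence a' = - c a + src with src = (1 + k0) f - d - eta,
   and g' is the causal function G p; the condition at x = 1 has delay 2. *)
Let d := k0 * (phi + prm f0 0) - (gam + prm g0 0).
Let src p t := (1 + k0) * (phi + prm p t) - d - eta t.
Let A p := duhamel c (src p).
Let G p t := if t <= 0 then g0 t else k0 * p t - c * (- c * A p t + src p t) - eta' t.
Let K p t := if t <= 1 then f0 t else k1 * G p (-2 + t) + k2 * p (-2 + t) + xi' (-1 + t).

Let src_L p : locL2 (-1) p -> locL2 0 (src p).
Proof.
move=> pL; apply: locL2B (H1on_locL2 etaH); apply: locL2B (locL2_cst _ _).
apply: locL2Z; apply: (@H1on_locL2 _ _ _ p).
by apply: H1on_base (H1on_prim phi pL); lra.
Qed.

Let A_H p : locL2 (-1) p -> H1on 0 (A p) (fun t => - c * A p t + src p t).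
Proof. by move=> pL; apply: H1on_duhamel; exact: src_L. Qed.

Let G_L p : locL2 (-1) p -> locL2 (-1) (G p).
Proof.
move=> pL; apply: locL2_if => //; have [_ AL _] := A_H pL; have [_ eL _] := etaH.
apply: locL2B eL; apply: locL2B; last exact: locL2Z.
by apply: locL2Z; apply: locL2_base pL; lra.
Qed.

Let K_L p : locL2 (-1) p -> locL2 (-1) (K p).
Proof.
move=> pL; apply: locL2_if => //; have [_ xL _] := xiH.
have e2 : -2 + 1 = -1 :> R by ring.
apply: locL2D; first apply: locL2D; try apply: locL2Z; apply: locL2_time_shift.
- by rewrite e2; exact: G_L.
- by rewrite e2.
- by rewrite addNr.
Qed.

Let src_causal (T : R) (p p' : R -> R) : (forall t, t <= T -> p t = p' t) ->
  forall t, t <= T -> src p t = src p' t.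
Proof.
move=> pp t tT; rewrite /src /prm (@locL2_le_eq _ _ p p')// => s st.
by apply: pp; exact: le_trans tT.
Qed.

Let G_causal (T : R) (p p' : R -> R) : (forall t, t <= T -> p t = p' t) ->
  forall t, t <= T -> G p t = G p' t.
Proof.
move=> pp t tT; rewrite /G; case: ifP => // _.
have AE : A p t = A p' t.
  rewrite /A /duhamel; apply: congr1; apply: locL2_le_eq => s st.
  by rewrite (src_causal pp (le_trans st tT)).
by rewrite AE (pp t tT) (src_causal pp tT).
Qed.

Let K_causal T p p' : (forall t, t <= T -> p t = p' t) ->
  forall t, t <= T + 1 -> K p t = K p' t.
Proof.
move=> pp t tT; rewrite /K; case: ifP => // _.
have tT2 : -2 + t <= T by lra.
by rewrite (G_causal pp tT2) (pp _ tT2).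
Qed.

(** The prescribed histories are [f0] up to 1 and [g0] up to 0; [eta] and [xi] are the forcing terms
    at the two ends, already integrated in time. Both boundary relations compare increments from
    time 0, because the equations solved are those for the derivatives. *)
Lemma delay_system : exists f f' g g' a, [/\
  [/\ H1on (-1) f f', H1on (-1) g g', f (-1) = phi & g (-1) = gam],
  (forall x, x <= 1 -> f' x = f0 x) /\ (forall x, x <= 0 -> g' x = g0 x),
  [/\ H1on 0 a (fun t => f t + g t), a 0 = 0 &
      forall t, 0 <= t -> k0 * f t - g t = k0 * f 0 - g 0 + c * a t + eta t] &
  forall t, 0 <= t ->
    f (1 + t) - f 1 = k1 * (g (-1 + t) - g (-1)) + k2 * (f (-1 + t) - f (-1)) + xi t].
Proof.
have [p pL pK] : exists2 p, locL2 (-1) p & forall t, p t = K p t.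
  by apply: (causal_fixpoint f0L K_L _ K_causal) => p t t1; rewrite /K t1.
pose f x := phi + prm p x; pose g x := gam + prm (G p) x.
have fH : H1on (-1) f p := H1on_prim phi pL.
have gH : H1on (-1) g (G p) := H1on_prim gam (G_L pL).
have pE x : x <= 1 -> p x = f0 x by move=> x1; rewrite pK /K x1.
have GE x : x <= 0 -> G p x = g0 x by move=> x1; rewrite /G x1.
have f1 : f (-1) = phi by rewrite /f /prm set_itvoo0 Rintegral_set0 addr0.
have g1 : g (-1) = gam by rewrite /g /prm set_itvoo0 Rintegral_set0 addr0.
(* The constant [d] was defined from the histories, which agree with [p] and [G p] to the left of
   0. *)
have dE : d = k0 * f 0 - g 0.
  rewrite /d /f /g /prm (@locL2_le_eq _ _ p f0); last by move=> t t0; apply: pE; lra.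
  by rewrite (@locL2_le_eq _ _ (G p) g0).
have srcE t : src p t = (1 + k0) * f t - (k0 * f 0 - g 0) - eta t by rewrite -dE.
have A0 : A p 0 = 0 by exact: duhamel0.
have gE t : 0 <= t -> g t = g 0 + k0 * (f t - f 0) - c * A p t - eta t.
  move=> t0; have m1 : -1 <= 0 :> R by lra.
  have := H1on_diff gH m1 t0.
  have RH := H1onB (H1onB (H1onZ k0 (H1on_base m1 fH)) (H1onZ c (A_H pL))) etaH.
  have := H1on_diff RH (lexx 0) t0.
  rewrite A0 eta0.
  have -> : \int[mu]_(y in `]0, t[) (k0 * p y - c * (- c * A p y + src p y) - eta' y) =
     \int[mu]_(y in `]0, t[) G p y.
    apply: eq_Rintegral => y; rewrite inE/= in_itv/= => /andP[y0 _].
    by rewrite /G leNgt y0.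
  by move=> <- E; rewrite -[LHS](subrK (g 0)) E; ring.
exists f, p, g, (G p), (A p); split => //.
- split => //; last first.
    by move=> t t0; rewrite (gE t t0); ring.
  apply: H1on_deriv_ext (A_H pL) => [|t t0].
    have m1 : -1 <= 0 :> R by lra.
    exact: locL2_base m1 (locL2D (H1on_locL2 fH) (H1on_locL2 gH)).
  by rewrite (gE t (ltW t0)) srcE; ring.
move=> t t0; have m1 : -1 <= 1 :> R by lra.
have tt1 : 1 <= 1 + t by rewrite lerDl.
have e2 : -2 + 1 = -1 :> R by ring.
have sf (h h' : R -> R) : H1on (-1) h h' -> H1on 1 (fun x => h (-2 + x)) (fun x => h' (-2 + x)).
  by move=> hH; apply: H1on_time_shift; rewrite e2.
have sxi : H1on 1 (fun x => xi (-1 + x)) (fun x => xi' (-1 + x)).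
  by apply: H1on_time_shift; rewrite addNr.
have HH := H1onD (H1onD (H1onZ k1 (sf _ _ gH)) (H1onZ k2 (sf _ _ fH))) sxi.
rewrite (H1on_diff fH m1 tt1).
have -> : \int[mu]_(y in `]1, (1 + t)[) p y =
    \int[mu]_(y in `]1, (1 + t)[) (k1 * G p (-2 + y) + k2 * p (-2 + y) + xi' (-1 + y)).
  apply: eq_Rintegral => y; rewrite inE/= in_itv/= => /andP[y1 _].
  by rewrite pK /K leNgt y1.
rewrite -(H1on_diff HH (lexx 1) tt1) !e2 addNr xi0.
have -> : -2 + (1 + t) = -1 + t by ring.
have -> : -1 + (1 + t) = t by ring.
ring.
Qed.
End solver.

(** * State-valued trajectories built from profiles *)

Section trajectory.
Variables (R : realType) (q : R).
Implicit Types (t : R) (f g b u v w : R -> R).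
Local Notation curve := (curve q).
Local Notation near_time t := (within [set s : R | 0 <= s] (nbhs t)).
Local Notation near_time' t := (within [set s : R | 0 <= s] (dnbhs t)).

Lemma sub_state_cancel (V V' W : state R) :
  sub_state (sub_state V W) (sub_state V' W) = sub_state V V'.
Proof.
case: V V' W => [? ? ? ? ? ? ?] [? ? ? ? ? ? ?] [? ? ? ? ? ? ?].
by congr State; apply/funext => x /=; ring.
Qed.

Lemma H1on_opp o f v : H1on o f v -> H1on o (\- f) (\- v).
Proof. by move/(H1onZ (-1)); congr H1on; apply/funext => x; rewrite mulN1r. Qed.

Lemma locL2_opp o f : locL2 o f -> locL2 o (\- f).
Proof. by move/(locL2Z (-1)); congr locL2; apply/funext => x; rewrite mulN1r. Qed.

Lemma cvg0_add (T : Type) (Fl : set_system T) (FF : Filter Fl) (f g h : T -> R) :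
  f x @[x --> Fl] --> (0 : R) -> g x @[x --> Fl] --> (0 : R) ->
  (\forall x \near Fl, f x + g x = h x) -> h x @[x --> Fl] --> (0 : R).
Proof.
move=> fc gc E; have fg := @cvgD _ _ _ Fl FF f g 0 0 fc gc.
rewrite addr0 in fg; apply: cvg_trans fg.
by apply: near_eq_cvg; apply: filterS E.
Qed.

Lemma curve_L2_continuous f g b b' t : locL2 (-1) f -> locL2 (-1) g -> H1on 0 b b' ->
  0 <= t ->
  L2norm (curve f g b s \- curve f g b t) ^+ 2 @[s --> near_time t] --> (0 : R).
Proof.
move=> fL gL bH t0; apply/cvg_within_nbhsP => e e0.
have [d d0 h] := curve_continuous q fL gL bH t0 e0; exists d => // s s0 sd.
by rewrite subr0 sqr_L2norm ger0_norm ?ip_ge0//; exact: h.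
Qed.

Lemma curve_H1_continuous f f' g g' b b' t :
  H1on (-1) f f' -> H1on (-1) g g' -> H1on 0 b b' -> 0 <= t ->
  H1norm (curve f g b s \- curve f g b t) ^+ 2 @[s --> near_time t] --> (0 : R).
Proof.
move=> ff gg bH t0; have [_ fL _] := ff; have [_ gL _] := gg.
apply: cvg0_add (curve_L2_continuous (H1on_locL2 ff) (H1on_locL2 gg) bH t0)
  (curve_L2_continuous fL (locL2_opp gL) (H1onZ q bH) t0) _.
near=> s; have s0 : 0 <= s by near: s; exact: withinT.
have dH := H1derivB (curve_H1deriv q b ff gg s0) (curve_H1deriv q b ff gg t0).
by rewrite (H1norm_sqr dH) -!sqr_L2norm.
Unshelve. all: by end_near. Qed.

Lemma curve_L2_derivative F f G g B b b' t :
  H1on (-1) F f -> H1on (-1) G g -> H1on 0 B b -> H1on 0 b b' -> 0 <= t ->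
  L2norm (((s - t)^-1 \*o (curve F G B s \- curve F G B t)) \- curve f g b t) ^+ 2
    @[s --> near_time' t] --> (0 : R).
Proof.
move=> FH GH BH bH t0; apply/cvg_within_dnbhsP => e e0.
have [d d0 h] := curve_derivative q FH GH BH bH t0 e0; exists d => // s s0 st sd.
by rewrite subr0 sqr_L2norm ger0_norm ?ip_ge0//; exact: h.
Qed.

Lemma curve_H1_derivative F f f' G g g' B b b' t :
  H1on (-1) F f -> H1on (-1) f f' -> H1on (-1) G g -> H1on (-1) g g' ->
  H1on 0 B b -> H1on 0 b b' -> 0 <= t ->
  H1norm (((s - t)^-1 \*o (curve F G B s \- curve F G B t)) \- curve f g b t) ^+ 2
    @[s --> near_time' t] --> (0 : R).
Proof.
move=> FH ff GH gg BH bH t0.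
apply: cvg0_add (curve_L2_derivative FH GH BH bH t0)
  (curve_L2_derivative ff (H1on_opp gg) (H1onZ q BH) (H1onZ q bH) t0) _.
near=> s; have s0 : 0 <= s by near: s; exact: withinT.
have := H1derivB (H1derivZ (s - t)^-1 (H1derivB (curve_H1deriv q B FH GH s0) (curve_H1deriv q B FH GH t0)))
  (curve_H1deriv q b ff gg t0).
by move/H1norm_sqr => ->; rewrite -!sqr_L2norm.
Unshelve. all: by end_near. Qed.

(** Velocities use the derivatives of the profiles. Y is a single right-moving profile, and only w
    carries the exponential term. *)
Definition trajectory fe fe' ge ge' y fz fz' gz gz' fw fw' gw gw' b b' t : state R :=
  State (curve fe ge (cst 0) t) (curve fe' ge' (cst 0) t) (curve (cst 0) y (cst 0) t)
    (curve fz gz (cst 0) t) (curve fz' gz' (cst 0) t)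
    (curve fw gw b t) (curve fw' gw' b' t).

Lemma Xdist_cvg (T : Type) (Fl : set_system T) (FF : Filter Fl) (U : T -> state R) (W : state R) :
  H1norm (s_eps (U s) \- s_eps W) ^+ 2 @[s --> Fl] --> (0 : R) ->
  L2norm (s_epst (U s) \- s_epst W) ^+ 2 @[s --> Fl] --> (0 : R) ->
  H1norm (s_Y (U s) \- s_Y W) ^+ 2 @[s --> Fl] --> (0 : R) ->
  H1norm (s_z (U s) \- s_z W) ^+ 2 @[s --> Fl] --> (0 : R) ->
  L2norm (s_zt (U s) \- s_zt W) ^+ 2 @[s --> Fl] --> (0 : R) ->
  H1norm (s_w (U s) \- s_w W) ^+ 2 @[s --> Fl] --> (0 : R) ->
  L2norm (s_wt (U s) \- s_wt W) ^+ 2 @[s --> Fl] --> (0 : R) ->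
  Xdist (U s) W @[s --> Fl] --> (0 : R).
Proof.
move=> h1 h2 h3 h4 h5 h6 h7.
have s0 (f g : T -> R) : f x @[x --> Fl] --> (0 : R) -> g x @[x --> Fl] --> (0 : R) ->
    (f x + g x) @[x --> Fl] --> (0 : R) by move=> fc gc; apply: cvg0_add fc gc _; exact: nearW.
have h := s0 _ _ (s0 _ _ (s0 _ _ (s0 _ _ (s0 _ _ (s0 _ _ h1 h2) h3) h4) h5) h6) h7.
rewrite -(@sqrtr0 R).
exact: (continuous_cvg _ (@sqrt_continuous R 0) h).
Qed.

Lemma curve0_H1on o : H1on o (cst 0 : R -> R) (cst 0). Proof. exact: H1on_cst. Qed.

Section fields.
Variables (Fe fe fe' Ge ge ge' Yp y y' Fz fz fz' Gz gz gz' Fw fw fw' Gw gw gw' B b b' b'' : R -> R).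
Hypotheses (FeH : H1on (-1) Fe fe) (feH : H1on (-1) fe fe') (GeH : H1on (-1) Ge ge)
  (geH : H1on (-1) ge ge') (YpH : H1on (-1) Yp y) (yH : H1on (-1) y y')
  (FzH : H1on (-1) Fz fz) (fzH : H1on (-1) fz fz') (GzH : H1on (-1) Gz gz)
  (gzH : H1on (-1) gz gz') (FwH : H1on (-1) Fw fw) (fwH : H1on (-1) fw fw')
  (GwH : H1on (-1) Gw gw) (gwH : H1on (-1) gw gw')
  (BH : H1on 0 B b) (bH : H1on 0 b b') (b'H : H1on 0 b' b'').

Let z1 := curve0_H1on (-1).
Let z0 := curve0_H1on 0.
Let U := trajectory fe fe' ge ge' y fz fz' gz gz' fw fw' gw gw' b b'.
Let W := trajectory Fe fe Ge ge Yp Fz fz Gz gz Fw fw Gw gw B b.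

Lemma trajectory_inX t : 0 <= t -> curve fz gz (cst 0) t 1 = 0 -> inX (U t).
Proof.
move=> t0 z1t; have [_ feL _] := feH; have [_ geL _] := geH; have [_ fzL _] := fzH.
have [_ gzL _] := gzH; have [_ fwL _] := fwH; have [_ gwL _] := gwH.
split.
- by split; [eexists; exact: (curve_H1deriv q (cst 0) feH geH t0)|exact: curve_L2].
- by eexists; exact: (curve_H1deriv q (cst 0) z1 yH t0).
- split; last exact: curve_L2.
  by split => //; eexists; exact: (curve_H1deriv q (cst 0) fzH gzH t0).
- by split; [eexists; exact: (curve_H1deriv q b fwH gwH t0)|exact: curve_L2].
Qed.

Lemma trajectory_continuous : (forall t, 0 <= t -> curve fz gz (cst 0) t 1 = 0) ->
  Xcontinuous U.
Proof.
move=> zt1 t t0; split; first exact: trajectory_inX (zt1 t t0).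
have [_ feL _] := feH; have [_ geL _] := geH; have [_ fzL _] := fzH.
have [_ gzL _] := gzH; have [_ fwL _] := fwH; have [_ gwL _] := gwH.
apply: Xdist_cvg.
- exact: (curve_H1_continuous feH geH z0 t0).
- exact: (curve_L2_continuous feL geL z0 t0).
- exact: (curve_H1_continuous z1 yH z0 t0).
- exact: (curve_H1_continuous fzH gzH z0 t0).
- exact: (curve_L2_continuous fzL gzL z0 t0).
- exact: (curve_H1_continuous fwH gwH bH t0).
- exact: (curve_L2_continuous fwL gwL b'H t0).
Qed.

(** Time differentiation acts on the profiles alone, so antiderivatives of the profiles give an
    antiderivative in X; subtracting [W 0] makes it start at 0. The assumption keeps its z-component
    in the space of functions vanishing at 1. *)
Lemma trajectory_primitive :
  (forall t, 0 <= t -> curve Fz Gz (cst 0) t 1 = curve Fz Gz (cst 0) 0 1) ->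
  Xprimitive U (fun t => sub_state (W t) (W 0)).
Proof.
move=> zt1; have [_ feL _] := FeH; have [_ geL _] := GeH; have [_ fzL _] := FzH.
have [_ gzL _] := GzH; have [_ fwL _] := FwH; have [_ gwL _] := GwH.
have e0 : 0 <= 0 :> R by [].
have VX t : 0 <= t -> inX (sub_state (W t) (W 0)).
  move=> t0; split.
  + split; last exact: L2B (curve_L2 q _ feL geL t0) (curve_L2 q _ feL geL e0).
    by eexists; exact: H1derivB (curve_H1deriv q (cst 0) FeH GeH t0) (curve_H1deriv q (cst 0) FeH GeH e0).
  + by eexists; exact: H1derivB (curve_H1deriv q (cst 0) z1 YpH t0) (curve_H1deriv q (cst 0) z1 YpH e0).
  + split; last exact: L2B (curve_L2 q _ fzL gzL t0) (curve_L2 q _ fzL gzL e0).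
    split; last by rewrite /= zt1 ?subrr.
    by eexists; exact: H1derivB (curve_H1deriv q (cst 0) FzH GzH t0) (curve_H1deriv q (cst 0) FzH GzH e0).
  + split; last exact: L2B (curve_L2 q _ fwL gwL t0) (curve_L2 q _ fwL gwL e0).
    by eexists; exact: H1derivB (curve_H1deriv q B FwH GwH t0) (curve_H1deriv q B FwH GwH e0).
split=> //.
- rewrite (_ : sub_state _ _ = scale_state 0 (sub_state (W 0) (W 0))); last first.
    by congr State; apply/funext => x /=; rewrite subrr mul0r.
  by rewrite Xnorm_scale_abs ?normr0 ?mul0r//; exact: VX.
- move=> t t0.
  have -> : (fun s => Xdist (scale_state (s - t)^-1
      (sub_state (sub_state (W s) (W 0)) (sub_state (W t) (W 0)))) (U t)) =
     (fun s => Xdist (scale_state (s - t)^-1 (sub_state (W s) (W t))) (U t)).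
    by apply/funext => s; rewrite sub_state_cancel.
  apply: Xdist_cvg.
  + exact: (curve_H1_derivative FeH feH GeH geH z0 z0 t0).
  + exact: (curve_L2_derivative feH geH z0 z0 t0).
  + exact: (curve_H1_derivative z1 z1 YpH yH z0 z0 t0).
  + exact: (curve_H1_derivative FzH fzH GzH gzH z0 z0 t0).
  + exact: (curve_L2_derivative fzH gzH z0 z0 t0).
  + exact: (curve_H1_derivative FwH fwH GwH gwH BH bH t0).
  + exact: (curve_L2_derivative fwH gwH bH b'H t0).
Qed.
End fields.
End trajectory.

(** * One wave with prescribed initial data *)

Section wave.
Variable R : realType.
Local Notation mu := (@lebesgue_measure R).
Implicit Types (o t : R) (f g p r u v w : R -> R).

Lemma zext_in u x : 0 < x < 1 -> zext u x = u x.
Proof.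
by move=> x01; rewrite /zext/= indicE mem_set ?mulr1.
Qed.

Lemma locL2_zext o u : L2 u -> locL2 o (zext u).
Proof.
move=> uL; have h := Lfun2_integrable_sqr uL; have [mu_ _] := (L2E u).1 uL.
split; first by rewrite zext_restrict; exact/(measurable_restrictT _ _).1.
move=> b; have mE : measurable (`]o, b[%classic : set R) by exact: measurable_itv.
exact: (@integrableS _ _ R mu setT _ _ measurableT mE (fun _ _ => I) h).
Qed.

Lemma locL2_neg o u : L2 u -> locL2 o (fun x => zext u (- x)).
Proof.
move=> uL; have [mz zi] := locL2_zext (-1) uL; split.
  apply: measurableT_comp => //; exact: oppr_measurable.
move=> b; have := @integrable_reflect R 0 o b (fun x => zext u x ^+ 2).
rewrite (_ : (fun x => zext u (0 - x) ^+ 2) = fun x => zext u (- x) ^+ 2); last first.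
  by apply/funext => x; rewrite sub0r.
apply; first exact: measurable_funX.
by have [_] := locL2_zext (0 - b) uL; apply.
Qed.

Lemma zext_neg_int u x : L2 u -> 0 <= x <= 1 ->
  \int[mu]_(y in `](- x), 0[) zext u (- y) = \int[mu]_(y in `]0, x[) u y.
Proof.
move=> uL /andP[x0 x1]; have [mz _] := locL2_zext 0 uL.
have := @Rintegral_reflect R 0 (- x) 0 (zext u) mz.
rewrite subr0 sub0r opprK => h.
have := prim_zext u x1; rewrite /prim => <-; rewrite -h.
by apply: eq_Rintegral => y _; rewrite sub0r.
Qed.

Variables (k0 k1 k2 c : R) (u0 u0' u1 r eta eta' xi xi' : R -> R).
Hypotheses (u0H : H1deriv u0 u0') (u1L : L2 u1) (rL : locL2 (-1) r).
Hypotheses (etaH : H1on 0 eta eta') (eta0 : eta 0 = 0).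
Hypotheses (xiH : H1on 0 xi xi') (xi0 : xi 0 = 0).

(* d'Alembert: at t = 0, f(x) + g(-x) = u0(x) and f'(x) + g'(-x) = u1(x); on
   (-1,0) the function f is free and r prescribes f' + g' there. *)
Lemma wave_exists : exists F f f' G g g', [/\
  [/\ H1on (-1) F f, H1on (-1) f f', H1on (-1) G g & H1on (-1) g g'],
  (forall x, 0 <= x <= 1 -> f x + g (- x) = u0 x) /\
    (forall x, 0 < x < 1 -> f' x + g' (- x) = u1 x),
  (forall x, x <= 0 -> f' x + g' x = r x),
  (forall t, 0 <= t -> k0 * f t - g t =
     k0 * f 0 - g 0 + c * (F t - F 0 + (G t - G 0)) + eta t) &
  forall t, 0 <= t ->
    f (1 + t) - f 1 = k1 * (g (-1 + t) - g (-1)) + k2 * (f (-1 + t) - f (-1)) + xi t].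
Proof.
have [u0'L u0E] := u0H.
(* On (0,1), f'(x) + g'(-x) is the initial velocity and f'(x) - g'(-x) the derivative of the initial
   position; solving for the two gives the halves. *)
pose g0 x := 2^-1 * (zext u1 (- x) - zext u0' (- x)).
pose f0 x := if x <= 0 then r x - g0 x else 2^-1 * (zext u0' x + zext u1 x).
have g0L : locL2 (-1) g0 by apply: locL2Z; apply: locL2B; exact: locL2_neg.
have f0L : locL2 (-1) f0.
  apply: locL2_if; first exact: locL2B.
  by apply: locL2Z; apply: locL2D; exact: locL2_zext.
(* The values at -1 are chosen so that f and g both equal half of [u0 0] at 0. *)
pose phi := 2^-1 * u0 0 - \int[mu]_(y in `]-1, 0[) f0 y.
pose gam := 2^-1 * u0 0 - \int[mu]_(y in `]-1, 0[) g0 y.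
have [f [f' [g [g' [a [[fH gH f1 g1] [fE gE] [aH a0 bc0] bc1]]]]]] :=
  delay_system k0 k1 k2 c phi gam f0L g0L etaH eta0 xiH xi0.
have m1 : -1 <= 0 :> R by lra.
have f00 : f 0 = 2^-1 * u0 0.
  have := H1on_diff fH (lexx _) m1; rewrite (@locL2_le_eq _ _ _ f' f0); last first.
    by move=> t t0; apply: fE; lra.
  by rewrite f1 /phi => /(canRL (subrK _)) ->; rewrite addrC subrK.
have g00 : g 0 = 2^-1 * u0 0.
  have := H1on_diff gH (lexx _) m1; rewrite (@locL2_le_eq _ _ _ g' g0)//.
  by rewrite g1 /gam => /(canRL (subrK _)) ->; rewrite addrC subrK.
have [_ fL _] := fH; have [_ gL _] := gH.
pose F x := 0 + \int[mu]_(y in `]-1, x[) f y.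
pose G x := 0 + \int[mu]_(y in `]-1, x[) g y.
have FH : H1on (-1) F f := H1on_prim 0 (H1on_locL2 fH).
have GH : H1on (-1) G g := H1on_prim 0 (H1on_locL2 gH).
have aE t : 0 <= t -> a t = F t - F 0 + (G t - G 0).
  move=> t0; have := H1on_diff aH (lexx 0) t0.
  rewrite a0 subr0 => ->.
  have FG := H1onD (H1on_base m1 FH) (H1on_base m1 GH).
  by rewrite -(H1on_diff FG (lexx 0) t0); ring.
exists F, f, f', G, g, g'; split => //.
- split=> x; last first.
    move=> x01; have /andP[x0 x1] := x01.
    rewrite gE; last by lra.
    rewrite fE ?ltW// /f0 /g0 leNgt x0/= opprK !zext_in//.
    by field.
  move=> x01; have /andP[x0 x1] := x01.
  have xm1 : -1 <= - x by lra.
  have xm0 : - x <= 0 by lra.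
  have hf := H1on_diff fH m1 x0; have hg := H1on_diff gH xm1 xm0.
  have u0'i := L2_integrableS u0'L x1; have u1i := L2_integrableS u1L x1.
  have hfE : \int[mu]_(y in `]0, x[) f' y =
      2^-1 * (\int[mu]_(y in `]0, x[) u0' y + \int[mu]_(y in `]0, x[) u1 y).
    rewrite -RintegralD// -RintegralZl//; last exact: integrable_addR.
    apply: eq_Rintegral => y; rewrite inE/= in_itv/= => /andP[y0 yx].
    rewrite fE; last by lra.
    have y01 : 0 < y < 1 by rewrite y0 (lt_le_trans yx).
    by rewrite /f0 leNgt y0/= !zext_in.
  have hgE : \int[mu]_(y in `](- x), 0[) g' y =
      2^-1 * (\int[mu]_(y in `]0, x[) u1 y - \int[mu]_(y in `]0, x[) u0' y).
    rewrite -(zext_neg_int u1L x01) -(zext_neg_int u0'L x01).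
    have i1 := locL2_integrable 0 (locL2_neg (- x) u1L).
    have i0 := locL2_integrable 0 (locL2_neg (- x) u0'L).
    rewrite -RintegralB// -RintegralZl//; last exact: integrable_subR.
    by apply: eq_Rintegral => y; rewrite inE/= in_itv/= => /andP[_ y0]; apply: gE; exact: ltW.
  rewrite u0E// -{1}[f x](subrK (f 0)) hf hfE f00.
  rewrite -[g (- x)](subKr (g 0)) hg hgE g00.
  by set A := Rintegral _ _ _; set B := Rintegral _ _ _; field.
- by move=> x x0; rewrite fE ?gE// /f0 ?x0; [ring|lra].
- by move=> t t0; rewrite -aE// bc0.
Qed.
End wave.

(** * Existence for the full system *)

Section existence.
Variables (R : realType) (q c0 c1 c2 c3 : R).
Hypotheses (c0_bounds : 0 < c0 < 1) (c3_gt0 : 0 < c3).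
Local Notation mu := (@lebesgue_measure R).
Local Notation cv := (curve q).
Local Notation op := (system_op q c0 c1 c2 c3).
Implicit Types (t : R) (f g b u v : R -> R).

Lemma curve_at0 f g b t : cv f g b t 0 = f t + g t + b t.
Proof. by rewrite /curve addr0 subr0 mulr0 expR0 mulr1. Qed.

Lemma curve_at1 f g b t : cv f g b t 1 = f (t + 1) + g (t - 1) + b t * expR q.
Proof. by rewrite /curve mulr1. Qed.

Section operator.
Variables (Fe fe fe' Ge ge ge' Fz fz fz' Gz gz gz' Fw fw fw' Gw gw gw' B b b' : R -> R).
Hypotheses (FeH : H1on (-1) Fe fe) (feH : H1on (-1) fe fe') (GeH : H1on (-1) Ge ge)
  (geH : H1on (-1) ge ge')
  (FzH : H1on (-1) Fz fz) (fzH : H1on (-1) fz fz') (GzH : H1on (-1) Gz gz)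
  (gzH : H1on (-1) gz gz') (FwH : H1on (-1) Fw fw) (fwH : H1on (-1) fw fw')
  (GwH : H1on (-1) Gw gw) (gwH : H1on (-1) gw gw').
Let Yp x := - c0 * (Fe x + Ge x).
Let y x := - c0 * (fe x + ge x).
Let y' x := - c0 * (fe' x + ge' x).
Let a F G t : R := F t - F 0 + (G t - G 0).
Let U := trajectory q fe fe' ge ge' y fz fz' gz gz' fw fw' gw gw' b b'.
Let W := trajectory q Fe fe Ge ge Yp Fz fz Gz gz Fw fw Gw gw B b.

(** The assumptions are the boundary conditions integrated over (0,t) and rewritten for the
    profiles. They are therefore statements about [W t - W 0] and [U t - U 0], the pair that the
    mild formulation puts into the operator. *)
Lemma trajectory_op t : 0 <= t -> B 0 = 0 -> b 0 = 0 -> b' 0 = 0 ->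
  b' t = q ^+ 2 * B t - (c1 + q) * (c2 + q) * a Fe Ge t ->
  (1 - 2 * c0) * fz t - gz t = (1 - 2 * c0) * fz 0 - gz 0 + c1 * a Fz Gz t ->
  Fz (t + 1) - Fz 1 + (Gz (t - 1) - Gz (-1)) = 0 ->
  fe t - ge t = fe 0 - ge 0 + c1 * a Fe Ge t ->
  fe (t + 1) - fe 1 = (1 - c0) * (ge (t - 1) - ge (-1)) - c0 * (fe (t - 1) - fe (-1))
    - (fz (t + 1) - fz 1) + (gz (t - 1) - gz (-1)) ->
  fw t - gw t = fw 0 - gw 0 + c2 * a Fw Gw t + (c2 - q) * B t + (c1 + q) * a Fe Ge t ->
  (1 + c3) * (fw (t + 1) - fw 1) = (1 - c3) * (gw (t - 1) - gw (-1))
    - q * expR q * B t - c3 * expR q * b t ->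
  op (sub_state (W t) (W 0)) (sub_state (U t) (U 0)).
Proof.
move=> t0 B0 b0 b'0 b'E z_at0 z_at1 e_at0 e_at1 w_at0 w_at1.
have e0 : 0 <= 0 :> R by [].
have zz := @curve0_H1on R (-1).
have YpH : H1on (-1) Yp y := H1onZ (- c0) (H1onD FeH GeH).
have yH : H1on (-1) y y' := H1onZ (- c0) (H1onD feH geH).
have d1 F f G g bb : H1on (-1) F f -> H1on (-1) G g ->
    H1deriv (cv F G bb t \- cv F G bb 0)
      (cv f (\- g) (q \*o bb) t \- cv f (\- g) (q \*o bb) 0).
  move=> FH GH; exact: H1derivB (curve_H1deriv q bb FH GH t0) (curve_H1deriv q bb FH GH e0).
exists (cv fz (\- gz) (q \*o cst 0) t \- cv fz (\- gz) (q \*o cst 0) 0).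
exists (cv fz' (\- \- gz') (q \*o (q \*o cst 0)) t \- cv fz' (\- \- gz') (q \*o (q \*o cst 0)) 0).
exists (cv fe (\- ge) (q \*o cst 0) t \- cv fe (\- ge) (q \*o cst 0) 0).
exists (cv fe' (\- \- ge') (q \*o (q \*o cst 0)) t \- cv fe' (\- \- ge') (q \*o (q \*o cst 0)) 0).
exists (cv (cst 0) (\- y) (q \*o cst 0) t \- cv (cst 0) (\- y) (q \*o cst 0) 0).
exists (cv fw (\- gw) (q \*o B) t \- cv fw (\- gw) (q \*o B) 0).
exists (cv fw' (\- \- gw') (q \*o (q \*o B)) t \- cv fw' (\- \- gw') (q \*o (q \*o B)) 0).
have c01 : 1 - c0 != 0 by case/andP: c0_bounds => _ ?; rewrite gt_eqF// subr_gt0.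
split.
- split.
  + by split; [exact: (d1 _ _ _ _ _ FzH GzH)|exact: (d1 _ _ _ _ _ fzH (H1on_opp gzH))].
  + split; first exact: eq_ae01_refl.
    by apply/aeW => x _; rewrite /U /= /curve/=; ring.
  + rewrite /U /W /= !curve_at0 /=.
    have -> : c1 / (1 - c0) * (Fz t + Gz t + 0 - (Fz 0 + Gz 0 + 0)) +
      c0 / (1 - c0) * (fz t + gz t + 0 - (fz 0 + gz 0 + 0)) =
      (c1 * a Fz Gz t + c0 * (fz t + gz t - (fz 0 + gz 0))) / (1 - c0) by rewrite /a; ring.
    apply: (canRL (mulfK c01)).
    move: z_at0; rewrite /a; lra.
  + by rewrite /W /= !curve_at1 /= add0r sub0r -z_at1; ring.
- split.
  + by split; [exact: (d1 _ _ _ _ _ FeH GeH)|exact: (d1 _ _ _ _ _ feH (H1on_opp geH))].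
  + split; first exact: eq_ae01_refl.
    by apply/aeW => x _; rewrite /U /= /curve/=; ring.
  + rewrite /W /= !curve_at0 /=.
    by move: e_at0; rewrite /a; lra.
  + rewrite /W /= !curve_at1 /=.
    by move: e_at1; rewrite /y add0r sub0r; lra.
- split.
  + by split; [exact: (d1 _ _ _ _ _ zz YpH)|eexists; exact: (d1 _ _ _ _ _ zz (H1on_opp yH))].
  + by apply/aeW => x _; rewrite /U /= /curve/=; ring.
  + by rewrite /W /= !curve_at0 /= /Yp; ring.
- split.
  + by split; [exact: (d1 _ _ _ _ _ FwH GwH)|exact: (d1 _ _ _ _ _ fwH (H1on_opp gwH))].
  + split; first exact: eq_ae01_refl.
    apply/aeW => x _; rewrite /U /W /= curve_at0 curve_at0 /curve/= b'E b'0 B0 /a; ring.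
  + rewrite /W /= !curve_at0 /= B0.
    by move: w_at0; rewrite /a; lra.
  + rewrite /W /U /= !curve_at1 /= B0 b0 add0r sub0r.
    by move: w_at1; lra.
Qed.
End operator.

Lemma H1norm_eq0 u : (forall x, 0 <= x <= 1 -> u x = 0) -> H1norm u ^+ 2 = 0.
Proof.
move=> u0; have uH : H1deriv u (cst 0).
  by apply: H1deriv_ext (H1deriv_affine 0 0) => x x01; rewrite u0//; ring.
rewrite (H1norm_sqr uH) (L2_ae0 (H1deriv_L2 uH)).
  by rewrite (L2_ae0 (L2_cst 0) (eq_ae01_refl _)) addr0.
by apply/aeW => x /=; rewrite in_itv/= => /andP[x0 x1]; apply: u0; rewrite !ltW.
Qed.

Lemma L2norm_eq0 u : (forall x, 0 < x < 1 -> u x = 0) -> L2norm u ^+ 2 = 0.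
Proof.
move=> u0; rewrite sqr_L2norm L2_ae0//; last first.
  by apply/aeW => x /=; rewrite in_itv/=; exact: u0.
by apply: L2_ext (L2_cst 0) => x; rewrite inE/= in_itv/= => /u0.
Qed.

(* b'' = q^2 b - C e with e = a', factored as (d/dt - q)(d/dt + q) b = - C e. *)
Lemma forced_oscillation (C : R) a e : H1on 0 a e -> a 0 = 0 ->
  exists B b b' b'', [/\ [/\ H1on 0 B b, H1on 0 b b' & H1on 0 b' b''],
    [/\ B 0 = 0, b 0 = 0 & b' 0 = 0] &
    forall t, 0 <= t -> b' t = q ^+ 2 * B t - C * a t].
Proof.
move=> aH a0; have [_ eL _] := aH.
pose n := duhamel (- q) (fun t => - C * e t).
have nH := H1on_duhamel (- q) (locL2Z (- C) eL); rewrite -/n in nH.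
pose b := duhamel q n.
have bH := H1on_duhamel q (H1on_locL2 nH); rewrite -/b in bH.
pose b' t := - q * b t + n t.
have b'H := H1onD (H1onZ (- q) bH) nH; rewrite -/b' in b'H.
pose B t := 0 + \int[mu]_(y in `]0, t[) b y.
have BH : H1on 0 B b := H1on_prim 0 (H1on_locL2 bH).
have B0 : B 0 = 0 by rewrite /B set_itvoo0 Rintegral_set0 addr0.
have b0 : b 0 = 0 by exact: duhamel0.
have n0 : n 0 = 0 by exact: duhamel0.
have b'0 : b' 0 = 0 by rewrite /b' b0 n0 mulr0 addr0.
exists B, b, b'; eexists; split; [split; [exact: BH|exact: bH|exact: b'H]|by []|move=> t t0].
have h1 := H1on_diff b'H (lexx 0) t0.
have h2 := H1on_diff (H1onB (H1onZ (q ^+ 2) BH) (H1onZ C aH)) (lexx 0) t0.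
move: h1 h2; rewrite b'0 B0 a0 !mulr0 !subr0 => -> ->.
by apply: eq_Rintegral => y _; ring.
Qed.

(** The cascade is solved in order: z is autonomous, its trace z_x(1) forces eps, and the trace
    eps(0) forces w. *)
Lemma mild_solution_exists (U0 : state R) : inX U0 -> s_Y U0 0 = - c0 * s_eps U0 0 ->
  exists U, mild_solution q c0 c1 c2 c3 U0 U.
Proof.
case=> [[[e' eH] etL] [Y' YH] [[[z' zH] z1] ztL] [[w' wH] wtL]] compat0.
have /andP[c0_gt0 c0_lt1] := c0_bounds.
have m1 : -1 <= 0 :> R by lra.
have zero0 := @curve0_H1on R 0.
(* Multiplying the condition at 0 by 1 - c0 gives (1 - 2 c0) f' - g' = c1 (f + g); the Dirichlet
   condition at 1 reflects with factor -1. *)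
have [Fz [fz [fz' [Gz [gz [gz' [[FzH fzH GzH gzH] [z_init zt_init] _ z_at0 z_at1]]]]]]] :=
  wave_exists (1 - 2 * c0) (-1) 0 c1 zH ztL (locL2_cst _ 0) zero0 erefl zero0 erefl.
have [Y'L Y'E] := YH.
(* Minus the increment of f(1+t) - g(t-1) for z, that is, minus the time integral of z_x(1). *)
pose xe t := fz 1 - gz (-1) - (fz (1 + t) - gz (-1 + t)).
pose xe' t := 0 - (fz' (1 + t) - gz' (-1 + t)).
have xeH : H1on 0 xe xe'.
  apply: H1onB (H1on_cst 0 _) (H1onB _ _); apply: H1on_time_shift.
    by apply: H1on_base fzH; lra.
  by rewrite addr0.
have xe0 : xe 0 = 0 by rewrite /xe !addr0 subrr.
(* With Y(x,t) = - c0 (f + g)(t - x), the datum Y_0 prescribes f' + g' on (-1,0); the minus sign of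
   the reflection cancels that of - c0. *)
have rL : locL2 (-1) (fun x => c0^-1 * zext Y' (- x)) by apply: locL2Z; exact: locL2_neg.
(* Inserting this form of Y into the condition at 1 gives f'(1+t) = (1 - c0) g'(t-1) - c0 f'(t-1) -
   z_x(1,t). *)
have [Fe [fe [fe' [Ge [ge [ge' [[FeH feH GeH geH] [e_init et_init] e_hist e_at0 e_at1]]]]]]] :=
  wave_exists 1 (1 - c0) (- c0) c1 eH etL rL zero0 erefl xeH xe0.
pose C := (c1 + q) * (c2 + q).
pose a t := Fe t - Fe 0 + (Ge t - Ge 0).
have aH : H1on 0 a (fun t => (fe t - 0) + (ge t - 0)).
  by apply: H1onD; apply: H1onB (H1on_cst 0 _); exact: H1on_base m1 _.
have a0 : a 0 = 0 by rewrite /a !subrr addr0.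
have [B [b [b' [b'' [[BH bH b'H] [B0 b0 b'0] b'E]]]]] := forced_oscillation C aH a0.
(* The exponential term adds q b to w_x(0) and b to w(0); together with the trace of eps this is the
   forcing at 0, integrated in time. *)
pose ew t := (c2 - q) * B t + (c1 + q) * a t.
have ewH := H1onD (H1onZ (c2 - q) BH) (H1onZ (c1 + q) aH).
have ew0 : ew 0 = 0 by rewrite /ew B0 a0 !mulr0 addr0.
(* At 1 the exponential term contributes q e^q b to w_x and e^q b' to w_t; integrated, these become
   multiples of [B] and [b]. Solving for the incoming f gives the factor [(1 + c3)^-1]. *)
pose xw t := (1 + c3)^-1 * (- (q * expR q) * B t + - (c3 * expR q) * b t).
have xwH := H1onZ (1 + c3)^-1 (H1onD (H1onZ (- (q * expR q)) BH) (H1onZ (- (c3 * expR q)) bH)).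
have xw0 : xw 0 = 0 by rewrite /xw B0 b0 !mulr0 addr0 mulr0.
have [Fw [fw [fw' [Gw [gw [gw' [[FwH fwH GwH gwH] [w_init wt_init] _ w_at0 w_at1]]]]]]] :=
  wave_exists 1 ((1 - c3) / (1 + c3)) 0 c2 wH wtL (locL2_cst _ 0) ewH ew0 xwH xw0.
pose y x := - c0 * (fe x + ge x); pose y' x := - c0 * (fe' x + ge' x).
have yH : H1on (-1) y y' := H1onZ (- c0) (H1onD feH geH).
pose Yp x := - c0 * (Fe x + Ge x).
have YpH : H1on (-1) Yp y := H1onZ (- c0) (H1onD FeH GeH).
have z_sum t : 0 <= t -> fz (t + 1) + gz (t - 1) = 0.
  move=> t0; have := z_at1 t t0; rewrite mul0r /= !addr0 (addrC 1) (addrC (-1)).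
  by have := z_init 1; rewrite ler01 lexx z1 => /(_ isT); lra.
have z_int t : 0 <= t -> Fz (t + 1) - Fz 1 + (Gz (t - 1) - Gz (-1)) = 0.
  move=> t0; have F1 : H1on 0 (fun x => Fz (1 + x)) (fun x => fz (1 + x)).
    by apply: H1on_time_shift; apply: H1on_base FzH; lra.
  have G1 : H1on 0 (fun x => Gz (-1 + x)) (fun x => gz (-1 + x)).
    by apply: H1on_time_shift; rewrite addr0.
  have := H1on_diff (H1onD F1 G1) (lexx 0) t0; rewrite !addr0 (addrC 1) (addrC (-1)).
  rewrite (_ : \int[mu]_(y in `]0, t[) _ = \int[mu]_(y in `]0, t[) 0); last first.
    apply: eq_Rintegral => s; rewrite inE/= in_itv/= => /andP[s0 _].
    by rewrite (addrC 1) (addrC (-1)) z_sum// ltW.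
  by rewrite Rintegral_cst// mul0r; lra.
(* [e_hist] matches the derivatives on (-1,0), and the compatibility condition of the data matches
   the values at 0. *)
have Y_init x : 0 <= x <= 1 -> y (- x) = s_Y U0 x.
  move=> x01; have /andP[x0 x1] := x01.
  have xm1 : -1 <= - x by lra.
  have xm0 : - x <= 0 by lra.
  have := H1on_diff yH xm1 xm0.
  have -> : \int[mu]_(s in `](- x), 0[) y' s = - \int[mu]_(s in `]0, x[) Y' s.
    rewrite -(zext_neg_int Y'L x01) -[RHS]mulN1r -RintegralZl//; last first.
      exact: locL2_integrable (locL2_neg _ Y'L).
    apply: eq_Rintegral => s; rewrite inE/= in_itv/= => /andP[_ s0].
    by rewrite /y' e_hist ?ltW// mulrA mulNr divff ?gt_eqF.
  have := Y'E x x01; have := e_init 0; rewrite oppr0 lexx ler01 => /(_ isT).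
  by rewrite /y compat0 => ->; lra.
pose U := trajectory q fe fe' ge ge' y fz fz' gz gz' fw fw' gw gw' b b'.
pose W := trajectory q Fe fe Ge ge Yp Fz fz Gz gz Fw fw Gw gw B b.
exists U; split.
- apply: (trajectory_continuous feH geH yH fzH gzH fwH gwH bH b'H) => t t0.
  by rewrite curve_at1 z_sum//= mul0r addr0.
- rewrite /Xdist /Xnorm /sub_state/= H1norm_eq0; last first.
    by move=> x x01; rewrite /curve /= add0r sub0r mul0r addr0 e_init// subrr.
  rewrite L2norm_eq0; last first.
    by move=> x x01; rewrite /curve /= add0r sub0r mul0r addr0 et_init// subrr.
  rewrite H1norm_eq0; last first.
    by move=> x x01; rewrite /curve /= sub0r add0r mul0r addr0 Y_init// subrr.
  rewrite H1norm_eq0; last first.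
    by move=> x x01; rewrite /curve /= add0r sub0r mul0r addr0 z_init// subrr.
  rewrite L2norm_eq0; last first.
    by move=> x x01; rewrite /curve /= add0r sub0r mul0r addr0 zt_init// subrr.
  rewrite H1norm_eq0; last first.
    by move=> x x01; rewrite /curve /= add0r sub0r b0 mul0r addr0 w_init// subrr.
  rewrite L2norm_eq0; last first.
    by move=> x x01; rewrite /curve /= add0r sub0r b'0 mul0r addr0 wt_init// subrr.
  by rewrite !addr0 sqrtr0.
exists (fun t => sub_state (W t) (W 0)); split.
  apply: (trajectory_primitive FeH feH GeH geH YpH yH FzH fzH GzH gzH FwH fwH GwH gwH BH bH b'H).
  by move=> t t0; rewrite !curve_at1/= !mul0r !addr0 add0r sub0r; have := z_int t t0; lra.
move=> t t0; have c31 : 1 + c3 != 0 by rewrite gt_eqF// addr_gt0.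
apply: (trajectory_op FeH feH GeH geH FzH fzH GzH gzH FwH fwH GwH gwH t0 B0 b0 b'0) => //.
- exact: b'E.
- by have := z_at0 t t0; rewrite addr0.
- exact: z_int.
- by have := e_at0 t t0; rewrite addr0 !mul1r.
- have := e_at1 t t0; rewrite /xe (addrC 1) (addrC (-1)) => ->; ring.
- by have := w_at0 t t0; rewrite !mul1r /ew => ->; rewrite /a; ring.
- have := w_at1 t t0; rewrite (addrC 1) (addrC (-1)) => ->; rewrite /xw; field.
  exact: c31.
Qed.
End existence.

Theorem theorem3p1 (R : realType) (q c0 c1 c2 c3 : R) :
  0 < q -> 0 < c0 < 1 -> 0 < c1 -> 0 < c2 -> 0 < c3 ->
  forall U0 : state R, inX U0 -> s_Y U0 0 = - c0 * s_eps U0 0 ->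
  exists U : R -> state R,
    [/\ mild_solution q c0 c1 c2 c3 U0 U,
        forall U' : R -> state R, mild_solution q c0 c1 c2 c3 U0 U' ->
          forall t : R, 0 <= t -> Xdist (U' t) (U t) = 0 &
        exists M mu : R, [/\ 0 < M, 0 < mu &
          forall t : R, 0 <= t -> Xnorm (U t) <= M * expR (- mu * t)]].
Proof.
move=> _ c0_bounds c1_gt0 c2_gt0 c3_gt0 U0 U0X compat0.
have [U mU] := mild_solution_exists q c1 c2 c0_bounds c3_gt0 U0X compat0.
exists U; split => //.
  by move=> U' mU' t t0; exact: (mild_solution_unique c0_bounds c1_gt0 c2_gt0 c3_gt0 U0X mU mU').
have [C [m [C0 m0 stable]]] := solution_stable q c0_bounds c1_gt0 c2_gt0 c3_gt0.
have [cU _ [V [VU opV]]] := mU.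
(* The added 1 keeps the constant positive when the initial state is 0. *)
exists (C * Xnorm (U 0) + 1), m; split => // [|t t0].
  by rewrite ltr_wpDl// mulr_ge0 ?Xnorm_ge0// ltW.
apply: le_trans (stable U V _ t t0) _; first by split.
by rewrite ler_wpM2r ?expR_ge0// lerDl.
Qed.
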